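(* Let $d\ge 1$, $L>0$, $\sigma^2>0$, and assume the regression model of the context: $Y=m(\mathbf X)+\varepsilon$ with $\mathbf X$ uniform on $[0,1]^d$, $m$ $L$-Lipschitz, and $\varepsilon$ centred with conditional variance at most $\sigma^2$. Let $m_{\infty,n}$ be the infinite median forest estimate with subsample size $a_n$ and level $k$, where $a_n2^{-k}\ge 4$. Then there is a constant $C_1>0$ depending only on $d$ such that, for all $n$ and all $\mathbf x\in[0,1]^d$, $$\mathbb E\big[m_{\infty,n}(\mathbf x)-m(\mathbf x)\big]^2\le 2\sigma^2\frac{2^k}{n}+dL^2C_1\Big(1-\frac{3}{4d}\Big)^k .$$ In addition, let $\beta=1-\frac{3}{4d}$. There are constants $C_3\in\mathbb R$ and $C_4,C>0$, depending only on $d$, $L$, $\sigma$, such that the following hold. The right-hand side above, as a function of a real variable $k$, is minimal for $$k_n=\frac{1}{\ln 2-\ln\beta}\big[\ln(n)+C_3\big],$$ and this level is allowed (that is, $a_n2^{-k_n}\ge4$) under the condition that $a_n\ge C_4\,n^{\frac{\ln 2}{\ln 2-\ln\beta}}$. For these choices of $k_n$ and $a_n$ (the level of the trees being the integer part of $k_n$), for all $n$ for which these parameters are admissible and all $\mathbf x\in[0,1]^d$, $$\mathbb E\big[m_{\infty,n}(\mathbf x)-m(\mathbf x)\big]^2\le C\,n^{\frac{\ln\beta}{\ln 2-\ln\beta}} .$$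
   Context: Model. $\mathcal D_n=\{(\mathbf X_1,Y_1),\dots,(\mathbf X_n,Y_n)\}$ are i.i.d. copies of a $[0,1]^d\times\mathbb R$-valued pair $(\mathbf X,Y)$ with $\mathbb E[Y^2]<\infty$, and $m(\mathbf x)=\mathbb E[Y\mid\mathbf X=\mathbf x]$. It is assumed that $Y=m(\mathbf X)+\varepsilon$, where $\varepsilon$ is a centred noise ($\mathbb E[\varepsilon\mid\mathbf X]=0$) with $\mathbb V[\varepsilon\mid\mathbf X=\mathbf x]\le\sigma^2$ for a finite constant $\sigma^2$, that $\mathbf X$ is uniformly distributed on $[0,1]^d$, and that $m$ is $L$-Lipschitz continuous. Median tree with subsample size $a_n\le n$ and level $k$ (a nonnegative integer with $a_n2^{-k}\ge4$). First select uniformly without replacement $a_n$ points of $\mathcal D_n$; only these are used. Start from the cell $[0,1]^d$. To split a cell, select a coordinate uniformly at random in $\{1,\dots,d\}$ (independently of everything else), and cut the cell, perpendicularly to that coordinate, at the empirical median along this coordinate of the selected points in the cell. The empirical median of $p$ real variables with increasingly ordered values $X_{(1)}<\dots<X_{(p)}$ and empirical distribution function $F_p$ is the unique $X_{(\ell)}$ with $F_p(X_{(\ell-1)})\le 1/2<F_p(X_{(\ell)})$ (with the convention $F_p(X_{(0)})=0$). The data point at which the split is performed is not sent down to either resulting cell. Repeat on the resulting cells until each cell has been cut exactly $k$ times, so that the tree is a complete binary tree of depth $k$. At a query point $\mathbf x$, the tree estimate $m_n(\mathbf x,\Theta)$ is the average of the $Y_i$ over the selected data points that have been sent down to the leaf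 cell containing $\mathbf x$. Here $\Theta$ denotes all the randomness of the construction (subsampling and choice of coordinates); it is independent of $\mathcal D_n$. Infinite median forest estimate: $m_{\infty,n}(\mathbf x)=\mathbb E_\Theta[m_n(\mathbf x,\Theta)]$, the expectation being over $\Theta$ only, conditionally on $\mathcal D_n$. Parameters are admissible when $a_n$ is an integer with $a_n\le n$, the level $k$ is a nonnegative integer, and $a_n2^{-k}\ge4$. *)

(* Defs.v *)
From mathcomp Require Import all_boot all_order all_algebra.
From mathcomp Require Import all_classical all_reals all_analysis.
Set Implicit Arguments.
Unset Strict Implicit.
Unset Printing Implicit Defensive.
Import Order.TTheory GRing.Theory Num.Theory.
Local Open Scope classical_set_scope.
Local Open Scope ring_scope.

(* Points of R^d are d-tuples, which carry the product sigma-algebra. *)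

Definition in_cube (R : realType) (d : nat) (x : d.-tuple R) : Prop :=
  forall j : 'I_d, 0 <= tnth x j <= 1.

Definition euclidean_dist (R : realType) (d : nat) (x y : d.-tuple R) : R :=
  Num.sqrt (\sum_(j < d) (tnth x j - tnth y j) ^+ 2).

Definition lipschitz_on_cube (R : realType) (d : nat) (L : R)
    (m : d.-tuple R -> R) : Prop :=
  forall x y : d.-tuple R, in_cube x -> in_cube y ->
    `|m x - m y| <= L * euclidean_dist x y.

(* The law of X is the d-dimensional Lebesgue measure on the cube, i.e. the
   d-fold product of the restriction of lebesgue_measure to [0,1]; a product
   measure is determined by its values on measurable rectangles. *)
Definition uniform_on_cube (R : realType) (d : nat) (disp : measure_display)
    (T : measurableType disp) (P : probability T R)
    (X : {RV P >-> d.-tuple R}) : Prop :=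
  forall A : 'I_d -> set R, (forall j, measurable (A j)) ->
    P (X @^-1` [set x | forall j, A j (tnth x j)]) =
    (\prod_(j < d) lebesgue_measure (A j `&` `[0%R, 1%R]))%E.
Arguments uniform_on_cube {R d disp T} P X.

(* W is a version of E[Z | X] = E[Z | sigma(X)]. *)
Definition is_cond_exp (R : realType) (disp disp' : measure_display)
    (T : measurableType disp) (T' : measurableType disp')
    (P : probability T R) (X : {RV P >-> T'}) (Z W : T -> R) : Prop :=
  [/\ P.-integrable setT (EFin \o Z),
      P.-integrable setT (EFin \o W),
      forall B : set R, measurable B ->
        preimage_set_system setT X measurable (W @^-1` B)
    & forall A : set T', measurable A ->
        (\int[P]_(w in X @^-1` A) (W w)%:E =
         \int[P]_(w in X @^-1` A) (Z w)%:E)%E].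
Arguments is_cond_exp {R disp disp' T T'} P X Z W.

(* V is a version of V[Z | X] = E[(Z - E[Z | X])^2 | X]. *)
Definition is_cond_var (R : realType) (disp disp' : measure_display)
    (T : measurableType disp) (T' : measurableType disp')
    (P : probability T R) (X : {RV P >-> T'}) (Z V : T -> R) : Prop :=
  exists W : T -> R,
    is_cond_exp P X Z W /\ is_cond_exp P X (fun w => (Z w - W w) ^+ 2) V.
Arguments is_cond_var {R disp disp' T T'} P X Z V.

(* m is a total function of which only the values on the cube matter; the noise
   is Y - m(X). *)
Record regression_model (R : realType) (d : nat) (disp : measure_display)
    (T : measurableType disp) (P : probability T R)
    (X : {RV P >-> d.-tuple R}) (Y : {RV P >-> R}) (m : d.-tuple R -> R)
    (L sigma : R) : Prop := RegressionModel {
  rm_cube : forall w, in_cube (X w);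
  rm_uniform : uniform_on_cube P X;
  rm_square_integrable : ('E_P[(fun w => Y w ^+ 2)%R] < +oo)%E;
  rm_regression : is_cond_exp P X Y (m \o X);
  rm_lipschitz : lipschitz_on_cube L m;
  rm_noise_centred : is_cond_exp P X (fun w => Y w - m (X w)) (cst 0);
  rm_noise_variance : exists V : T -> R,
    is_cond_var P X (fun w => Y w - m (X w)) V /\
    {ae P, forall w, V w <= sigma ^+ 2} }.
Arguments regression_model {R d disp T} P X Y m L sigma.

(* Independence of subfamilies is the case B i = setT for the other indices. *)
Definition iid_copies (R : realType) (d : nat) (disp : measure_display)
    (T : measurableType disp) (P : probability T R)
    (X0 : {RV P >-> d.-tuple R}) (Y0 : {RV P >-> R}) (n : nat)
    (X : 'I_n -> {RV P >-> d.-tuple R}) (Y : 'I_n -> {RV P >-> R}) : Prop :=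
  (forall (i : 'I_n) (B : set (d.-tuple R * R)), measurable B ->
     P [set w | B (X i w, Y i w)] = P [set w | B (X0 w, Y0 w)]) /\
  (forall B : 'I_n -> set (d.-tuple R * R), (forall i, measurable (B i)) ->
     P [set w | forall i, B i (X i w, Y i w)] =
     (\prod_(i < n) P [set w | B i (X i w, Y i w)])%E).
Arguments iid_copies {R d disp T} P X0 Y0 {n} X Y.

Definition ecdf (R : realType) (s : seq R) (t : R) : R :=
  (count (fun v => v <= t) s)%:R / (size s)%:R.

(* F l is F_p(X_(l)), with F_p(X_(0)) = 0, where X_(l) is the entry of index
   l - 1 of the sorted sequence. *)
Definition emp_median (R : realType) (s : seq R) : R :=
  let v := sort <=%R s in
  let F l := if l is l'.+1 then ecdf s v`_l' else 0 in
  v`_(find (fun l => F l <= 2^-1 < F l.+1) (iota 0 (size s))).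

(* A coordinate for each internal node of the complete binary tree of depth k:
   the one of the root, then those of the left and of the right subtree.  The
   coordinates are i.i.d. uniform under the uniform law on this finite type. *)
Fixpoint split_coords (d k : nat) : finType :=
  if k is k'.+1 then ('I_d * (split_coords d k' * split_coords d k'))%type
  else unit.

(* Among the points xs i, i \in I, of a cell containing x, those sent down to
   the leaf cell containing x.  The strict inequalities discard the point at
   which the split is performed.  The convention for a query point lying on a
   cut, and the one for ties between data points, concern null events. *)
Fixpoint leaf_points (R : realType) (d n : nat) (xs : 'I_n -> d.-tuple R)
    (x : d.-tuple R) (k : nat) : split_coords d k -> {set 'I_n} -> {set 'I_n} :=
  match k return split_coords d k -> {set 'I_n} -> {set 'I_n} with
  | 0 => fun _ I => I
  | k'.+1 => fun c I =>
      let: (j, (cl, cr)) := c in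
      let z := emp_median [seq tnth (xs i) j | i <- enum I] in
      if tnth x j <= z
      then leaf_points xs x cl [set i in I | tnth (xs i) j < z]%SET
      else leaf_points xs x cr [set i in I | z < tnth (xs i) j]%SET
  end.

(* theta is the pair formed by the subsample and the coordinates; the average
   is 0 if the leaf contains no point (a null event in admissible regimes). *)
Definition tree_estimate (R : realType) (d n k : nat)
    (xs : 'I_n -> d.-tuple R) (ys : 'I_n -> R) (x : d.-tuple R)
    (theta : {set 'I_n} * split_coords d k) : R :=
  let I := leaf_points xs x theta.2 theta.1 in
  (\sum_(i in I) ys i) / #|I|%:R.

Definition forest_randomness (d n a k : nat) :
    {set {set 'I_n} * split_coords d k} :=
  [set theta : {set 'I_n} * split_coords d k | #|theta.1| == a]%SET.

(* theta is uniform on the finite set forest_randomness d n a k. *)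
Definition forest_estimate (R : realType) (d n a k : nat)
    (xs : 'I_n -> d.-tuple R) (ys : 'I_n -> R) (x : d.-tuple R) : R :=
  (\sum_(theta in forest_randomness d n a k) tree_estimate xs ys x theta) /
  #|forest_randomness d n a k|%:R.

Definition forest_risk (R : realType) (d : nat) (disp : measure_display)
    (T : measurableType disp) (P : probability T R) (m : d.-tuple R -> R)
    (n : nat) (X : 'I_n -> {RV P >-> d.-tuple R}) (Y : 'I_n -> {RV P >-> R})
    (a k : nat) (x : d.-tuple R) : \bar R :=
  ('E_P[(fun w => (forest_estimate a k (fun i => X i w) (fun i => Y i w) x
                   - m x) ^+ 2)%R])%E.
Arguments forest_risk {R d disp T} P m {n} X Y a k x.

Definition admissible (R : realType) (n a k : nat) : Prop :=
  (a <= n)%N /\ (4 : R) <= a%:R / 2 ^+ k.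

Definition beta_rate (R : realType) (d : nat) : R := 1 - 3 / (4 * d%:R).

Definition risk_bound (R : realType) (d : nat) (C1 L sigma : R) (n : nat)
    (k : R) : R :=
  2 * sigma ^+ 2 * (2 `^ k / n%:R) + d%:R * L ^+ 2 * C1 * beta_rate R d `^ k.

Definition optimal_level (R : realType) (d : nat) (C3 : R) (n : nat) : R :=
  (ln n%:R + C3) / (ln 2 - ln (beta_rate R d)).

(* Main.v *)
(* A leaf of a tree contains at least a_n 2^-k - 2 >= a_n 2^-k / 2 selected
   points, and every data point is selected with probability a_n / n; hence all
   the weights of the forest estimate are at most 2 * 2^k / n.  The weights
   depend on X_1, ..., X_n only, so the noise contributes at most
   sigma^2 max_i w_i to the risk.  The squared bias is at most L^2 times the
   mean squared diameter of the leaf of x.  When a cell with p points is cut at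
   the empirical median of one coordinate, the expected squared length of the
   longer half is 1/4 + O(p^{-1/2}) times the previous one.  The numbers of
   points grow geometrically from the leaves up, so the correction terms are
   summable over the levels and the product is at most C_1 (1 - 3/(4d))^k.

   Everything is computed on a grid with M slots per axis.  If, along each
   axis, the data points and x lie in distinct slots, then the tree depends only
   on the pattern of slots; the M^(dn) patterns are equally likely, so the
   moments are finite sums; the other patterns have probability O(1/M), and
   replacing points by corners of the grid costs O(1/M). *)
Require Import Defs.
From mathcomp Require Import all_boot all_order all_algebra all_fingroup.
From mathcomp Require Import all_classical all_reals all_analysis.
From mathcomp Require Import measurable_realfun zify ring lra.
Set Implicit Arguments.
Unset Strict Implicit.
Unset Printing Implicit Defensive.
Import Order.TTheory GRing.Theory Num.Theory.
Import HBNNSimple.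
Local Open Scope classical_set_scope.
Local Open Scope ring_scope.

(** The cuts depend on the points, so the usual argument that the points of a cell are uniform in it
    given the previous cuts would need conditioning on continuous data. On patterns it becomes a
    symmetry: a weight restricted to one cut slot and one set of points sent to a child is still
    invariant under exchanges of slots inside the child box. The recursion over the levels is an
    induction over all weights with this invariance.

    The factor 1/4 comes from [max x y = (x + y + |x - y|) / 2]. For the two sides left by a median
    cut of a cell with p points, the mean of [x * y] is a binomial sum in closed form, and it makes
    the mean of [|x - y| ^ 2] at most [(x + y) ^ 2 / (p + 1)]. Since the longer side is bounded, the
    child that contains x is irrelevant and the estimate is uniform in x. *)

(** * Binomial convolutions *)

(** Counts the subsets of size [s + t + 1] of [h] slots by the position [z] of their element with
    [s] elements below it. *)
Lemma sum_bin_mul (s t h : nat) :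
  (\sum_(z < h) 'C(z, s) * 'C(h.-1 - z, t))%N = 'C(h, s + t + 1).
Proof.
elim: h s t => [|h IH] s t; first by rewrite big_ord0 addn1 bin0n.
case: t => [|t].
  rewrite addn0 addn1.
  under eq_bigr do rewrite bin0 muln1.
  elim: h.+1 => [|g IHg]; first by rewrite big_ord0 bin0n.
  by rewrite big_ord_recr /= IHg [RHS]binS.
rewrite big_ord_recr /= subnn bin0n muln0 addn0.
have -> : (s + t.+1 + 1 = (s + t + 1).+1)%N by lia.
rewrite binS; have <- := IH s t.
have <- : (s + t.+1 + 1 = (s + t + 1).+1)%N by lia.
rewrite -IH -big_split /=; apply: eq_bigr => z _.
rewrite -mulnDr; congr muln; have hz := ltn_ord z.
have -> : (h - z = (h.-1 - z).+1)%N by lia.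
by rewrite binS addnC.
Qed.

(** Absorption, [z.+1 * 'C(z, s) = s.+1 * 'C(z.+1, s.+1)] and likewise for [h - z], reduces this to
    the previous convolution at [s.+1], [t.+1], [h.+2], whose two extreme terms vanish. The factors
    will be the two sides left by a cut at slot [z]. *)
Lemma sum_bin_mul_gap (s t h : nat) :
  (\sum_(z < h) ('C(z, s) * 'C(h.-1 - z, t)) * (z.+1 * (h - z)))%N =
  (s.+1 * t.+1 * 'C(h.+2, s + t + 3))%N.
Proof.
have -> : (s + t + 3 = s.+1 + t.+1 + 1)%N by lia.
rewrite -sum_bin_mul big_ord_recl big_ord_recr /= bin0n mul0n add0n.
rewrite /bump /= subnn bin0n muln0 addn0 big_distrr /=.
apply: eq_bigr => z _; have hz := ltn_ord z.
have -> : (h - z = (h.-1 - z).+1)%N by lia.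
have -> : (h.+1 - (1 + z) = (h.-1 - z).+1)%N by lia.
rewrite add1n.
have E1 := mul_bin_diag z.+1 s; have E2 := mul_bin_diag (h.-1 - z).+1 t.
by rewrite [RHS]mulnACA -E1 -E2 [LHS]mulnC mulnACA.
Qed.

(** * Patterns of slots and medians *)

Definition ord_itv (M lo hi : nat) : {set 'I_M} :=
  [set u : 'I_M | (lo <= u < hi)%N]%SET.

Lemma card_ord_itv (M lo hi : nat) : (hi <= M)%N ->
  #|ord_itv M lo hi| = (hi - lo)%N.
Proof.
move=> hM; rewrite -sum1dep_card.
rewrite -(big_mkord (fun u => (lo <= u < hi)%N) (fun=> 1%N)).
rewrite sum1_count /index_iota subn0.
rewrite -[RHS](size_iota lo) -size_filter.
apply/perm_size/uniq_perm; rewrite ?filter_uniq ?iota_uniq// => u.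
by rewrite mem_filter !mem_iota; lia.
Qed.

(** Such a set is [z] with a free choice of [s] slots below it and [t] slots above it; [f] glues the
    two choices. *)
Lemma card_sets_with_order_stat (M lo hi s t : nat) (z : 'I_M) :
  (lo <= z < hi)%N -> (hi <= M)%N ->
  #|[set K : {set 'I_M} | [&& K \subset ord_itv M lo hi, #|K| == (s + t + 1)%N,
      z \in K & #|K :&: ord_itv M lo z| == s]]%SET| =
  ('C(z - lo, s) * 'C(hi - z.+1, t))%N.
Proof.
move=> hz hM; have hzM := ltn_ord z.
rewrite -(card_ord_itv lo (ltnW hzM)) -(card_ord_itv z.+1 hM).
rewrite -!cards_draws -cardsX.
set D := finset.setX _ _.
pose f (A : {set 'I_M} * {set 'I_M}) := (z |: (A.1 :|: A.2))%SET.
have fI A : A \in D -> (f A :&: ord_itv M lo z = A.1)%SET /\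
    (f A :&: ord_itv M z.+1 hi = A.2)%SET.
  rewrite !inE => /andP[/andP[/fintype.subsetP h1 _] /andP[/fintype.subsetP h2 _]].
  split; apply/finset.setP => u; rewrite !inE.
    have := h1 u; have := h2 u; rewrite !inE -val_eqE /=.
    by case: (u \in A.1); case: (u \in A.2) => /=; lia.
  have := h1 u; have := h2 u; rewrite !inE -val_eqE /=.
  by case: (u \in A.1); case: (u \in A.2) => /=; lia.
have finj : {in D &, injective f}.
  move=> [A1 A2] [B1 B2] hA hB e.
  have [a1 a2] := fI _ hA; have [b1 b2] := fI _ hB.
  by move: a1 a2; rewrite e b1 b2 /= => -> ->.
rewrite -(card_in_imset finj); apply: eq_card => K; rewrite inE.
apply/idP/finset.imsetP.
  move=> /and4P[/fintype.subsetP hK /eqP cK zK /eqP cs].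
  exists (K :&: ord_itv M lo z, K :&: ord_itv M z.+1 hi)%SET; last first.
    apply/finset.setP => u; rewrite !inE -val_eqE /=.
    have := hK u; rewrite !inE.
    have [->|] := eqVneq u z; first by rewrite zK eqxx.
    by rewrite -val_eqE /=; case: (u \in K) => /=; lia.
  rewrite !inE /= !finset.subsetIr cs eqxx /=.
  have e : K = (z |: ((K :&: ord_itv M lo z) :|: (K :&: ord_itv M z.+1 hi)))%SET.
    apply/finset.setP => u; rewrite !inE -val_eqE /=.
    have := hK u; rewrite !inE.
    have [->|] := eqVneq u z; first by rewrite zK eqxx.
    by rewrite -val_eqE /=; case: (u \in K) => /=; lia.
  move: cK; rewrite {1}e cardsU1 (_ : z \notin _ = true); last by rewrite !inE; lia.
  rewrite cardsU.
  rewrite (_ : (_ :&: _ :&: (_ :&: _) = finset.set0)%SET); last first.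
    by apply/finset.setP => u; rewrite !inE; case: (u \in K) => //=; lia.
  by rewrite cards0 cs subn0; set w := #|_|; rewrite (_ : nat_of_bool true = 1%N)//; lia.
move=> [[A1 A2] hA ->].
have [/= e1 e2] := fI _ hA; rewrite e1.
move: hA; rewrite !inE /= => /andP[/andP[/fintype.subsetP h1 /eqP c1]].
move=> /andP[/fintype.subsetP h2 /eqP c2].
rewrite c1 !eqxx /= andbT; apply/andP; split.
  apply/fintype.subsetP => u; rewrite !inE; case/or3P => [/eqP->|/h1|/h2]; rewrite ?inE; lia.
rewrite /f /= cardsU1 inE cardsU c1 c2.
rewrite (_ : (A1 :&: A2 = finset.set0)%SET) ?cards0; last first.
  apply/finset.setP => u; rewrite !inE; apply/negbTE/negP => /andP[/h1 + /h2].
  by rewrite !inE; lia.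
have -> : (z \in A1) = false by apply/negbTE/negP => /h1; rewrite !inE; lia.
have -> : (z \in A2) = false by apply/negbTE/negP => /h2; rewrite !inE; lia.
by rewrite /=; lia.
Qed.

(** Induction on the size: a point where [f] is largest has the top rank, and removing it leaves the
    other ranks unchanged. *)
Lemma exists_rank (I : finType) (f : I -> nat) (S : {set I}) (r : nat) :
  {in S &, injective f} -> (r < #|S|)%N ->
  exists2 i, i \in S & #|[set i' in S | (f i' < f i)%N]%SET| = r.
Proof.
move: {2}#|S| (erefl #|S|) => m; elim: m S => [|m IH] S cS finj hr.
  by move: hr; rewrite cS.
have [i0 i0S] : exists i, i \in S by apply/card_gt0P; rewrite cS.
have [i1 i1S hmax] := arg_maxnP f i0S.
have cD : #|S :\ i1| = m by have := cardsD1 i1 S; rewrite (i1S : i1 \in S) cS; lia.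
have [->|rm] := eqVneq r m.
  exists i1 => //; rewrite -cD; apply: eq_card => i; rewrite !inE.
  have [iS|_] := boolP (i \in S); rewrite ?andbF//= andbT.
  have h : (f i <= f i1)%N := hmax i iS; have [->|ne] := eqVneq i i1; first by rewrite ltnn.
  rewrite ltn_neqAle h andbT; apply/negP => /eqP e.
  by move: ne; rewrite (finj _ _ iS i1S e) eqxx.
have [|||i iS <-] := IH (S :\ i1); rewrite ?cD//; last 2 first.
- by move: hr; rewrite cS => hr; lia.
- exists i; first by move: iS; rewrite !inE => /andP[].
  apply: eq_card => k; rewrite !inE.
  have [->|//] := eqVneq k i1; rewrite (i1S : i1 \in S) /=.
  by move: iS; rewrite !inE => /andP[_ /hmax] /= h; rewrite ltnNge h.
by move=> i k; rewrite !inE => /andP[_ iS] /andP[_ kS]; exact: finj.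
Qed.

Lemma rank_inj (I : finType) (f : I -> nat) (S : {set I}) (i k : I) :
  {in S &, injective f} -> i \in S -> k \in S ->
  #|[set i' in S | (f i' < f i)%N]%SET| = #|[set i' in S | (f i' < f k)%N]%SET| ->
  i = k.
Proof.
move=> finj; wlog ik : i k / (f i < f k)%N.
  move=> h iS kS e; case: (ltngtP (f i) (f k)) => [lt|gt|]; last exact: finj.
    exact: h.
  by apply/esym/h.
move=> iS kS e; suff : (#|[set i' in S | (f i' < f i)%N]%SET| <
    #|[set i' in S | (f i' < f k)%N]%SET|)%N by rewrite e ltnn.
apply/proper_card/fintype.properP; split.
  by apply/fintype.subsetP => x; rewrite !inE => /andP[-> /=]; lia.
by exists i; rewrite !inE ?iS ?ik ?ltnn.
Qed.

(** [c i j] is the slot of data point [i] along axis [j]. *)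
Definition pattern (n d M : nat) := {ffun 'I_n -> {ffun 'I_d -> 'I_M}}.

Section pattern_cells.
Variables (n d M : nat).
Implicit Types (c : pattern n d M) (S : {set 'I_n}) (j : 'I_d).

Definition below c S j (z : nat) : {set 'I_n} :=
  [set i in S | (c i j < z)%N]%SET.

Definition above c S j (z : nat) : {set 'I_n} :=
  [set i in S | (z < c i j)%N]%SET.

(* The junk value M occurs only if S is empty or has ties. *)
Definition cell_median c S j : nat :=
  if [pick i in S | #|below c S j (c i j)| == #|S|./2] is Some i then c i j
  else M.

Lemma cell_median_le c S j : (cell_median c S j <= M)%N.
Proof. by rewrite /cell_median; case: pickP => // i _; exact: ltnW. Qed.

Definition coord_inj c S : Prop := forall j, {in S &, injective (c^~ j)}.

Lemma cell_medianE c S j i : {in S &, injective (c^~ j)} -> i \in S ->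
  #|below c S j (c i j)| = #|S|./2 -> cell_median c S j = c i j.
Proof.
move=> cinj iS ri; rewrite /cell_median; case: pickP => [k /andP[kS /eqP rk]|].
  rewrite (@rank_inj _ (fun i => c i j) S i k)//; last by rewrite -/(below _ _ _ _) ri.
  by move=> a b aS bS e; apply: cinj => //; exact: val_inj.
by move=> /(_ i); rewrite iS ri eqxx.
Qed.

Lemma cell_medianP c S j : {in S &, injective (c^~ j)} -> (0 < #|S|)%N ->
  exists i, [/\ i \in S, #|below c S j (c i j)| = #|S|./2 &
                cell_median c S j = c i j].
Proof.
move=> cinj S0.
have [||i iS ri] := @exists_rank _ (fun i => c i j) S #|S|./2.
- by move=> a b aS bS e; apply: cinj => //; exact: val_inj.
- by rewrite ltn_half_double // -addnn -[X in (X < _)%N]addn0 ltn_add2l.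
by exists i; split=> //; exact: cell_medianE.
Qed.

Definition swap j (u v : 'I_M) c : pattern n d M :=
  [ffun i => [ffun j' => if j' == j then tperm u v (c i j') else c i j']].

Lemma swapK j u v : involutive (swap j u v).
Proof.
move=> c; apply/ffunP => i; apply/ffunP => j'; rewrite !ffunE.
by case: eqP => // _; rewrite tpermK.
Qed.

(* Replaces the conditional law of the points of a cell, given the cuts made so
   far: invariance of a weight under exchanges of slots inside a box passes to
   the children of the box, and already determines the law of the order
   statistics. *)
Definition swap_invariant (R : Type) (mu : pattern n d M -> R)
    (lo hi : 'I_d -> nat) : Prop :=
  forall j (u v : 'I_M), (lo j <= u < hi j)%N -> (lo j <= v < hi j)%N ->
  forall c, mu (swap j u v c) = mu c.

Definition in_box c S (lo hi : 'I_d -> nat) : Prop :=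
  forall i j, i \in S -> (lo j <= c i j < hi j)%N.

End pattern_cells.

Section order_statistic_law.
Variables (R : realType) (n d M : nat) (mu : pattern n d M -> R).
Variables (lo hi : 'I_d -> nat) (S : {set 'I_n}) (j : 'I_d).
Hypothesis mu_inv : swap_invariant mu lo hi.
Hypothesis mu_supp : forall c, mu c != 0 ->
  in_box c S lo hi /\ coord_inj c S.
Hypothesis hiM : (hi j <= M)%N.

Let img (c : pattern n d M) : {set 'I_M} := [set c i j | i in S]%SET.
Let mass (K : {set 'I_M}) : R := \sum_(c | img c == K) mu c.
Let full (K : {set 'I_M}) := (K \subset ord_itv M (lo j) (hi j)) && (#|K| == #|S|).

Let mass_swap (K : {set 'I_M}) (u v : 'I_M) :
  (lo j <= u < hi j)%N -> (lo j <= v < hi j)%N ->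
  mass (tperm u v @: K) = mass K.
Proof.
move=> hu hv; rewrite /mass (reindex_inj (can_inj (swapK j u v))) /=.
apply: eq_big => [c|c _]; last exact: mu_inv.
have -> : img (swap j u v c) = (tperm u v @: img c)%SET.
  rewrite /img -imset_comp; apply: eq_imset => i /=.
  by rewrite !ffunE eqxx.
by rewrite (inj_eq (imset_inj (@perm_inj _ _))).
Qed.

(** [K] is turned into [K'] by exchanging one slot at a time, which preserves [mass]; the induction
    is on the number of slots of [K] outside [K']. *)
Let mass_const (K K' : {set 'I_M}) : full K -> full K' -> mass K = mass K'.
Proof.
move: {2}#|K :\: K'| (erefl #|K :\: K'|) => r.
elim: r K => [|r IH] K cD /andP[sK /eqP cK] /andP[sK' /eqP cK'].
  congr mass; apply/eqP; rewrite eqEcard cK cK' leqnn andbT.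
  by rewrite -finset.setD_eq0 -cards_eq0 cD.
have cD' : #|K' :\: K| = r.+1.
  by have := cardsID K K'; have := cardsID K' K; rewrite finset.setIC cD cK cK'; lia.
have [u] : exists u, u \in (K :\: K')%SET by apply/card_gt0P; rewrite cD.
rewrite !inE => /andP[uK' uK].
have [v] : exists v, v \in (K' :\: K)%SET by apply/card_gt0P; rewrite cD'.
rewrite !inE => /andP[vK vK'].
have hu := fintype.subsetP sK _ uK; have hv := fintype.subsetP sK' _ vK'.
rewrite !inE in hu hv.
rewrite -(mass_swap K hu hv)//.
have e : (tperm u v @: K = v |: (K :\ u))%SET.
  apply/finset.setP => x; rewrite -{1}(tpermK u v x) mem_imset; last exact: perm_inj.
  rewrite !inE; case: tpermP => [->|->|/eqP xu /eqP xv].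
  - by rewrite (negbTE vK) eqxx orbF; apply/esym/negbTE; apply: contraNneq vK => <-.
  - by rewrite uK eqxx.
  - by rewrite (negbTE xv) xu.
apply: IH.
- rewrite e; have := cardsD1 u (K :\: K')%SET; rewrite cD !inE uK uK' /= => -[->].
  apply: eq_card => x; rewrite !inE.
  have [->|xv] := eqVneq x v; first by rewrite vK' (negbTE vK) /= andbF.
  by rewrite /= andbCA.
- rewrite /full card_imset ?cK ?eqxx ?andbT; last exact: perm_inj.
  rewrite e; apply/fintype.subsetP => x; rewrite !inE.
  by case/orP => [/eqP->//|/andP[_ /(fintype.subsetP sK)]]; rewrite inE.
- by rewrite /full sK' cK' eqxx.
Qed.

Let full_supp c : mu c != 0 -> full (img c).
Proof.
move=> /mu_supp[hb hi']; apply/andP; split.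
  by apply/fintype.subsetP => x /finset.imsetP[i iS ->]; rewrite inE; exact: hb.
by rewrite card_in_imset//; exact: hi'.
Qed.

Let is_med (K : {set 'I_M}) (z : 'I_M) :=
  (z \in K) && (#|K :&: ord_itv M (lo j) z| == #|S|./2).

(** By [mass_const] the set of slots occupied along [j] is uniform among the subsets of size [#|S|]
    of the side of the box. The median is its element of rank [#|S|./2], and
    [card_sets_with_order_stat] counts the sets with a given one. The binomial on the left replaces
    a division, so that the zero weight is covered too. *)
Lemma order_statistic_law (g : nat -> R) : (0 < #|S|)%N ->
  'C(hi j - lo j, #|S|)%:R * (\sum_c mu c * g (cell_median c S j)) =
  (\sum_c mu c) * \sum_(z < hi j - lo j)
    ('C(z, #|S|./2) * 'C((hi j - lo j).-1 - z, #|S|.-1 - #|S|./2))%:R *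
      g (lo j + z)%N.
Proof.
move=> S0.
have [K0 K0f|noK] := pickP full; last first.
  have mu0 c : mu c = 0.
    by apply/eqP; apply/negPn/negP => /full_supp; rewrite noK.
  have -> : \sum_c mu c = 0 by rewrite big1.
  by rewrite mul0r big1 ?mulr0// => c _; rewrite mu0 mul0r.
have massE K : full K -> mass K = mass K0 by move=> fK; exact: mass_const.
have mass0 K : ~~ full K -> mass K = 0.
  move=> nK; rewrite /mass big1// => c /eqP ec; apply/eqP/negPn/negP.
  by move=> /full_supp; rewrite ec (negbTE nK).
have tot (Q : pred {set 'I_M}) : \sum_(c | Q (img c)) mu c =
    #|[set K | full K && Q K]%SET|%:R * mass K0.
  rewrite (partition_big img Q) //=.
  rewrite (bigID full) /= [X in _ + X]big1 ?addr0; last first.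
    move=> K /andP[QK nK]; rewrite -[RHS](mass0 K nK); apply: eq_bigl => c.
    by case: eqP => [->|]; rewrite ?QK// andbF.
  rewrite -sum1dep_card natr_sum mulr_suml; apply: eq_big => K; first by rewrite andbC.
  move=> /andP[QK fK]; rewrite mul1r -(massE K fK); apply: eq_bigl => c.
  by case: eqP => [->|]; rewrite ?QK// andbF.
(* On the support exactly one slot is the median of the occupied set. Written as a sum over [z], the
   term allows the sums over [c] and [z] to be exchanged. *)
have medE c : mu c * g (cell_median c S j) =
    \sum_(z : 'I_M | is_med (img c) z) mu c * g z.
  have [->|nz] := eqVneq (mu c) 0.
    by rewrite mul0r big1// => z _; rewrite mul0r.
  have [hb cinj] := mu_supp nz.
  have [i [iS ri ei]] := cell_medianP (cinj j) S0.
  have rk k : k \in S -> #|img c :&: ord_itv M (lo j) (c k j)| = #|below c S j (c k j)|.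
    move=> kS; rewrite -(card_in_imset (D := below c S j (c k j)) (f := c^~ j)); last first.
      by move=> a b; rewrite !inE => /andP[aS _] /andP[bS _]; exact: cinj.
    apply: eq_card => z; rewrite !inE; apply/idP/finset.imsetP.
      by move=> /andP[/finset.imsetP[a aS ->] h]; exists a => //; rewrite inE aS; lia.
    move=> [a]; rewrite !inE => /andP[aS h] ->.
    have -> /= : c a j \in img c by apply/finset.imsetP; exists a.
    by have := hb a j aS; lia.
  rewrite (big_pred1 (c i j)) ?ei// => z /=; apply/idP/eqP => [/andP[]|->].
    move=> /finset.imsetP[k kS ->]; rewrite rk// => /eqP ek; congr (c _ j).
    apply: (@rank_inj _ (fun i => c i j : nat) S) => //.
      by move=> a b aS bS e; apply: (cinj j) => //; exact: val_inj.
    by rewrite -!/(below _ _ _ _) ri ek.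
  have ci : c i j \in img c by apply/finset.imsetP; exists i.
  by rewrite /is_med ci rk// ri eqxx.
have -> : \sum_c mu c * g (cell_median c S j) =
    mass K0 * \sum_(z : 'I_M) #|[set K | full K && is_med K z]%SET|%:R * g z.
  under eq_bigr do rewrite medE.
  rewrite (exchange_big_dep xpredT)//= mulr_sumr; apply: eq_bigr => z _.
  by rewrite -mulr_suml (tot (is_med^~ z)) mulrA [mass _ * _]mulrC.
have -> : \sum_c mu c = 'C(hi j - lo j, #|S|)%:R * mass K0.
  rewrite (tot xpredT) -(card_ord_itv (lo j) hiM) -cards_draws.
  by congr (_%:R * _); apply: eq_card => K; rewrite !inE andbT.
rewrite -!mulrA; congr (_ * (_ * _)).
set h := (hi j - lo j)%N.
have cnt (z : 'I_M) : (lo j <= z < hi j)%N -> #|[set K | full K && is_med K z]%SET| =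
    ('C(z - lo j, #|S|./2) * 'C(hi j - z.+1, #|S|.-1 - #|S|./2))%N.
  move=> hz; rewrite -(card_sets_with_order_stat _ _ hz hiM).
  apply: eq_card => K; rewrite !inE /full /is_med -!andbA.
  by have -> : (#|S|./2 + (#|S|.-1 - #|S|./2) + 1 = #|S|)%N by lia.
rewrite (bigID (fun z : 'I_M => (lo j <= z < hi j)%N)) /= [X in _ + X]big1 ?addr0; last first.
  move=> z nz; rewrite (_ : #|_| = 0%N) ?mul0r//; apply/eqP; rewrite cards_eq0.
  apply/eqP/finset.setP => K; rewrite !inE; apply/negbTE/negP.
  by move=> /andP[/andP[/fintype.subsetP sK _] /andP[/sK]]; rewrite inE (negbTE nz).
under eq_bigr => z hz do rewrite cnt//.
rewrite -(big_mkord (fun z => (lo j <= z < hi j)%N)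
  (fun z => ('C(z - lo j, #|S|./2) * 'C(hi j - z.+1, #|S|.-1 - #|S|./2))%:R * g z)).
rewrite -(big_mkord xpredT
  (fun z => ('C(z, #|S|./2) * 'C(h.-1 - z, #|S|.-1 - #|S|./2))%:R * g (lo j + z)%N)).
have [lh|hl] := leqP (lo j) (hi j); last first.
  by rewrite big_pred0 ?big_geq// => [|z]; rewrite ?/h; lia.
rewrite (@big_cat_nat _ _ _ (lo j)) //=; last exact: leq_trans hiM.
rewrite big_nat_cond big_pred0 ?add0r; last by move=> z; lia.
rewrite (@big_cat_nat _ _ _ (hi j)) //=.
rewrite [X in _ + X]big_nat_cond [X in _ + X]big_pred0 ?addr0; last by move=> z; lia.
rewrite -{1}[lo j]add0n big_addn -/h big_nat_cond [RHS]big_nat_cond.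
apply: eq_big => [z|z /andP[hz _]]; first by rewrite /h; lia.
by congr ((_ * _)%:R * g _); [congr 'C(_, _)|congr 'C(_, _)|]; rewrite /h in hz *; lia.
Qed.

End order_statistic_law.

(* AM-GM: 2 (x + y) |x - y| <= t (x + y)^2 + |x - y|^2 / t. *)
Lemma max_sqr_le (R : realFieldType) (x y t : R) : 0 <= x -> 0 <= y -> 0 < t ->
  (Num.max x y) ^+ 2 <= (1 / 4 + t / 4) * (x + y) ^+ 2 +
                        (1 / (4 * t) + 1 / 4) * ((x + y) ^+ 2 - 4 * (x * y)).
Proof.
move=> x0 y0 t0; set s := x + y; pose D := `|x - y|.
have -> : Num.max x y = (s + D) / 2.
  rewrite /s /D; case: (leP x y) => h.
    by rewrite distrC ger0_norm ?subr_ge0//; field.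
  by rewrite gtr0_norm ?subr_gt0//; field.
have -> : s ^+ 2 - 4 * (x * y) = D ^+ 2 by rewrite real_normK ?num_real// /s; ring.
have h : 0 <= (t * s - D) ^+ 2 / (4 * t) by rewrite divr_ge0 ?sqr_ge0//; lra.
rewrite -subr_ge0; apply: le_trans h _.
rewrite le_eqVlt; apply/orP; left; apply/eqP; field.
by rewrite gt_eqF.
Qed.

(** * Mean squared length of the longer side after one median cut *)

Section split_moment.
Variables (R : realType) (n d M : nat) (mu : pattern n d M -> R).
Variables (lo hi : 'I_d -> nat) (S : {set 'I_n}) (j : 'I_d).
Hypothesis mu_ge0 : forall c, 0 <= mu c.
Hypothesis mu_inv : swap_invariant mu lo hi.
Hypothesis mu_supp : forall c, mu c != 0 ->
  in_box c S lo hi /\ coord_inj c S.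
Hypothesis hiM : (hi j <= M)%N.
Hypothesis S0 : (0 < #|S|)%N.

Let H := ((hi j).+1 - lo j)%N.

Lemma supp_card_le c : mu c != 0 -> (#|S| <= hi j - lo j)%N.
Proof.
move=> /mu_supp[hb hc]; rewrite -(card_in_imset (hc j)) -(card_ord_itv (lo j) hiM).
apply/subset_leq_card/fintype.subsetP => x /finset.imsetP[i iS ->].
by rewrite inE; exact: hb.
Qed.

(* The sides are enlarged by one slot: cutting at slot z leaves sides z - lo + 1
   and hi - z, whose sum is H = hi - lo + 1, and their product then has an exact
   mean, by a Vandermonde convolution. *)
Lemma gap_moment :
  #|S|%:R * H%:R ^+ 2 * (\sum_c mu c) <=
  4 * #|S|.+1%:R * \sum_c mu c *
    (((cell_median c S j).+1 - lo j) * (hi j - cell_median c S j))%:R.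
Proof.
have [c0 nz0|mu0] := pickP (fun c => mu c != 0); last first.
  have e c : mu c = 0 by apply/eqP; have := mu0 c; case: eqP.
  rewrite !big1 ?mulr0// => c _; rewrite e ?mul0r//.
have pH := supp_card_le nz0.
set h := (hi j - lo j)%N in pH.
have eH : H = h.+1 by rewrite /H /h; lia.
have p0 := S0; set p := #|S| in pH p0 *; set s := p./2; set t := (p.-1 - s)%N.
have law := order_statistic_law mu_inv mu_supp hiM
  (fun z => ((z.+1 - lo j) * (hi j - z))%:R) S0.
rewrite /= -/h -/p -/s -/t in law.
set A := \sum_c _ in law *; set m := \sum_c mu c in law *.
have m0 : 0 <= m by apply: sumr_ge0.
have eB : (\sum_(z < h) ('C(z, s) * 'C(h.-1 - z, t))%:R *
    (((lo j + z).+1 - lo j) * (hi j - (lo j + z)))%:R : R) =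
    (s.+1 * t.+1 * 'C(h.+2, p.+2))%:R.
  have -> : p.+2 = (s + t + 3)%N by rewrite /t /s; lia.
  rewrite -sum_bin_mul_gap natr_sum; apply: eq_bigr => z _.
  by rewrite -natrM; congr (_ * (_ * _))%:R; rewrite /h; lia.
rewrite eB in law.
have C0 : (0 < 'C(h, p))%N by rewrite bin_gt0.
have e2 : (p.+2 * p.+1 * 'C(h.+2, p.+2) = h.+2 * h.+1 * 'C(h, p))%N.
  have h1 := mul_bin_diag h.+2 p.+1; have h2 := mul_bin_diag h.+1 p.
  by rewrite /= in h1 h2; rewrite mulnAC -h1 -mulnA [('C(_, _) * p.+1)%N]mulnC -h2 mulnA.
have e3 : (p * p.+2 <= 4 * (s.+1 * t.+1))%N by rewrite /t /s; nia.
have key : (p * p.+2 * (h.+1 * h.+1) * 'C(h, p) <=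
    4 * (p.+2 * p.+1) * (s.+1 * t.+1 * 'C(h.+2, p.+2)))%N.
  rewrite [leqRHS](_ : _ = 4 * (s.+1 * t.+1) * (p.+2 * p.+1 * 'C(h.+2, p.+2)))%N; last by ring.
  rewrite e2 mulnA [leqRHS]mulnA leq_mul2r; apply/orP; right.
  by rewrite -[leqLHS]mulnA; apply: leq_mul => //; rewrite leq_mul2r leqnSn orbT.
have CR : (0 : R) < 'C(h, p)%:R by rewrite ltr0n.
have pR : (0 : R) < p.+2%:R by rewrite ltr0n.
rewrite -(ler_pM2l CR) -(ler_pM2l pR).
have -> : p.+2%:R * ('C(h, p)%:R * (4 * p.+1%:R * A)) =
  4 * (p.+2%:R * p.+1%:R) * ('C(h, p)%:R * A) by ring.
rewrite law eH.
have -> : p.+2%:R * ('C(h, p)%:R * (p%:R * h.+1%:R ^+ 2 * m)) =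
   (p * p.+2 * (h.+1 * h.+1) * 'C(h, p))%:R * m by rewrite !natrM; ring.
have -> : 4 * (p.+2%:R * p.+1%:R) * (m * (s.+1 * t.+1 * 'C(h.+2, p.+2))%:R) =
  (4 * (p.+2 * p.+1) * (s.+1 * t.+1 * 'C(h.+2, p.+2)))%:R * m.
  by rewrite !natrM; ring.
by rewrite ler_wpM2r// ler_nat.
Qed.

(** [max_sqr_le] is used with [t = (3 / 4) ^+ r]. By [gap_moment] the squared difference of the
    sides has mean at most [H ^ 2 / #|S|.+1], and [#|S|.+1 >= 3 * 2 ^ r]; this is at most
    [t ^ 2 / 3] times [H ^ 2], because [(9 / 16) * 2 >= 1], so that dividing by [t] still leaves a
    multiple of [t]. The ratio 3/4 is a rational number between [2 ^ (- 1 / 2)] and 1, which keeps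
    the corrections summable over [r]. *)
Lemma split_moment (r : nat) : (4 * 2 ^ r <= #|S|.+2)%N ->
  \sum_c mu c *
    (maxn ((cell_median c S j).+1 - lo j) (hi j - cell_median c S j))%:R ^+ 2 <=
  (1 / 4 + (3 / 4) ^+ r / 2) * H%:R ^+ 2 * (\sum_c mu c).
Proof.
move=> hr; set t : R := (3 / 4) ^+ r; set m := \sum_c mu c.
have m0 : 0 <= m by apply: sumr_ge0.
have t0 : 0 < t by rewrite exprn_gt0//; lra.
have t1 : t <= 1 by rewrite exprn_ile1//; lra.
have gap := gap_moment; rewrite -/m in gap.
pose g (c : pattern n d M) : R := (((cell_median c S j).+1 - lo j) * (hi j - cell_median c S j))%:R.

have step c : mu c * (maxn ((cell_median c S j).+1 - lo j) (hi j - cell_median c S j))%:R ^+ 2 <=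
    mu c * ((1 / 4 + t / 4) * H%:R ^+ 2 +
            (1 / (4 * t) + 1 / 4) * (H%:R ^+ 2 - 4 * g c)).
  have [->|nz] := eqVneq (mu c) 0; first by rewrite !mul0r.
  apply: ler_wpM2l => //; have [hb hc] := mu_supp nz.
  have [i [iS _ ei]] := cell_medianP (hc j) S0.
  have := hb i j iS; rewrite -ei /g; set z := cell_median c S j => hz.
  have := @max_sqr_le R (z.+1 - lo j)%:R (hi j - z)%:R t (ler0n _ _) (ler0n _ _) t0.
  rewrite -natrD -natrM.
  have -> : (z.+1 - lo j + (hi j - z) = H)%N by rewrite /H; lia.
  by rewrite natr_max.
apply: le_trans (ler_sum _ (fun c _ => step c)) _.
under eq_bigr do rewrite mulrDr.
rewrite big_split /= -mulr_suml -/m.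
under eq_bigr do rewrite mulrCA mulrBr [mu _ * (4 * _)]mulrCA.
rewrite -mulr_sumr big_split /= -mulr_suml -/m sumrN -mulr_sumr.
set G := \sum_c mu c * g c; rewrite -/G in gap.
set p1 : R := #|S|.+1%:R in gap *.
have p10 : 0 < p1 by rewrite ltr0n.
have ep : #|S|%:R = p1 - 1 by rewrite /p1 -natr1 addrK.
have ht : p1^-1 <= t ^+ 2 / 3.
  have h1 : 3 * 2 ^+ r <= p1.
    rewrite /p1 -natrX -natrM ler_nat; have : (0 < 2 ^ r)%N by rewrite expn_gt0.
    by lia.
  have h2 : (0 : R) < 2 ^+ r by rewrite exprn_gt0.
  have h3 : 1 <= t ^+ 2 * 2 ^+ r.
    by rewrite /t -exprM mulnC exprM -exprMn exprn_ege1//; lra.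
  rewrite -[leLHS]mul1r ler_pdivrMr//.
  by apply: le_trans h3 _; rewrite -[_ / 3 * _]mulrA ler_wpM2l ?sqr_ge0//; lra.
have hg : H%:R ^+ 2 * m - 4 * G <= t ^+ 2 / 3 * (H%:R ^+ 2 * m).
  apply: (@le_trans _ _ (p1^-1 * (H%:R ^+ 2 * m))).
    rewrite -(ler_pM2l p10) mulVKf ?gt_eqF//.
    by rewrite ep in gap; lra.
  by rewrite ler_wpM2r// mulr_ge0// exprn_ge0.
set q := H%:R ^+ 2 * m in hg.
have q0 : 0 <= q by rewrite mulr_ge0// exprn_ge0.
rewrite [X in X + _](_ : _ = (1 / 4 + t / 4) * q); last by rewrite /q; ring.
rewrite [leRHS](_ : _ = (1 / 4 + t / 2) * q); last by rewrite /q; ring.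
rewrite [m * _]mulrC -/q.
have ht4 : (1 / (4 * t) + 1 / 4) * (q - 4 * G) <= (1 / (4 * t) + 1 / 4) * (t ^+ 2 / 3 * q).
  by rewrite ler_wpM2l// addr_ge0// divr_ge0//; lra.
have e4 : (1 / (4 * t) + 1 / 4) * (t ^+ 2 / 3 * q) = (t / 12 + t ^+ 2 / 12) * q.
  by field; rewrite gt_eqF.
rewrite e4 in ht4.
have : t ^+ 2 * q <= t * q by rewrite ler_wpM2r// expr2 ger_pMl.
move: ht4; set w := (1 / (4 * t) + 1 / 4) * _ => ht4 h5.
have : 0 <= t * q by rewrite mulr_ge0// ltW.
by lra.
Qed.

End split_moment.

Definition upd (d : nat) (f : 'I_d -> nat) (j : 'I_d) (z : nat) : 'I_d -> nat :=
  fun j' => if j' == j then z else f j'.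

(** * Length of the sides of the leaf of x *)

Section children.
Variables (n d M : nat).
Implicit Types (c : pattern n d M) (S : {set 'I_n}) (j : 'I_d).

Definition child (b : bool) c S j (z : nat) : {set 'I_n} :=
  if b then below c S j z else above c S j z.

(** Slot [z], which holds the point of the cut, belongs to neither child box. *)
Definition child_lo (b : bool) (lo : 'I_d -> nat) j (z : nat) :=
  if b then lo else upd lo j z.+1.

Definition child_hi (b : bool) (hi : 'I_d -> nat) j (z : nat) :=
  if b then upd hi j z else hi.

Lemma card_below_above c S j i : {in S &, injective (c^~ j)} -> i \in S ->
  (#|below c S j (c i j)| + #|above c S j (c i j)|).+1 = #|S|.
Proof.
move=> cinj iS; rewrite (cardsD1 i S) iS add1n; congr _.+1.
rewrite -cardsUI (_ : _ :&: _ = finset.set0)%SET ?cards0 ?addn0; last first.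
  by apply/finset.setP => k; rewrite !inE; case: (k \in S) => //=; lia.
apply: eq_card => k; rewrite !inE.
have [->|ne] := eqVneq k i; first by rewrite !ltnn !andbF.
case kS: (k \in S) => //=; rewrite -neq_ltn; apply/eqP => e.
by move: ne; rewrite (cinj k i) ?eqxx//; exact: val_inj.
Qed.

(** In other words [#|S|.+2] is at worst halved by a cut. Hence the form [4 * 2 ^ k <= #|S|.+2] of
    the size hypotheses, which passes from a cell with [k.+1] levels left to its children. *)
Lemma card_child b c S j : {in S &, injective (c^~ j)} -> (0 < #|S|)%N ->
  (#|S| <= (#|child b c S j (cell_median c S j)|).*2.+2)%N.
Proof.
move=> cinj S0; have [i [iS ri ei]] := cell_medianP cinj S0.
have := card_below_above cinj iS; rewrite /child ei.
by case: (b); lia.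
Qed.

Lemma child_sub b c S j z : child b c S j z \subset S.
Proof. by apply/fintype.subsetP => i; case: (b); rewrite inE => /andP[]. Qed.

(** Along another axis the exchange does not touch coordinate [j]. Along [j] itself both slots are
    on the same side of [z] and differ from it, so no comparison with [z] changes. *)
Lemma child_swap b c S j z j1 (u v : 'I_M) (lo hi : 'I_d -> nat) :
  coord_inj c S -> (0 < #|S|)%N -> cell_median c S j = z ->
  (child_lo b lo j z j1 <= u < child_hi b hi j z j1)%N ->
  (child_lo b lo j z j1 <= v < child_hi b hi j z j1)%N ->
  cell_median (swap j1 u v c) S j = z /\
  child b (swap j1 u v c) S j z = child b c S j z.
Proof.
move=> cinj S0 medz; have [ej hu hv|nej _ _] := eqVneq j1 j; last first.
  have e i : swap j1 u v c i j = c i j by rewrite !ffunE eq_sym (negbTE nej).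
  have eb z' : below (swap j1 u v c) S j z' = below c S j z'.
    by apply/finset.setP => i; rewrite !inE e.
  have ea z' : above (swap j1 u v c) S j z' = above c S j z'.
    by apply/finset.setP => i; rewrite !inE e.
  split; last by case: (b); rewrite /child ?eb ?ea.
  by rewrite -medz /cell_median; under eq_pick do rewrite e eb; case: pickP => // i _; rewrite e.
have sinj : {in S &, injective ((swap j1 u v c)^~ j)}.
  move=> i k iS kS; rewrite !ffunE -ej eqxx => /perm_inj; exact: cinj.
have uv (x : 'I_M) : ((tperm u v x < z) = (x < z))%N /\ ((z < tperm u v x) = (z < x))%N.
  move: hu hv; rewrite ej /child_lo /child_hi /upd; case: (b); rewrite !eqxx.
    by case: tpermP => [->|->|//] h1 h2; split; lia.
  by case: tpermP => [->|->|//] h1 h2; split; lia.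
have eb : below (swap j1 u v c) S j z = below c S j z.
  by apply/finset.setP => i; rewrite !inE !ffunE -ej eqxx (uv _).1.
have ea : above (swap j1 u v c) S j z = above c S j z.
  by apply/finset.setP => i; rewrite !inE !ffunE -ej eqxx (uv _).2.
split; last by case: (b); rewrite /child ?eb ?ea.
have [i [iS ri ei]] := cell_medianP (cinj j) S0.
have zi : swap j1 u v c i j = z :> nat.
  by have := uv (c i j); rewrite !ffunE ej eqxx -medz ei; lia.
by rewrite -zi; apply: cell_medianE => //; rewrite zi eb -medz ei.
Qed.

Section leaf.
Variables (c : pattern n d M) (q : 'I_d -> nat).

(** Slot version of [leaf_points], where [q] holds the slots of the query point. The test is strict
    because [tnth x j <= tnth (xs i) j] becomes [q j < c i j] when the slots differ. *)
Fixpoint leaf_set (k : nat) : split_coords d k -> {set 'I_n} -> {set 'I_n} :=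
  match k return split_coords d k -> {set 'I_n} -> {set 'I_n} with
  | 0 => fun _ S => S
  | k'.+1 => fun theta S =>
      let: (j, (tl, tr)) := theta in
      let z := cell_median c S j in
      if (q j < z)%N then leaf_set tl (child true c S j z)
      else leaf_set tr (child false c S j z)
  end.

(* A box with h slots along axis l counts for h + 1, as in gap_moment. *)
Fixpoint leaf_side (l : 'I_d) (k : nat) : split_coords d k -> {set 'I_n} ->
    ('I_d -> nat) -> ('I_d -> nat) -> nat :=
  match k return split_coords d k -> {set 'I_n} ->
    ('I_d -> nat) -> ('I_d -> nat) -> nat with
  | 0 => fun _ _ lo hi => ((hi l).+1 - lo l)%N
  | k'.+1 => fun theta S lo hi =>
      let: (j, (tl, tr)) := theta in
      let z := cell_median c S j in
      if (q j < z)%N then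
        leaf_side l tl (child true c S j z) (child_lo true lo j z) (child_hi true hi j z)
      else
        leaf_side l tr (child false c S j z) (child_lo false lo j z) (child_hi false hi j z)
  end.

End leaf.
End children.

(* Factor r is for a cut with r further levels below it, made in a cell with at
   least 4 * 2^(r + 1) - 2 points. *)
Definition median_contraction (R : realType) (d k : nat) : R :=
  \prod_(r < k) (1 - d%:R^-1 + d%:R^-1 * (1 / 4 + (3 / 4) ^+ r.+1 / 2)).

Section leaf_side_moment.
Variables (R : realType) (n d M : nat) (q : 'I_d -> nat) (l : 'I_d).

Let bound (k : nat) : R := #|split_coords d k|%:R * median_contraction R d k.

Let good (mu : pattern n d M -> R) (S : {set 'I_n}) (lo hi : 'I_d -> nat) : Prop :=
  [/\ forall c, 0 <= mu c, swap_invariant mu lo hi,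
      forall c, mu c != 0 -> in_box c S lo hi /\ coord_inj c S &
      forall j, (hi j <= M)%N].

Let side (lo hi : 'I_d -> nat) : R := ((hi l).+1 - lo l)%:R.

(** Patterns are grouped by the slot [z] of the cut and the set [A] of points sent to the child.
    Within a group the box and the point set of the child are fixed, and the restricted weight
    satisfies the hypotheses of the induction by [child_swap]. *)
Let child_moment (b : bool) (k : nat) (mu : pattern n d M -> R) (S : {set 'I_n})
    (lo hi : 'I_d -> nat) (j : 'I_d) :
  (forall mu S lo hi, good mu S lo hi -> (4 * 2 ^ k <= #|S|.+2)%N ->
     \sum_theta \sum_c mu c *
       (leaf_side c q l (theta : split_coords d k) S lo hi)%:R ^+ 2 <=
     bound k * side lo hi ^+ 2 * \sum_c mu c) ->
  good mu S lo hi -> (4 * 2 ^ k.+1 <= #|S|.+2)%N ->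
  \sum_theta \sum_(c | (q j < cell_median c S j)%N == b)
    mu c * (let z := cell_median c S j in
      leaf_side c q l (theta : split_coords d k) (child b c S j z)
       (child_lo b lo j z) (child_hi b hi j z))%:R ^+ 2 <=
  bound k * \sum_(c | (q j < cell_median c S j)%N == b) mu c *
    side (child_lo b lo j (cell_median c S j)) (child_hi b hi j (cell_median c S j)) ^+ 2.
Proof.
move=> IH [mu0 inv supp hM] hk.
have k0 : (0 < 2 ^ k)%N by rewrite expn_gt0.
have S0 : (0 < #|S|)%N by rewrite expnS in hk; lia.
(* The first component lies in ['I_M.+1] since [cell_median] may take the default value [M]. *)
pose key (c : pattern n d M) : 'I_M.+1 * {set 'I_n} :=
  (inord (cell_median c S j), child b c S j (cell_median c S j)).
have keyE c : nat_of_ord (key c).1 = cell_median c S j.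
  by rewrite /= inordK// ltnS cell_median_le.
rewrite exchange_big /= (partition_big key (fun K => (q j < K.1)%N == b)) /=; last first.
  by move=> c; rewrite keyE.
rewrite [X in _ <= _ * X](partition_big key (fun K => (q j < K.1)%N == b)) /=; last first.
  by move=> c; rewrite keyE.
rewrite mulr_sumr; apply: ler_sum => -[z A] /= hz.
(* The unnormalised conditional weight given the cut and the child; no division by its total mass is
   needed. *)
pose mu' c := mu c * (key c == (z, A))%:R.
have -> : \sum_(c | ((q j < cell_median c S j)%N == b) && (key c == (z, A)))
     mu c * side (child_lo b lo j (cell_median c S j))
                 (child_hi b hi j (cell_median c S j)) ^+ 2 =
    side (child_lo b lo j z) (child_hi b hi j z) ^+ 2 * \sum_c mu' c.
  rewrite mulr_sumr big_mkcond /=; apply: eq_bigr => c _; rewrite /mu'.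
  have [e|] := eqVneq (key c) (z, A); last by rewrite andbF !mulr0.
  have ez : cell_median c S j = z by rewrite -keyE e.
  by rewrite ez hz /= mulr1 mulrC.
rewrite mulrA.
rewrite [leLHS](_ : _ = \sum_theta \sum_c mu' c *
  (leaf_side c q l (theta : split_coords d k) A
     (child_lo b lo j z) (child_hi b hi j z))%:R ^+ 2); last first.
  rewrite [RHS]exchange_big /= big_mkcond /=; apply: eq_bigr => c _; rewrite /mu'.
  have [e|] := eqVneq (key c) (z, A); last first.
    by rewrite andbF big1// => theta _; rewrite mulr0 mul0r.
  have ez : cell_median c S j = z by rewrite -keyE e.
  have eA : child b c S j z = A by move: e; rewrite /key ez => -[].
  by rewrite ez hz eA /= mulr1.
have [c0 nz0|mu'0] := pickP (fun c => mu' c != 0); last first.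
  have e c : mu' c = 0 by apply/eqP; have := mu'0 c; case: eqP.
  rewrite [X in _ * X]big1 ?mulr0// big1// => theta _; rewrite big1// => c _.
  by rewrite e mul0r.
have mu'P c : mu' c != 0 -> [/\ mu c != 0, cell_median c S j = z & child b c S j z = A].
  rewrite /mu'; have [e|] := eqVneq (key c) (z, A); last by rewrite mulr0 eqxx.
  rewrite mulr1 => nz; have ez : cell_median c S j = z by rewrite -keyE e.
  by split=> //; move: e; rewrite /key ez => -[].
have [nz0' med0 A0] := mu'P _ nz0; have [hb0 hc0] := supp _ nz0'.
have [i0 [i0S _ ei0]] := cell_medianP (hc0 j) S0.
have zbox : (lo j <= z < hi j)%N by rewrite -med0 ei0; exact: hb0.
have sub x j1 : (child_lo b lo j z j1 <= x < child_hi b hi j z j1)%N -> (lo j1 <= x < hi j1)%N.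
  rewrite /child_lo /child_hi /upd; case: (b) => /=; case: eqP => // ->; lia.
apply: IH; last first.
  by have := card_child b (hc0 j) S0; rewrite med0 A0; rewrite expnS in hk; lia.
split.
- by move=> c; rewrite mulr_ge0.
- have imp j1 (u v : 'I_M) c : (child_lo b lo j z j1 <= u < child_hi b hi j z j1)%N ->
      (child_lo b lo j z j1 <= v < child_hi b hi j z j1)%N ->
      mu c != 0 -> key c = (z, A) -> key (swap j1 u v c) = (z, A).
    move=> hu hv nz e; have ez : cell_median c S j = z by rewrite -keyE e.
    have eA : child b c S j z = A by move: e; rewrite /key ez => -[].
    have [m1 m2] := child_swap (supp _ nz).2 S0 ez hu hv.
    by rewrite /key m1 m2 eA; congr pair; apply: val_inj; rewrite /= inordK.
  move=> j1 u v hu hv c; rewrite /mu' (inv _ _ _ (sub _ _ hu) (sub _ _ hv)).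
  have [->|nz] := eqVneq (mu c) 0; first by rewrite !mul0r.
  congr (_ * _%:R); congr nat_of_bool; apply/eqP/eqP; last exact: imp.
  (* The converse is [imp] for the exchanged pattern, [swap] being an involution. *)
  move=> /(imp j1 u v _ hu hv); rewrite swapK; apply.
  by rewrite (inv _ _ _ (sub _ _ hu) (sub _ _ hv)).
- move=> c /mu'P[nz ez eA]; have [hb hc] := supp _ nz.
  split; last first.
    move=> j1 i k' iA kA; apply: hc; apply: (fintype.subsetP (child_sub b c S j z)); rewrite eA//.
  move=> i j1; rewrite -eA => iA.
  have iS := fintype.subsetP (child_sub b c S j z) _ iA; have := hb i j1 iS.
  move: iA; rewrite /child /child_lo /child_hi /upd; case: (b); rewrite inE => /andP[_];
    by case: eqP => // ->; lia.
- move=> j1; rewrite /child_hi /upd; case: (b) => //; case: eqP => // _.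
  by rewrite -ltnS.
Qed.

Lemma sum_split_coords (k : nat) (F : split_coords d k.+1 -> R) :
  \sum_theta F theta = \sum_(j < d) \sum_(tl : split_coords d k)
    \sum_(tr : split_coords d k) F (j, (tl, tr)).
Proof.
under [RHS]eq_bigr => j _ do rewrite pair_big /=.
by rewrite pair_big /=; apply: eq_bigr => -[j [tl tr]].
Qed.

Lemma median_contraction_ge0 k : (0 < d)%N -> 0 <= median_contraction R d k.
Proof.
move=> d0; apply: prodr_ge0 => r _; rewrite addr_ge0//.
  by rewrite subr_ge0 invf_le1 ?ltr0n// ler1n.
Qed.

(** Induction from the root over all weights: one axis out of [d] yields the contraction of
    [split_moment], the others leave side [l] alone. The child containing the query point is bounded
    by the longer one, so nothing is assumed about [q]. *)
Lemma leaf_side_moment (k : nat) (mu : pattern n d M -> R) (S : {set 'I_n})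
    (lo hi : 'I_d -> nat) :
  (forall c, 0 <= mu c) -> swap_invariant mu lo hi ->
  (forall c, mu c != 0 -> in_box c S lo hi /\ coord_inj c S) ->
  (forall j, (hi j <= M)%N) -> (4 * 2 ^ k <= #|S|.+2)%N ->
  \sum_theta \sum_c mu c *
    (leaf_side c q l (theta : split_coords d k) S lo hi)%:R ^+ 2 <=
  #|split_coords d k|%:R * median_contraction R d k *
    ((hi l).+1 - lo l)%:R ^+ 2 * \sum_c mu c.
Proof.
rewrite -/(bound k) -/(side lo hi) => h1 h2 h3 h4.
have {h1 h2 h3 h4} : good mu S lo hi by [].
elim: k mu S lo hi => [|k IH] mu S lo hi gmu hk.
  rewrite /bound /median_contraction big_ord0 mulr1 card_unit mul1r.
  rewrite (big_pred1 tt)/=; last by case.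
  by rewrite -mulr_suml mulrC.
have d0 : (0 < d)%N by case: (d) l => // -[].
have k0 : (0 < 2 ^ k)%N by rewrite expn_gt0.
have S0 : (0 < #|S|)%N by rewrite expnS in hk; lia.
set N : R := #|split_coords d k|%:R.
set m := \sum_c mu c.
have [mu0 inv supp hM] := gmu.
have m0 : 0 <= m by apply: sumr_ge0.
pose side' b (c : pattern n d M) j :=
      side (child_lo b lo j (cell_median c S j)) (child_hi b hi j (cell_median c S j)).
pose rho : R := 1 / 4 + (3 / 4) ^+ k.+1 / 2.
(* The factor [N] comes from the coordinates of the subtree that the query point does not enter. *)
have step j : \sum_(tl : split_coords d k) \sum_(tr : split_coords d k)
    \sum_c mu c * (leaf_side c q l ((j, (tl, tr)) : split_coords d k.+1) S lo hi)%:R ^+ 2 <=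
    N * bound k * ((if j == l then rho else 1) * side lo hi ^+ 2 * m).
  pose T b (theta : split_coords d k) := \sum_(c | (q j < cell_median c S j)%N == b)
    mu c * (let z := cell_median c S j in
      leaf_side c q l theta (child b c S j z)
       (child_lo b lo j z) (child_hi b hi j z))%:R ^+ 2.
  have -> : \sum_(tl : split_coords d k) \sum_(tr : split_coords d k)
    \sum_c mu c * (leaf_side c q l ((j, (tl, tr)) : split_coords d k.+1) S lo hi)%:R ^+ 2 =
    N * (\sum_theta T true theta + \sum_theta T false theta).
    transitivity (\sum_(tl : split_coords d k)
        \sum_(tr : split_coords d k) (T true tl + T false tr)).
      apply: eq_bigr => tl _; apply: eq_bigr => tr _.
      rewrite (bigID (fun c => (q j < cell_median c S j)%N)) /=; congr (_ + _).
        by apply: eq_big => c; [rewrite eqb_id|move=> ->].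
      by apply: eq_big => c; [rewrite eqbF_neg|move=> /negbTE ->].
    under eq_bigr do rewrite big_split /= sumr_const.
    rewrite big_split /= sumr_const mulrDr sumrMnl !mulr_natl//.
  rewrite -mulrA ler_wpM2l//.
  apply: le_trans (lerD (child_moment true j IH gmu hk) (child_moment false j IH gmu hk)) _.
  have bk : 0 <= bound k by rewrite mulr_ge0// median_contraction_ge0.
  rewrite -mulrDr ler_wpM2l//.
  have -> : \sum_(c | (q j < cell_median c S j)%N == true) mu c * side' true c j ^+ 2 +
    \sum_(c | (q j < cell_median c S j)%N == false) mu c * side' false c j ^+ 2 =
    \sum_c mu c * side' (q j < cell_median c S j)%N c j ^+ 2.
    rewrite [RHS](bigID (fun c => (q j < cell_median c S j)%N)) /=; congr (_ + _).
      by apply: eq_big => c; [rewrite eqb_id|move=> /eqP ->].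
    by apply: eq_big => c; [rewrite eqbF_neg|move=> /eqP ->].
  have [ejl|njl] := eqVneq j l; last first.
    rewrite mul1r /m mulr_sumr; apply: ler_sum => c _; rewrite mulrC.
    rewrite /side' /side /child_lo /child_hi /upd.
    by case: (q j < _)%N; rewrite eq_sym (negbTE njl).
  rewrite ejl; apply: le_trans (split_moment mu0 inv supp (hM l) S0 hk).
  apply: ler_sum => c _; apply: ler_wpM2l => //.
  rewrite lerXn2r ?nnegrE// /side' /side ler_nat /child_lo /child_hi /upd.
  by case: (q l < _)%N; rewrite !eqxx ?leq_maxl// subSS leq_maxr.
rewrite sum_split_coords; apply: le_trans (ler_sum _ (fun j _ => step j)) _.
rewrite -mulr_sumr -!mulr_suml.
have -> : \sum_(j < d) (if j == l then rho else 1) = d%:R - 1 + rho.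
  rewrite (bigD1 l)//= eqxx addrC; congr (_ + _).
  rewrite (eq_bigr (fun=> 1)) => [|j /negbTE ->//].
  by rewrite sumr_const cardC1 card_ord -subn1 natrB.
rewrite le_eqVlt; apply/orP; left; apply/eqP.
rewrite /bound {2}/median_contraction big_ord_recr /= -/(median_contraction R d k) -/rho.
rewrite card_prod card_prod card_ord !natrM -/N.
have dn : d%:R != 0 :> R by rewrite pnatr_eq0 -lt0n.
by field.
Qed.

End leaf_side_moment.

(** With [t = (3 / 4) ^+ r.+1], a factor is [b + t / (2 d)], and [t / (2 d) <= 2 t b] because
    [b >= 1 / 4]. So it is at most [b * (1 + 2 t) <= b * expR (2 t)], and the sum of all [2 t] is at
    most 6. *)
Lemma median_contraction_le (R : realType) (d k : nat) : (0 < d)%N ->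
  median_contraction R d k <= expR 6 * beta_rate R d ^+ k.
Proof.
move=> d0; set b := beta_rate R d.
have d1 : 1 <= d%:R :> R by rewrite ler1n.
have dV : 0 < d%:R^-1 :> R by rewrite invr_gt0; lra.
have dV1 : d%:R^-1 <= 1 :> R by rewrite invf_le1; lra.
have eb : b = 1 - 3 / 4 * d%:R^-1 by rewrite /b /beta_rate; field; rewrite gt_eqF//; lra.
have b4 : 1 / 4 <= b by lra.
have step r : 1 - d%:R^-1 + d%:R^-1 * (1 / 4 + (3 / 4) ^+ r.+1 / 2) <=
    b * expR (2 * (3 / 4) ^+ r.+1).
  set t : R := (3 / 4) ^+ r.+1.
  have t0 : 0 <= t by rewrite exprn_ge0//; lra.
  have h : 1 + 2 * t <= expR (2 * t) by exact: expR_ge1Dx.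
  apply: (@le_trans _ _ (b * (1 + 2 * t))); last by rewrite ler_wpM2l//; lra.
  nra.
have geo : \sum_(r < k) 2 * (3 / 4) ^+ r.+1 <= 6 :> R.
  suff -> : \sum_(r < k) 2 * (3 / 4) ^+ r.+1 = 6 * (1 - (3 / 4) ^+ k) :> R.
    have : 0 <= (3 / 4) ^+ k :> R by rewrite exprn_ge0//; lra.
    by lra.
  elim: k => [|k IH]; first by rewrite big_ord0 expr0 subrr mulr0.
  by rewrite big_ord_recr /= IH exprS; field.
apply: (@le_trans _ _ (expR (\sum_(r < k) 2 * (3 / 4) ^+ r.+1) * b ^+ k)); last first.
  by rewrite ler_wpM2r ?ler_expR// exprn_ge0//; lra.
elim: k {geo} => [|k IH]; first by rewrite /median_contraction !big_ord0 expR0 expr0 mulr1.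
rewrite /median_contraction !big_ord_recr /= expRD [b ^+ _]exprSr mulrACA [_ * b]mulrC.
apply: ler_pM => //; first exact: median_contraction_ge0.
have : 0 <= (3 / 4) ^+ k.+1 :> R by rewrite exprn_ge0//; lra.
nra.
Qed.

(** * From real trees to trees on slots *)

(** Without ties [F l] is [l / size s], so [F l <= 1 / 2 < F l.+1] holds at the single index
    [l = (size s)./2]. *)
Lemma emp_medianE (R : realType) (s : seq R) (v : R) :
  uniq s -> v \in s -> count (< v) s = (size s)./2 -> emp_median s = v.
Proof.
move=> us vs cv; rewrite /emp_median; cbv zeta; set w := sort _ s; set a := (X in find X _).
have sw : sorted <%R w by rewrite lt_sorted_uniq_le sort_uniq us sort_le_sorted.
have zw : size w = size s by rewrite size_sort.
have cw b : count b w = count b s by apply/seq.permP; rewrite perm_sort.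
have rank (l : nat) : (l < size s)%N ->
    count (<= w`_l) s = l.+1 /\ count (< w`_l) s = l.
  move=> ls; rewrite -!cw -[X in count _ X](mkseq_nth 0) -[X in _ /\ count _ X = _](mkseq_nth 0).
  rewrite !count_map zw -!size_filter; split.
    rewrite -[RHS](size_iota 0) -(@filter_iota_ltn 0 (size s) l.+1)//.
    congr size; apply: eq_in_filter => i; rewrite mem_iota /= add0n => hi.
    by rewrite (lt_sorted_leq_nth _ sw) ?inE ?zw.
  rewrite -[RHS](size_iota 0) -(@filter_iota_ltn 0 (size s) l)//; last exact: ltnW.
  congr size; apply: eq_in_filter => i; rewrite mem_iota /= add0n => hi.
  by rewrite (lt_sorted_ltn_nth _ sw) ?inE ?zw.
have vw : v \in w by rewrite mem_sort.
have iv : (index v w < size s)%N by rewrite -zw index_mem.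
have ev : index v w = (size s)./2 by rewrite -cv -(rank _ iv).2 nth_index.
rewrite ev in iv.
suff -> : find a (iota 0 (size s)) = (size s)./2 by rewrite -ev nth_index.
set m := (size s)./2 in ev iv *.
have s0 : 0 < (size s)%:R :> R by rewrite ltr0n; lia.
have F (l : nat) : (l < size s)%N -> ecdf s w`_l = l.+1%:R / (size s)%:R.
  by move=> ls; rewrite /ecdf (rank _ ls).1.
have half (l : nat) : (l%:R / (size s)%:R <= 2^-1 :> R) = (l <= m)%N.
  by rewrite ler_pdivrMr// mulrC ler_pdivlMr// -natrM ler_nat /m; lia.
have am : a m.
  rewrite /a F// ltNge half -ltnNge ltnSn andbT.
  have <- : m%:R / (size s)%:R = (if m is m'.+1 then ecdf s w`_m' else 0 : R).
    case: (m) iv => [|m'] hm; first by rewrite mul0r.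
    by rewrite F//; lia.
  by rewrite half.
have hasa : has a (iota 0 (size s)) by apply/hasP; exists m; rewrite // mem_iota.
apply/eqP; rewrite eqn_leq; apply/andP; split.
  rewrite leqNgt; apply/negP => h; have := before_find 0%N h.
  by rewrite nth_iota// am.
rewrite leqNgt; apply/negP => h; set l := find _ _ in h.
have ls : (l < size s)%N by rewrite -[X in (_ < X)%N](size_iota 0) -has_find.
have := nth_find 0%N hasa; rewrite -/l nth_iota// add0n /a => /andP[_].
by rewrite F// ltNge half h.
Qed.

Section leaf_points_pattern.
Variables (R : realType) (n d M : nat) (c : pattern n d M) (q : 'I_d -> nat).

(** The construction only compares coordinates along one axis, so slots in the same order reproduce
    it. The size hypothesis keeps every cell that is cut nonempty and thus excludes the default
    values of both medians. *)
Lemma leaf_points_leaf_set (xs : 'I_n -> d.-tuple R) (x : d.-tuple R) (k : nat)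
    (theta : split_coords d k) (S : {set 'I_n}) :
  (forall i i' j, (tnth (xs i) j < tnth (xs i') j) = (c i j < c i' j)%N) ->
  (forall i j, (tnth x j <= tnth (xs i) j) = (q j < c i j)%N) ->
  coord_inj c S -> (4 * 2 ^ k <= #|S|.+2)%N ->
  leaf_points xs x theta S = leaf_set c q theta S.
Proof.
move=> hxs hx; elim: k theta S => [//|k IH] [j [tl tr]] S cinj hk.
have k0 : (0 < 2 ^ k)%N by rewrite expn_gt0.
have S0 : (0 < #|S|)%N by rewrite expnS in hk; lia.
have [i [iS ri ei]] := cell_medianP (cinj j) S0.
have cch b := card_child b (cinj j) S0.
have ich b : coord_inj c (child b c S j (cell_median c S j)).
  move=> j' a a' ha ha'; apply: cinj.
    exact: (fintype.subsetP (child_sub b c S j _)) ha.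
  exact: (fintype.subsetP (child_sub b c S j _)) ha'.
rewrite /=; have -> : emp_median [seq tnth (xs i) j | i <- enum S] = tnth (xs i) j.
  apply: emp_medianE.
  - rewrite map_inj_in_uniq ?enum_uniq// => a a'; rewrite !mem_enum => aS a'S e.
    have h1 := hxs a a' j; have h2 := hxs a' a j.
    rewrite e ltxx in h1; rewrite e ltxx in h2; move=> {e}.
    have e : c a j = c a' j :> nat by lia.
    exact: (cinj j _ _ aS a'S (ord_inj e)).
  - by apply/mapP; exists i; rewrite ?mem_enum.
  - rewrite count_map size_map -cardE -ri cardE -size_filter.
    apply: perm_size; apply: uniq_perm => [||a];
      [by rewrite filter_uniq ?enum_uniq|exact: enum_uniq|].
    by rewrite mem_filter !mem_enum [RHS]inE /= hxs andbC.
have hk' b : (4 * 2 ^ k <= #|child b c S j (cell_median c S j)|.+2)%N.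
  by have := cch b; rewrite expnS in hk; lia.
have IHb b t := IH t _ (ich b) (hk' b).
rewrite hx -ei; case: ifP => _.
  rewrite -[RHS](IHb true tl); congr leaf_points.
  by apply/finset.setP => a; rewrite !inE hxs ei.
rewrite -[RHS](IHb false tr); congr leaf_points.
by apply/finset.setP => a; rewrite !inE hxs ei.
Qed.

Lemma card_leaf_set (k : nat) (theta : split_coords d k) (S : {set 'I_n}) :
  coord_inj c S -> (4 * 2 ^ k <= #|S|.+2)%N ->
  (#|S|.+2 <= #|leaf_set c q theta S|.+2 * 2 ^ k)%N.
Proof.
elim: k theta S => [|k IH] theta S cinj hk; first by rewrite muln1.
have k0 : (0 < 2 ^ k)%N by rewrite expn_gt0.
have S0 : (0 < #|S|)%N by rewrite expnS in hk; lia.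
case: theta => j [tl tr].
have cch b := card_child b (cinj j) S0.
have ich b : coord_inj c (child b c S j (cell_median c S j)).
  move=> j' a a' ha ha'; apply: cinj.
    exact: (fintype.subsetP (child_sub b c S j _)) ha.
  exact: (fintype.subsetP (child_sub b c S j _)) ha'.
have step b (t : split_coords d k) : (#|S|.+2 <=
    #|leaf_set c q t (child b c S j (cell_median c S j))|.+2 * 2 ^ k.+1)%N.
  rewrite expnS in hk; have hS := cch b.
  have hk' : (4 * 2 ^ k <= #|child b c S j (cell_median c S j)|.+2)%N by lia.
  by have := IH t _ (ich b) hk'; rewrite expnS mulnCA; lia.
by rewrite /=; case: ifP => _; [exact: (step true)|exact: (step false)].
Qed.

(** Down to the leaf, the current box contains both [q] and the points of the cell; two slots of one
    box differ by less than its enlarged side. *)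
Lemma leaf_side_bound (l : 'I_d) (k : nat) (theta : split_coords d k)
    (S : {set 'I_n}) (lo hi : 'I_d -> nat) (i : 'I_n) :
  coord_inj c S -> in_box c S lo hi -> (4 * 2 ^ k <= #|S|.+2)%N ->
  (forall j, lo j <= q j < hi j)%N -> (forall i j, q j != c i j :> nat) ->
  i \in leaf_set c q theta S ->
  [/\ c i l < q l + leaf_side c q l theta S lo hi & q l < c i l + leaf_side c q l theta S lo hi]%N.
Proof.
move=> cinj hb hk hq qc.
elim: k theta S lo hi cinj hb hk hq => [|k IH] theta S lo hi cinj hb hk hq.
  by move=> /= iS; have := hb i l iS; have := hq l; split; lia.
have k0 : (0 < 2 ^ k)%N by rewrite expn_gt0.
have S0 : (0 < #|S|)%N by rewrite expnS in hk; lia.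
case: theta => j [tl tr].
have cch b := card_child b (cinj j) S0.
have [i0 [i0S _ ei]] := cell_medianP (cinj j) S0.
have ich b : coord_inj c (child b c S j (cell_median c S j)).
  move=> j' a a' ha ha'; apply: cinj.
    exact: (fintype.subsetP (child_sub b c S j _)) ha.
  exact: (fintype.subsetP (child_sub b c S j _)) ha'.
have hb' b : in_box c (child b c S j (cell_median c S j))
    (child_lo b lo j (cell_median c S j)) (child_hi b hi j (cell_median c S j)).
  move=> a j1 ha; have := hb a j1 (fintype.subsetP (child_sub b c S j _) _ ha).
  move: ha; rewrite /child /child_lo /child_hi /upd; case: (b); rewrite inE => /andP[_];
    by case: eqP => // ->; lia.
have hk' b : (4 * 2 ^ k <= #|child b c S j (cell_median c S j)|.+2)%N.
  by have := cch b; rewrite expnS in hk; lia.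
rewrite /=; case: ifPn => hlt.
  apply: (IH tl _ _ _ (ich true) (hb' true) (hk' true)).
  move=> j1; have := hq j1; rewrite /child_lo /child_hi /upd.
  by case: eqP => // ->; lia.
apply: (IH tr _ _ _ (ich false) (hb' false) (hk' false)).
move=> j1; have := hq j1; rewrite /child_lo /child_hi /upd.
(* The query slot is not the cut slot, so not being below the cut means being at least [z.+1]. *)
by case: eqP => // ->; have := qc i0 j; rewrite -ei; lia.
Qed.

End leaf_points_pattern.

(** * Integration and independence *)

Section integral_facts.
Context {disp : measure_display} {T : measurableType disp} {R : realType}.
Variable P : probability T R.

Lemma Rintegral_sum (I : Type) (s : seq I) (f : I -> T -> R) :
  (forall i, P.-integrable setT (EFin \o f i)) ->
  \int[P]_w (\sum_(i <- s) f i w) = \sum_(i <- s) \int[P]_w f i w.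
Proof.
move=> fi; rewrite /Rintegral.
rewrite (_ : \int[P]_x (\sum_(i <- s) f i x)%:E = \sum_(i <- s) \int[P]_x (f i x)%:E)%E.
  rewrite sum_fine// => i _. exact: (integrable_fin_num measurableT (fi i)).
by under eq_integral do rewrite -sumEFin; rewrite (integral_sum measurableT fi).
Qed.

Lemma integrable_sumR (I : Type) (s : seq I) (f : I -> T -> R) :
  (forall i, P.-integrable setT (EFin \o f i)) ->
  P.-integrable setT (EFin \o (fun w => \sum_(i <- s) f i w)).
Proof.
move=> fi; rewrite (_ : _ \o _ = fun w => \sum_(i <- s) (f i w)%:E)%E; last first.
  by apply/funext => w /=; rewrite sumEFin.
by apply: integrable_sum => // i _; exact: fi.
Qed.

(* No measurability of f: the integral of a nonnegative function is a supremum
   over simple functions below it; these are bounded, so that what happens on a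
   set of small probability does not matter. *)
Lemma integral_le_of_truncated (f : T -> R) (b : R) : (forall w, 0 <= f w) ->
  (forall e : R, 0 < e -> exists (G : set T) (g : T -> R),
     [/\ measurable G, (P (~` G) <= e%:E)%E, measurable_fun setT g
       & [/\ forall w, 0 <= g w, forall w, G w -> f w <= g w
           & (\int[P]_w (g w)%:E <= (b + e)%:E)%E]]) ->
  (\int[P]_w (f w)%:E <= b%:E)%E.
Proof.
move=> f0 hG; rewrite ge0_integralTE => [|w]; last by rewrite lee_fin.
apply: ge_ereal_sup => _ /= [h hf <-].
have [K [_ hK]] := simple_bounded h.
pose K1 := `|K| + 1; have K10 : 0 < K1 by rewrite ltr_pwDr.
have {}hK w : h w <= K1.
  by apply: le_trans (ler_norm _) _; apply: hK => //; rewrite (le_lt_trans (ler_norm _))// ltrDl.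
rewrite -integralT_nnsfun.
apply/lee_addgt0Pr => e e0.
(* Chosen so that [e' + K1 * e' = e]: the error on [g] plus the bound [K1] times the probability of
   the complement of [G]. *)
pose e' := e / (1 + K1); have e'0 : 0 < e' by rewrite divr_gt0// addr_gt0.
have [G [g [mG PG mg [g0 fg ig]]]] := hG e' e'0.
have mI : measurable_fun setT (\1_(~` G) : T -> R).
  by apply: measurable_indic; exact: measurableC.
apply: (@le_trans _ _ (\int[P]_w ((g w)%:E + (K1 * \1_(~` G) w)%:E))%E).
  apply: ge0_le_integral => //=.
  - by move=> w _; rewrite lee_fin.
  - exact/measurable_EFinP.
  - apply: emeasurable_funD; apply/measurable_EFinP => //.
    exact: measurable_funM.
  - move=> w _; rewrite -EFinD lee_fin indicE.
    have [Gw|nGw] := pselect (G w).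
      rewrite memNset ?mulr0 ?addr0; last by move=> /(_ Gw).
      by apply: le_trans (fg _ Gw); rewrite -lee_fin; exact: hf.
    by rewrite mem_set// mulr1; apply: le_trans (hK w) _; rewrite lerDr.
rewrite ge0_integralD//=; last first.
- by apply/measurable_EFinP; exact: measurable_funM.
- by move=> w _; rewrite lee_fin mulr_ge0// ltW.
- exact/measurable_EFinP.
- by move=> w _; rewrite lee_fin.
under [X in (_ + X <= _)%E]eq_integral do rewrite EFinM.
rewrite ge0_integralZl//=; [|exact/measurable_EFinP|by rewrite lee_fin ltW].
rewrite integral_indic ?setIT//; last exact: measurableC.
apply: (@le_trans _ _ ((b + e')%:E + K1%:E * e'%:E)%E).
  by apply: leeD => //; apply: lee_wpmul2l => //; rewrite lee_fin ltW.
rewrite -EFinM -!EFinD lee_fin -addrA lerD2l /e'.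
by rewrite -{1}[_ / _]mul1r -mulrDl mulrC divfK// gt_eqF// addr_gt0.
Qed.

(** The product formula on rectangles identifies the joint law with the product of the two laws; the
    rest is Fubini and Tonelli. *)
Lemma expectation_mul_indep (U V : T -> R) :
  measurable_fun setT U -> measurable_fun setT V ->
  P.-integrable setT (EFin \o U) -> P.-integrable setT (EFin \o V) ->
  (forall A B : set R, measurable A -> measurable B ->
    P (U @^-1` A `&` V @^-1` B) = (P (U @^-1` A) * P (V @^-1` B))%E) ->
  P.-integrable setT (EFin \o (fun w => U w * V w)) /\
  \int[P]_w (U w * V w) = (\int[P]_w U w) * (\int[P]_w V w).
Proof.
move=> mU mV iU iV UV.
pose U' : {mfun T >-> R} :=
  MeasurableFun.Pack (MeasurableFun.Class (isMeasurableFun.Build _ _ _ _ _ mU)).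
pose V' : {mfun T >-> R} :=
  MeasurableFun.Pack (MeasurableFun.Class (isMeasurableFun.Build _ _ _ _ _ mV)).
have mW : measurable_fun setT (fun w => (U w, V w)) by exact: measurable_fun_pair.
pose W' : {mfun T >-> (R * R)%type} :=
  MeasurableFun.Pack (MeasurableFun.Class (isMeasurableFun.Build _ _ _ _ _ mW)).
pose mu := distribution P U'; pose nu := distribution P V'.
pose f (z : R * R) : \bar R := (z.1 * z.2)%:E.
have mf : measurable_fun setT f.
  by apply/measurable_EFinP; exact: measurable_funM.
have prodE X : measurable X -> (mu \x nu)%E X = distribution P W' X.
  apply: product_measure_unique => A B mA mB.
  by rewrite /mu /nu /distribution /pushforward /= -UV.
have inte (X : {mfun T >-> R}) : P.-integrable setT (EFin \o X) ->
    (distribution P X).-integrable setT (EFin \o (idfun : R -> R)).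
  move=> iX; apply: integrable_pushforward => //.
  by apply/measurable_EFinP; exact: measurable_id.
have intv (X : {mfun T >-> R}) : P.-integrable setT (EFin \o X) ->
    (\int[distribution P X]_x x%:E = \int[P]_w (X w)%:E)%E.
  by move=> iX; rewrite integral_distribution//.
have fin (X : {mfun T >-> R}) : P.-integrable setT (EFin \o X) ->
    (\int[distribution P X]_x `|x%:E| < +oo)%E.
  by move=> /inte /integrableP[].
have ifx : (mu \x nu)%E.-integrable setT f.
  apply/integrable12ltyP => //.
  have mabs : measurable_fun setT (fun y : R => `|y%:E|%E).
    by apply: measurableT_comp => //; apply/measurable_EFinP; exact: measurable_id.
  have -> : (\int[mu]_x \int[nu]_y `|f (x, y)| =
      \int[mu]_x (`|x%:E| * \int[nu]_y `|y%:E|))%E.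
    apply: eq_integral => x _.
    under eq_integral do rewrite /f EFinM abseM /=.
    by apply: (ge0_integralZl nu measurableT mabs).
  rewrite ge0_integralZr//; last exact: integral_ge0.
  apply: lte_mul_pinfty; [exact: integral_ge0| |exact: fin].
  by rewrite ge0_fin_numE; [exact: fin|exact: integral_ge0].
have iUV : P.-integrable setT (EFin \o (fun w => U w * V w)).
  have : (distribution P W').-integrable setT f.
    apply/integrableP; split => //.
    move/integrableP : ifx => [_]; congr (_ < _)%E.
    by apply: eq_measure_integral => X mX _; exact: prodE.
  move=> /integrableP[_]; rewrite ge0_integral_distribution//; last exact: measurableT_comp.
  move=> h; apply/integrableP; split => //.
  by apply/measurable_EFinP; exact: measurable_funM.
split => //; rewrite /Rintegral.
rewrite -fineM; [|exact: (integrable_fin_num measurableT iU)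
  |exact: (integrable_fin_num measurableT iV)].
congr fine.
transitivity (\int[distribution P W']_z f z)%E; first by rewrite integral_distribution.
transitivity (\int[(mu \x nu)%E]_z f z)%E.
  by apply: eq_measure_integral => X mX _; apply/esym/prodE.
rewrite -(integral12_prod_meas1 ifx) -(intv U' iU) -(intv V' iV).
transitivity (\int[mu]_x (x%:E * \int[nu]_y y%:E))%E.
  apply: eq_integral => x _; rewrite /fubini_F /f.
  under eq_integral do rewrite EFinM.
  by rewrite integralZl//; exact: inte.
have : (\int[nu]_y y%:E)%E \is a fin_num.
  exact: (integrable_fin_num measurableT (inte V' iV)).
move=> /fineK <-.
by rewrite integralZr//; exact: inte.
Qed.
End integral_facts.

Section conditional_moments.
Context {disp disp' : measure_display} {T : measurableType disp}.
Context {T' : measurableType disp'} {R : realType}.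
Variables (P : probability T R) (X : {RV P >-> T'}).

Let mX (A : set T') : measurable A -> measurable (X @^-1` A).
Proof. by move=> mA; rewrite -[_ @^-1` _]setTI; exact: measurable_funPT. Qed.

(** The event [W >= 0] and its complement are preimages under [X], and [W] has integral 0 over each;
    hence so has [|W|]. *)
Lemma centred_cond_exp_ae0 (Z W : T -> R) :
  is_cond_exp P X Z (cst 0) -> is_cond_exp P X Z W ->
  ae_eq P setT (EFin \o W) (cst 0%E).
Proof.
move=> [iZ _ _ Z0] [_ iW sW ZW].
have W0 A : measurable A -> (\int[P]_(w in X @^-1` A) (W w)%:E = 0)%E.
  by move=> mA; rewrite ZW// -Z0//; exact: integral0_eq.
have mW := measurable_int _ iW.
have [A mA] := sW `[0, +oo[%classic (measurable_itv _); rewrite setTI => eA.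
apply/ae_eq_integral_abs => //.
rewrite -(setUv (X @^-1` A)) ge0_integral_setU//=; last 4 first.
- exact: mX.
- by apply: measurableC; exact: mX.
- rewrite setUv; apply/measurable_EFinP/measurableT_comp => //.
  exact/measurable_EFinP.
- by apply/disj_setPS => w [].
rewrite (_ : \int[P]_(x in X @^-1` A) _ = 0)%E; last first.
  rewrite -[RHS](W0 A mA); apply: eq_integral => w; rewrite inE => Aw.
  rewrite ger0_norm//; have : (W @^-1` `[0, +oo[) w by rewrite -eA.
  by rewrite /= in_itv/= andbT.
rewrite add0e preimage_setC (_ : \int[P]_(x in X @^-1` (~` A)) _ =
    \int[P]_(x in X @^-1` (~` A)) (- (W x)%:E))%E; last first.
  apply: eq_integral => w; rewrite inE => Aw.
  rewrite -EFinN ler0_norm// leNgt; apply/negP => W1; apply: Aw.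
  have : (W @^-1` `[0, +oo[) w by rewrite /= in_itv/= andbT ltW.
  by rewrite -eA.
under eq_integral do rewrite -mulN1e -EFinN.
rewrite integralZl ?W0 ?mule0//; last 2 first.
- by apply: mX; exact: measurableC.
- apply: integrableS iW => //; apply: mX; exact: measurableC.
exact: measurableC.
Qed.

(** [is_cond_var] only provides some version [W] of the conditional mean. It vanishes almost
    everywhere by the previous lemma, so the square of [Z - W] may be replaced by that of [Z]. *)
Lemma centred_cond_var_le (Z V : T -> R) (s : R) : is_cond_exp P X Z (cst 0) ->
  is_cond_var P X Z V -> {ae P, forall w, V w <= s} -> 0 <= s ->
  P.-integrable setT (EFin \o (fun w => Z w ^+ 2)) /\
  forall A : set T', measurable A ->
    (\int[P]_(w in X @^-1` A) (Z w ^+ 2)%:E <= s%:E * P (X @^-1` A))%E.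
Proof.
move=> hZ [W [hW [iZW iV sV ZV]]] [N [mN N0 VN]] s0.
have W0 := centred_cond_exp_ae0 hZ hW.
have [iZ _ _ _] := hZ.
have mZ2 : measurable_fun setT (fun w => (Z w ^+ 2)%:E).
  apply/measurable_EFinP; apply: measurable_funX; apply/measurable_EFinP.
  exact: (measurable_int _ iZ).
have mZW := measurable_int _ iZW.
have ZWe : ae_eq P setT (EFin \o (fun w => (Z w - W w) ^+ 2)) (fun w => (Z w ^+ 2)%:E).
  by apply: filterS W0 => w /(_ I)[/= ->] _; rewrite subr0.
have iZ2 : P.-integrable setT (EFin \o (fun w => Z w ^+ 2)).
  apply/integrableP; split => //.
  move/integrableP : iZW => [_]; congr (_ < _)%E.
  apply: ae_eq_integral => //; [exact: measurableT_comp|exact: measurableT_comp|].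
  by apply: filterS ZWe => w /(_ I) /= [h] _; rewrite h.
split=> // A mA; have mXA := mX mA.
have -> : (\int[P]_(w in X @^-1` A) (Z w ^+ 2)%:E = \int[P]_(w in X @^-1` A) (V w)%:E)%E.
  rewrite ZV//; apply: ae_eq_integral => //.
  - exact: measurable_funTS.
  - exact: measurable_funTS mZW.
  - by apply: filterS ZWe => w /(_ I) /= [h] _; rewrite h.
rewrite (negligible_integral mN)//; last exact: integrableS iV.
have mD : measurable (X @^-1` A `\` N) by exact: measurableD.
apply: (@le_trans _ _ (\int[P]_(w in X @^-1` A `\` N) s%:E)%E).
  apply: le_integral => //.
  - exact: integrableS iV.
  - exact: finite_measure_integrable_cst.
  - move=> w; rewrite inE => -[_ nN]; rewrite lee_fin; apply: contrapT => h.
    exact/nN/VN.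
rewrite integral_cst//; apply: lee_wpmul2l; first by rewrite lee_fin.
by apply: le_measure; rewrite ?inE//; exact: subDsetl.
Qed.

End conditional_moments.

Section transfer.
Context {disp disp' : measure_display} {T : measurableType disp}.
Context {S : measurableType disp'} {R : realType}.
Variable P : probability T R.

Lemma integral_same_law (Z Z0 : T -> S) (f : S -> R) :
  measurable_fun setT Z -> measurable_fun setT Z0 ->
  (forall B, measurable B -> P (Z @^-1` B) = P (Z0 @^-1` B)) ->
  measurable_fun setT f -> P.-integrable setT (EFin \o (f \o Z0)) ->
  P.-integrable setT (EFin \o (f \o Z)) /\
  \int[P]_w f (Z w) = \int[P]_w f (Z0 w).
Proof.
move=> mZ mZ0 law mf if0.
pose Z' : {mfun T >-> S} :=
  MeasurableFun.Pack (MeasurableFun.Class (isMeasurableFun.Build _ _ _ _ _ mZ)).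
pose Z0' : {mfun T >-> S} :=
  MeasurableFun.Pack (MeasurableFun.Class (isMeasurableFun.Build _ _ _ _ _ mZ0)).
have mfE : measurable_fun setT (EFin \o f) by exact/measurable_EFinP.
have e (g : S -> \bar R) : (\int[distribution P Z']_y g y = \int[distribution P Z0']_y g y)%E.
  by apply: eq_measure_integral => B mB _; exact: law.
have ifZ : P.-integrable setT (EFin \o (f \o Z)).
  apply/integrableP; split; first by apply/measurable_EFinP; exact: measurableT_comp.
  move/integrableP : if0 => [_]; congr (_ < _)%E.
  transitivity (\int[distribution P Z0']_y `|(f y)%:E|)%E.
    by rewrite ge0_integral_distribution//; exact: measurableT_comp.
  by rewrite -e ge0_integral_distribution//; exact: measurableT_comp.
split => //; rewrite /Rintegral; congr fine.
transitivity (\int[distribution P Z']_y (f y)%:E)%E.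
  by rewrite integral_distribution.
by rewrite e integral_distribution.
Qed.

Lemma Rintegral_indic_mul (D : set T) (f : T -> R) :
  \int[P]_w (\1_D w * f w) = \int[P]_(w in D) f w.
Proof.
rewrite [RHS]Rintegral_mkcond; apply: eq_Rintegral => w _.
by rewrite patchE indicE; case: (w \in D); rewrite ?mul1r ?mul0r.
Qed.

Lemma integrable_indic_mul (D : set T) (f : T -> R) : measurable D ->
  P.-integrable setT (EFin \o f) ->
  P.-integrable setT (EFin \o (fun w => \1_D w * f w)).
Proof.
move=> mD fi; have mf : measurable_fun setT f.
  by apply/measurable_EFinP; exact: (measurable_int _ fi).
apply: le_integrable fi => //.
  by apply/measurable_EFinP; apply: measurable_funM => //; exact: measurable_indic.
move=> w _ /=; rewrite lee_fin normrM indicE.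
by case: (w \in D); rewrite ?normr1 ?mul1r ?normr0 ?mul0r.
Qed.

End transfer.

(* The residual Y - kappa, for a value kappa of m in the cell, is used instead of
   the noise Y - m(X): only m \o X, not m itself, is known to be measurable. *)
Section cell_moments.
Context {R : realType} {d : nat} {disp : measure_display} {T : measurableType disp}.
Variables (P : probability T R) (X : {RV P >-> d.-tuple R}) (Y : {RV P >-> R}).
Variables (m : d.-tuple R -> R) (L sigma : R).
Hypothesis model : regression_model P X Y m L sigma.
Variables (Q : set (d.-tuple R)) (kappa eta : R).
Hypothesis mQ : measurable Q.
Hypothesis Qm : forall x, Q x -> in_cube x -> `|m x - kappa| <= eta.

Let D := X @^-1` Q.
Let mD : measurable D.
Proof. by rewrite /D -[_ @^-1` _]setTI; exact: measurable_funPT. Qed.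

Let icst (r : R) : P.-integrable setT (EFin \o cst r).
Proof. exact: finite_measure_integrable_cst. Qed.

Let iY : P.-integrable setT (EFin \o Y).
Proof. by have [] := rm_regression model. Qed.

Let imX : P.-integrable setT (EFin \o (m \o X)).
Proof. by have [] := rm_regression model. Qed.

Let inoise : P.-integrable setT (EFin \o (fun w => Y w - m (X w))).
Proof. by have [] := rm_noise_centred model. Qed.

Lemma integrable_sqr_response : P.-integrable setT (EFin \o (fun w => Y w ^+ 2)).
Proof.
apply/integrableP; split.
  by apply/measurable_EFinP; exact: measurable_funX.
have := rm_square_integrable model; rewrite unlock.
by congr (_ < _)%E; apply: eq_integral => w _; rewrite /= ger0_norm// sqr_ge0.
Qed.

Let iYk : P.-integrable setT (EFin \o (fun w => Y w - kappa)).
Proof. exact: (integrableB measurableT iY (icst kappa)). Qed.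

Lemma integrable_sqr_residual :
  P.-integrable setT (EFin \o (fun w => (Y w - kappa) ^+ 2)).
Proof.
have h := integrableD measurableT integrable_sqr_response
  (integrableD measurableT (integrableZl measurableT (- 2 * kappa) iY) (icst (kappa ^+ 2))).
apply: eq_integrable h => // w _ /=.
by rewrite -EFinM -!EFinD; congr EFin; ring.
Qed.

Let iS (f : T -> R) : P.-integrable setT (EFin \o f) -> P.-integrable D (EFin \o f).
Proof. by move=> h; apply: integrableS h. Qed.

(** The noise has integral 0 over the event that X lies in [Q], so [Y] can be replaced by [m (X w)],
    which is within [eta] of [kappa] there. *)
Lemma cell_mean_le : 0 <= eta ->
  `|\int[P]_(w in D) (Y w - kappa)| <= eta * fine (P D).
Proof.
move=> eta0.
have imk : P.-integrable setT (EFin \o (fun w => m (X w) - kappa)).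
  exact: (integrableB measurableT imX (icst kappa)).
have -> : \int[P]_(w in D) (Y w - kappa) = \int[P]_(w in D) (m (X w) - kappa).
  transitivity (\int[P]_(w in D) ((Y w - m (X w)) + (m (X w) - kappa))).
    by apply: eq_Rintegral => w _; ring.
  rewrite (RintegralD mD (iS inoise) (iS imk)).
  have [_ _ _ h] := rm_noise_centred model.
  by rewrite {1}/Rintegral -(h Q mQ) integral0_eq// add0r.
apply: le_trans (le_normr_Rintegral mD (iS imk)) _.
rewrite -Rintegral_cst//; apply: le_Rintegral => //.
- by apply: iS; exact: (integrable_abse imk).
- exact: iS (icst eta).
- by move=> w Dw; apply: Qm => //; exact: (rm_cube model).
Qed.

(** Noise and oscillation of [m] are separated by [(u + v) ^ 2 <= (1 + t) u ^ 2 + (1 + 1 / t) v ^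
    2]. A free [t] lets the coefficient of [sigma ^+ 2] tend to 1. *)
Lemma cell_sqr_le (t : R) : 0 < t ->
  \int[P]_(w in D) (Y w - kappa) ^+ 2 <=
  ((1 + t) * sigma ^+ 2 + (1 + t^-1) * eta ^+ 2) * fine (P D).
Proof.
move=> t0.
have [V [hV VN]] := rm_noise_variance model.
have [ie2 he2] := centred_cond_var_le (rm_noise_centred model) hV VN (sqr_ge0 sigma).
have {}he2 : \int[P]_(w in D) (Y w - m (X w)) ^+ 2 <= sigma ^+ 2 * fine (P D).
  rewrite -lee_fin EFinM /Rintegral (fineK (integrable_fin_num mD (iS ie2))).
  by rewrite fineK ?fin_num_measure//; exact: he2.
have ib : P.-integrable setT (EFin \o (fun w => (1 + t) * (Y w - m (X w)) ^+ 2)).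
  exact: (integrableZl measurableT (1 + t) ie2).
have ic : P.-integrable setT (EFin \o cst ((1 + t^-1) * eta ^+ 2)) by exact: icst.
apply: (@le_trans _ _ (\int[P]_(w in D) ((1 + t) * (Y w - m (X w)) ^+ 2 + (1 + t^-1) * eta ^+ 2))).
  apply: le_Rintegral => //.
  - exact: iS integrable_sqr_residual.
  - exact: iS (integrableD measurableT ib ic).
  - move=> w Dw; have h := Qm Dw (rm_cube model w).
    set u := Y w - m (X w); set v := m (X w) - kappa in h.
    have -> : Y w - kappa = u + v by rewrite /u /v; ring.
    have v2 : v ^+ 2 <= eta ^+ 2 by
      rewrite -[v ^+ 2]real_normK ?num_real// lerXn2r ?nnegrE//; exact: le_trans h.
    apply: (@le_trans _ _ ((1 + t) * u ^+ 2 + (1 + t^-1) * v ^+ 2)).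
      rewrite -subr_ge0 (_ : _ - _ = (t * u - v) ^+ 2 / t); last by field; rewrite gt_eqF.
      by rewrite divr_ge0 ?sqr_ge0// ltW.
    by rewrite lerD2l ler_wpM2l// addr_ge0// invr_ge0 ltW.
rewrite (RintegralD mD (iS ib) (iS ic)) RintegralZl//; last exact: iS ie2.
rewrite (Rintegral_cst _ mD) [leRHS]mulrDl; apply: lerD => //.
by rewrite -mulrA ler_wpM2l// addr_ge0// ltW.
Qed.

End cell_moments.

Section pair_independence.
Context {disp disp' : measure_display} {T : measurableType disp}.
Context {S : measurableType disp'} {R : realType}.
Variables (P : probability T R) (n : nat) (Z : 'I_n -> T -> S).
Hypothesis mZ : forall i, measurable_fun setT (Z i).
Hypothesis indepZ : forall B : 'I_n -> set S, (forall i, measurable (B i)) ->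
  P [set w | forall i, B i (Z i w)] = (\prod_(i < n) P [set w | B i (Z i w)])%E.
Variables (i i' : 'I_n) (B : 'I_n -> set S).
Hypothesis ii' : i != i'.
Hypothesis mB : forall l, measurable (B l).

Definition others_in : set T :=
  [set w | forall l, l != i -> l != i' -> B l (Z l w)].

Let upd2 (A A' : set S) : 'I_n -> set S :=
  fun l => if l == i then A else if l == i' then A' else B l.

Let mupd2 A A' : measurable A -> measurable A' -> forall l, measurable (upd2 A A' l).
Proof. by move=> mA mA' l; rewrite /upd2; case: ifP => // _; case: ifP. Qed.

Let mset (C : 'I_n -> set S) : (forall l, measurable (C l)) ->
  measurable [set w | forall l, C l (Z l w)].
Proof.
move=> mC; rewrite (_ : mkset _ = \bigcap_(l in [set: 'I_n]) (Z l @^-1` C l)).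
  apply: fin_bigcap_measurable; first exact: finite_finset.
  by move=> l _; rewrite -[_ @^-1` _]setTI; exact: mZ.
by apply/seteqP; split => w h l; [move=> _; exact: h|exact: (h l I)].
Qed.

Lemma others_inE : others_in = [set w | forall l, upd2 setT setT l (Z l w)].
Proof.
apply/seteqP; split => w h l.
  by rewrite /upd2; case: ifPn => // li; case: ifPn => // li'; exact: h.
by move=> li li'; have := h l; rewrite /upd2 (negbTE li) (negbTE li').
Qed.

Lemma measurable_others_in : measurable others_in.
Proof. by rewrite others_inE; exact/mset/mupd2. Qed.

Let Pupd2 A A' : measurable A -> measurable A' ->
  P [set w | forall l, upd2 A A' l (Z l w)] =
  (P (Z i @^-1` A) * (P (Z i' @^-1` A') *
    \prod_(l < n | (l != i) && (l != i')) P [set w | B l (Z l w)]))%E.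
Proof.
move=> mA mA'; rewrite indepZ; last exact: mupd2.
rewrite (bigD1 i)//= (bigD1 i')/=; last by rewrite eq_sym.
congr (_ * (_ * _))%E.
- by rewrite /upd2 eqxx.
- by rewrite /upd2 eqxx eq_sym (negbTE ii').
- by apply: eq_bigr => l /andP[li li']; rewrite /upd2 (negbTE li) (negbTE li').
Qed.

(* If 0 is in C, pass to the complement of C. *)
Let indep_of_set (U V : T -> R) (mU : measurable_fun setT U) (mV : measurable_fun setT V) :
  (forall A C : set R, measurable A -> measurable C -> ~ C 0 ->
    P (U @^-1` A `&` V @^-1` C) = (P (U @^-1` A) * P (V @^-1` C))%E) ->
  forall A C : set R, measurable A -> measurable C ->
    P (U @^-1` A `&` V @^-1` C) = (P (U @^-1` A) * P (V @^-1` C))%E.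
Proof.
move=> h A C mA mC; have [C0|nC0] := pselect (C 0); last exact: h.
have mpre (f : T -> R) (E : set R) : measurable_fun setT f -> measurable E ->
    measurable (f @^-1` E).
  by move=> mf mE; rewrite -[_ @^-1` _]setTI; exact: mf.
have mUA := mpre U A mU mA; have mVC := mpre V C mV mC.
have hC := h A (~` C) mA (measurableC mC) (fun f => f C0).
rewrite -preimage_setC in hC.
have e1 : P (U @^-1` A) =
    (P (U @^-1` A `&` ~` (V @^-1` C)) + P (U @^-1` A `&` V @^-1` C))%E.
  by rewrite -setDE; exact: measureDI.
rewrite hC in e1.
have e2 := probability_setC P mVC; rewrite e2 in e1.
have fA : P (U @^-1` A) \is a fin_num by rewrite fin_num_measure.
have fC : P (V @^-1` C) \is a fin_num by rewrite fin_num_measure.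
have fAC : P (U @^-1` A `&` V @^-1` C) \is a fin_num.
  by rewrite fin_num_measure//; exact: measurableI.
move: e1; rewrite -(fineK fA) -(fineK fC) -(fineK fAC) -EFinB -!EFinM -EFinD => -[e].
by congr EFin; move: e; lra.
Qed.

(** If [C] does not contain 0, then the preimage of [C] under [\1_others_in * g (Z i')] is a product
    event in the [Z l], so the hypothesis on product events gives the independence needed by
    [expectation_mul_indep]. *)
Lemma pair_indep (f g : S -> R) :
  measurable_fun setT f -> measurable_fun setT g ->
  P.-integrable setT (EFin \o (f \o Z i)) ->
  P.-integrable setT (EFin \o (g \o Z i')) ->
  P.-integrable setT (EFin \o (fun w => f (Z i w) * (\1_others_in w * g (Z i' w)))) /\
  \int[P]_w (f (Z i w) * (\1_others_in w * g (Z i' w))) =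
  \int[P]_w f (Z i w) * \int[P]_w (\1_others_in w * g (Z i' w)).
Proof.
move=> mf mg ifZ igZ.
have mJ := measurable_others_in.
have mU : measurable_fun setT (fun w => f (Z i w)) by exact: measurableT_comp.
have mV : measurable_fun setT (fun w => \1_others_in w * g (Z i' w) : R).
  by apply: measurable_funM; [exact: measurable_indic|exact: measurableT_comp].
apply: expectation_mul_indep => //; first exact: integrable_indic_mul.
apply: indep_of_set => // A C mA mC C0.
have mfA : measurable (f @^-1` A) by rewrite -[_ @^-1` _]setTI; exact: mf.
have mgC : measurable (g @^-1` C) by rewrite -[_ @^-1` _]setTI; exact: mg.
have VC : (fun w => \1_others_in w * g (Z i' w) : R) @^-1` C =
    [set w | forall l, upd2 setT (g @^-1` C) l (Z l w)].
  rewrite predeqE => w /=; rewrite indicE.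
  have [Jw|Jw] := boolP (w \in others_in); last first.
    rewrite mul0r; split => // h; exfalso; move: Jw; apply/negP/negPn.
    rewrite inE => l li li'; have := h l.
    by rewrite /upd2 (negbTE li) (negbTE li').
  rewrite mul1r; split => [h l|/(_ i')]; last by rewrite /upd2 eq_sym (negbTE ii') eqxx.
  rewrite /upd2; case: ifPn => // li; case: ifPn => [/eqP -> //|li'].
  by move/set_mem : Jw; exact.
rewrite VC Pupd2// preimage_setT probability_setT mul1e.
rewrite (_ : _ `&` _ = [set w | forall l, upd2 (f @^-1` A) (g @^-1` C) l (Z l w)]).
  by rewrite Pupd2.
rewrite predeqE => w; split => [[Aw h] l|h].
  by have := h l; rewrite /upd2; case: ifPn => // /eqP ->.
split; first by have := h i; rewrite /upd2 eqxx.
by move=> l; have := h l; rewrite /upd2; case: ifPn.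
Qed.

End pair_independence.

(** Expanding a square on the event that all points lie in given cells produces such terms: two
    points carry functions, the others carry indicators. *)
Lemma pair_expectation (disp disp' : measure_display) (T : measurableType disp)
    (S : measurableType disp') (R : realType) (P : probability T R) (n : nat)
    (Z : 'I_n -> T -> S) (i i' : 'I_n) (B : 'I_n -> set S) (f g : S -> R) :
  (forall l, measurable_fun setT (Z l)) ->
  (forall B : 'I_n -> set S, (forall l, measurable (B l)) ->
    P [set w | forall l, B l (Z l w)] = (\prod_(l < n) P [set w | B l (Z l w)])%E) ->
  i != i' -> (forall l, measurable (B l)) ->
  measurable_fun setT f -> measurable_fun setT g ->
  P.-integrable setT (EFin \o (f \o Z i)) ->
  P.-integrable setT (EFin \o (g \o Z i')) ->
  P.-integrable setT (EFin \o (fun w => f (Z i w) * (\1_(others_in Z i i' B) w * g (Z i' w)))) /\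
  \int[P]_w (f (Z i w) * (\1_(others_in Z i i' B) w * g (Z i' w))) =
  \int[P]_w f (Z i w) * \int[P]_w g (Z i' w) *
    \prod_(l < n | (l != i) && (l != i')) fine (P (Z l @^-1` B l)).
Proof.
move=> mZ indep ii' mB mf mg ifZ igZ.
have [h1 h2] := pair_indep mZ indep ii' mB mf mg ifZ igZ.
split => //; rewrite h2 -mulrA; congr (_ * _).
have mJ := measurable_others_in mZ i i' mB.
have icst : P.-integrable setT (EFin \o (cst 1 \o Z i)).
  exact: finite_measure_integrable_cst.
have i'i : i' != i by rewrite eq_sym.
have mc : measurable_fun setT (cst 1 : S -> R) by exact: measurable_cst.
(* The roles of the two points are exchanged, with the constant 1 as second function, to separate
   [g] from the indicator. *)
have [_ h3] := pair_indep mZ indep i'i mB mg mc igZ icst.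
have JJ : others_in Z i' i B = others_in Z i i' B.
  by apply/seteqP; split => w h l l1 l2; exact: h.
rewrite JJ in h3.
transitivity (\int[P]_w g (Z i' w) * \int[P]_w (\1_(others_in Z i i' B) w * 1)).
  rewrite -h3; apply: eq_Rintegral => w _.
  by rewrite mulr1 mulrC.
have PJ : P (others_in Z i i' B) =
    (\prod_(l < n | (l != i) && (l != i')) fine (P (Z l @^-1` B l)))%:E.
  rewrite others_inE -prodEFin.
  transitivity (\prod_(l < n) P [set w | (if l == i then setT else
      if l == i' then setT else B l) (Z l w)])%E.
    apply: (indep (fun l => if l == i then setT else if l == i' then setT else B l)).
    by move=> l; case: ifP => // _; case: ifP.
  rewrite (bigID (fun l => (l != i) && (l != i')))/= [X in (_ * X)%E]big1 ?mule1; last first.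
    move=> l; rewrite negb_and !negbK => /orP[/eqP ->|/eqP ->].
      by rewrite eqxx -[RHS](probability_setT P); congr (P _); apply/seteqP; split.
    by rewrite (negbTE i'i) eqxx -[RHS](probability_setT P); congr (P _); apply/seteqP; split.
  apply: eq_bigr => l /andP[li li']; rewrite (negbTE li) (negbTE li') fineK//.
  by rewrite fin_num_measure// -[_ @^-1` _]setTI; exact: mZ.
congr (_ * _); rewrite Rintegral_indic_mul (Rintegral_cst _ mJ) mul1r.
exact: (congr1 (@fine R) PJ).
Qed.

(** * Weights, bias and risk of the forest on the grid *)

Section forest_weights.
Variables (R : realType) (n d M a k : nat) (q : 'I_d -> nat).
Implicit Types (c : pattern n d M) (theta : {set 'I_n} * split_coords d k).

Let FR := forest_randomness d n a k.

Lemma sum_forest_randomness (F : {set 'I_n} * split_coords d k -> R) :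
  \sum_(theta in FR) F theta =
  \sum_(S : {set 'I_n} | #|S| == a) \sum_(t : split_coords d k) F (S, t).
Proof.
rewrite pair_big_dep /=; apply: eq_big => [[S t]|[S t] _//].
by rewrite inE /= andbT.
Qed.

Lemma card_forest_randomness :
  #|FR|%:R = 'C(n, a)%:R * #|split_coords d k|%:R :> R.
Proof.
rewrite -sum1_card natr_sum sum_forest_randomness.
under eq_bigr do rewrite sumr_const.
rewrite sumr_const mulr_natl; congr (_ *+ _).
rewrite -[X in _ = 'C(X, _)]card_ord -card_draws.
by apply: eq_card => S; rewrite inE.
Qed.

Definition tree_weight c theta (i : 'I_n) : R :=
  (i \in leaf_set c q theta.2 theta.1)%:R / #|leaf_set c q theta.2 theta.1|%:R.

(** A function of the pattern alone, hence constant on the event that the data have a given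
    pattern. *)
Definition forest_weight c (i : 'I_n) : R :=
  (\sum_(theta in FR) tree_weight c theta i) / #|FR|%:R.

Lemma leaf_set_sub c j (t : split_coords d j) S : leaf_set c q t S \subset S.
Proof.
elim: j t S => [|j IH] t S /=; first exact: subxx.
case: t => l [tl tr]; case: ifP => _.
  exact: fintype.subset_trans (IH _ _) (child_sub true _ _ _ _).
exact: fintype.subset_trans (IH _ _) (child_sub false _ _ _ _).
Qed.

Lemma forest_weight_ge0 c i : 0 <= forest_weight c i.
Proof. by rewrite divr_ge0// sumr_ge0// => theta _; rewrite divr_ge0. Qed.

Hypotheses (ha : (a <= n)%N) (hk : (4 * 2 ^ k <= a)%N).

Let k0 : (0 < 2 ^ k)%N. Proof. by rewrite expn_gt0. Qed.

Lemma card_split_coords_gt0 j : (0 < d)%N -> (0 < #|split_coords d j|)%N.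
Proof.
move=> d0; elim: j => [|j IH]; first by rewrite card_unit.
by rewrite /= !card_prod card_ord !muln_gt0 d0 IH.
Qed.

Section injective_pattern.
Variable (c : pattern n d M).
Hypothesis cinj : coord_inj c [set: 'I_n]%SET.
Hypothesis d0 : (0 < d)%N.

Lemma coord_injS S : coord_inj c S.
Proof. by move=> j i i' _ _; exact: cinj (finset.in_setT i) (finset.in_setT i'). Qed.

Lemma card_forest_randomness_gt0 : 0 < #|FR|%:R :> R.
Proof.
by rewrite card_forest_randomness mulr_gt0// ltr0n ?bin_gt0// card_split_coords_gt0.
Qed.

Lemma leaf_set_big theta : theta \in FR ->
  (a <= 2 * 2 ^ k * #|leaf_set c q theta.2 theta.1|)%N.
Proof.
rewrite inE => /eqP cS.
have := @card_leaf_set n d M c q k theta.2 theta.1 (@coord_injS _).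
rewrite cS; set l := #|_| => h.
have {}h : (a.+2 <= l.+2 * 2 ^ k)%N by apply: h; lia.
by rewrite -mulnA [(2 ^ k * l)%N]mulnC; move: h; rewrite !mulSn; lia.
Qed.

Lemma leaf_set_gt0 theta : theta \in FR ->
  (0 < #|leaf_set c q theta.2 theta.1|)%N.
Proof.
move=> /leaf_set_big; have := k0; case: #|_| => //.
by rewrite muln0 leqn0 => _ /eqP a0; move: hk; rewrite a0; lia.
Qed.

Lemma sum_tree_weight theta : theta \in FR -> \sum_i tree_weight c theta i = 1.
Proof.
move=> /leaf_set_gt0 h; rewrite -mulr_suml -natr_sum.
rewrite (_ : (\sum_i _)%N = #|leaf_set c q theta.2 theta.1|); last first.
  by rewrite -sum1_card [RHS]big_mkcond; apply: eq_bigr => i _; case: (i \in _).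
by rewrite divff// pnatr_eq0 -lt0n.
Qed.

Lemma sum_forest_weight : \sum_i forest_weight c i = 1.
Proof.
rewrite -mulr_suml exchange_big /=.
rewrite (eq_bigr (fun=> 1)); last by move=> theta; exact: sum_tree_weight.
by rewrite sumr_const divff// gt_eqF// card_forest_randomness_gt0.
Qed.

Lemma forest_weight_le i : forest_weight c i <= 2 * 2 ^+ k / n%:R.
Proof.
have a0 : (0 < a)%N by lia.
have n0 : (0 < n)%N by lia.
have aR : 0 < a%:R :> R by rewrite ltr0n.
have nR : 0 < n%:R :> R by rewrite ltr0n.
set W : R := 2 * 2 ^+ k / a%:R.
have W0 : 0 <= W by rewrite divr_ge0// mulr_ge0// exprn_ge0.
have tw theta : theta \in FR -> tree_weight c theta i <= W * (i \in theta.1)%:R.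
  move=> hth; rewrite /tree_weight; case: (boolP (i \in leaf_set _ _ _ _)) => [il|_]; last first.
    by rewrite mul0r mulr_ge0.
  rewrite (fintype.subsetP (leaf_set_sub _ _ _) _ il) mulr1 div1r.
  have l0 := leaf_set_gt0 hth; have lb := leaf_set_big hth.
  rewrite /W -[leLHS]mul1r ler_pdivrMr ?ltr0n// mulrAC ler_pdivlMr// mul1r.
  by rewrite -(ler_nat R) natrM natrM natrX in lb.
rewrite /forest_weight ler_pdivrMr ?card_forest_randomness_gt0//.
apply: le_trans (ler_sum _ tw) _.
rewrite -mulr_sumr sum_forest_randomness /=.
under eq_bigr do rewrite sumr_const -[_ *+ _]mulr_natr.
rewrite -mulr_suml card_forest_randomness -natr_sum.
set m := (\sum_(S : {set 'I_n} | _) _)%N.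
have em : m = #|[set S : {set 'I_n} | (#|S| == a) && (i \in S)]%SET|.
  rewrite -sum1dep_card big_mkcondr; apply: eq_bigr => S _; by case: (i \in S).
(* Removing [i] maps the subsamples that contain it injectively into the sets of [a.-1] other
   points. *)
have mle : (m <= 'C(n.-1, a.-1))%N.
  have <- : #|[set~ i]%SET| = n.-1 by rewrite cardsC1 card_ord.
  rewrite em -cards_draws -(card_in_imset (f := fun S : {set 'I_n} => (S :\ i)%SET)
    (D := [set S : {set 'I_n} | (#|S| == a) && (i \in S)]%SET)); last first.
    move=> S1 S2; rewrite !inE => /andP[_ i1] /andP[_ i2] e.
    by rewrite -(finset.setD1K i1) -(finset.setD1K i2) e.
  apply/subset_leq_card/fintype.subsetP => _ /finset.imsetP[S + ->].
  rewrite !inE => /andP[/eqP cS iS]; apply/andP; split.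
    by apply/fintype.subsetP => x; rewrite !inE => /andP[].
  by have := cardsD1 i S; rewrite iS cS => ->; rewrite add1n.
have e : (n * 'C(n.-1, a.-1) = a * 'C(n, a))%N.
  by have := mul_bin_diag n a.-1; rewrite prednK.
have {}mle : (n * m <= a * 'C(n, a))%N by rewrite -e leq_mul2l mle orbT.
rewrite -(ler_nat R) !natrM in mle.
rewrite mulrA [leRHS]mulrA ler_wpM2r// /W.
rewrite ![_ / _ * _]mulrAC ler_pdivrMr// [leRHS]mulrAC ler_pdivlMr//.
rewrite -!mulrA ler_wpM2l// ler_wpM2l ?exprn_ge0//.
by rewrite mulrC [leRHS]mulrC.
Qed.

(** Jensen for the forest weights, which are then unfolded as averages over trees: the weights of
    one tree live on its leaf and sum to 1. *)
Lemma sqr_weighted_sum_le (v : 'I_n -> R) (bd : {set 'I_n} * split_coords d k -> R) :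
  (forall theta i, theta \in FR -> i \in leaf_set c q theta.2 theta.1 -> v i ^+ 2 <= bd theta) ->
  (\sum_i forest_weight c i * v i) ^+ 2 <= (\sum_(theta in FR) bd theta) / #|FR|%:R.
Proof.
have jensen (I : finType) (Q : pred I) (w u : I -> R) : (forall i, Q i -> 0 <= w i) ->
    \sum_(i | Q i) w i = 1 -> (\sum_(i | Q i) w i * u i) ^+ 2 <= \sum_(i | Q i) w i * u i ^+ 2.
  move=> w0 w1; set s := \sum_(i | Q i) w i * u i.
  have h : 0 <= \sum_(i | Q i) w i * (u i - s) ^+ 2.
    by apply: sumr_ge0 => i Qi; rewrite mulr_ge0 ?w0 ?sqr_ge0.
  rewrite -subr_ge0; apply: le_trans h _; rewrite le_eqVlt; apply/orP; left; apply/eqP.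
  transitivity (\sum_(i | Q i) (w i * u i ^+ 2 - (2 * s) * (w i * u i) + s ^+ 2 * w i)).
    by apply: eq_bigr => i _; ring.
  rewrite big_split /= sumrB -!mulr_sumr w1 -/s; ring.
move=> hbd; have N0 := card_forest_randomness_gt0.
apply: le_trans (jensen _ _ _ _ (fun i _ => forest_weight_ge0 c i) sum_forest_weight) _.
under eq_bigr do rewrite /forest_weight mulrAC.
rewrite -mulr_suml ler_wpM2r ?invr_ge0 ?(ltW N0)//.
under eq_bigr do rewrite mulr_suml.
rewrite exchange_big /=; apply: ler_sum => theta hth.
rewrite -[leRHS]mul1r -(sum_tree_weight hth) mulr_suml; apply: ler_sum => i _.
rewrite /tree_weight; case: (boolP (i \in leaf_set _ _ _ _)) => [il|_]; last by rewrite !mul0r.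
by rewrite ler_wpM2l ?divr_ge0//; exact: hbd.
Qed.

Lemma forest_estimate_weight (xs : 'I_n -> d.-tuple R) (ys : 'I_n -> R) (x : d.-tuple R) :
  (forall i i' j, (tnth (xs i) j < tnth (xs i') j) = (c i j < c i' j)%N) ->
  (forall i j, (tnth x j <= tnth (xs i) j) = (q j < c i j)%N) ->
  forest_estimate a k xs ys x = \sum_i forest_weight c i * ys i.
Proof.
move=> hxs hx; under eq_bigr do rewrite /forest_weight mulrAC.
rewrite -mulr_suml /forest_estimate; congr (_ / _).
under [RHS]eq_bigr do rewrite mulr_suml.
rewrite exchange_big /=; apply: eq_bigr => theta; rewrite inE => /eqP cS.
rewrite /tree_estimate (leaf_points_leaf_set _ hxs hx (@coord_injS _)); last first.
  by rewrite cS; apply: leq_trans hk _; exact: leqW (leqnSn a).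
rewrite mulr_suml big_mkcond /=; apply: eq_bigr => i _; rewrite /tree_weight.
by case: ifP => _; rewrite ?mul0r// mul1r mulrC.
Qed.

End injective_pattern.
End forest_weights.

(** * Slots, corners and cells of the grid *)

Section grid.
Variables (R : realType) (d M : nat).
Hypothesis M0 : (0 < M)%N.

Let MR : 0 < M%:R :> R. Proof. by rewrite ltr0n. Qed.

(** The minimum puts the coordinate 1 into the last slot. *)
Definition grid_index (x : d.-tuple R) (j : 'I_d) : nat :=
  minn (Num.truncn (M%:R * tnth x j)) M.-1.

Definition grid_corner (u : {ffun 'I_d -> 'I_M}) : d.-tuple R :=
  [tuple (u j)%:R / M%:R | j < d].

(** Half-open cells are disjoint; the faces where a coordinate is 1 are left out, a null event for
    the data. *)
Definition grid_cell (u : {ffun 'I_d -> 'I_M}) : set (d.-tuple R) :=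
  [set x | forall j, (u j)%:R / M%:R <= tnth x j < (u j).+1%:R / M%:R].

Lemma grid_index_lt x j : (grid_index x j < M)%N.
Proof. by rewrite /grid_index; lia. Qed.

Lemma grid_index_bounds x j : in_cube x ->
  (grid_index x j)%:R <= M%:R * tnth x j <= (grid_index x j).+1%:R.
Proof.
move=> /(_ j) /andP[x0 x1].
have h0 : 0 <= M%:R * tnth x j by rewrite mulr_ge0.
have /andP[h1 h2] := truncn_itv h0.
rewrite /grid_index; set f := Num.truncn _ in h1 h2 *.
apply/andP; split.
  by apply: le_trans h1; rewrite ler_nat geq_minl.
have [fM|fM] := leqP f M.-1; first by rewrite ltW.
by rewrite prednK// ler_piMr.
Qed.

Lemma grid_corner_in_cube u : in_cube (grid_corner u).
Proof.
move=> j; rewrite tnth_mktuple divr_ge0//= ler_pdivrMr// mul1r ler_nat.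
exact: ltnW.
Qed.

Lemma grid_cell_dist u x : grid_cell u x ->
  euclidean_dist x (grid_corner u) <= Num.sqrt d%:R / M%:R.
Proof.
move=> hx; rewrite /euclidean_dist -[leRHS]ger0_norm ?divr_ge0 ?sqrtr_ge0// -sqrtr_sqr.
rewrite ler_wsqrtr// exprMn sqr_sqrtr// mulr_natl -[X in _ *+ X](card_ord d) -sumr_const.
apply: ler_sum => j _; rewrite tnth_mktuple lerXn2r ?nnegrE ?invr_ge0//.
  by rewrite subr_ge0; have /andP[] := hx j.
have /andP[_] := hx j; rewrite -natr1 mulrDl mul1r; lra.
Qed.

Lemma grid_cell_lt u v x y j : grid_cell u x -> grid_cell v y -> u j != v j ->
  (tnth x j < tnth y j) = (u j < v j)%N.
Proof.
move=> /(_ j) /andP[x1 x2] /(_ j) /andP[y1 y2] uv.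
have [lt|ge] := ltnP (u j) (v j).
  apply: lt_le_trans x2 (le_trans _ y1).
  by rewrite ler_pM2r ?invr_gt0// ler_nat.
apply/negbTE; rewrite -leNgt; apply: le_trans (ltW y2) (le_trans _ x1).
rewrite ler_pM2r ?invr_gt0// ler_nat ltn_neqAle ge andbT eq_sym.
by rewrite val_eqE.
Qed.

Lemma grid_cell_le_index u x y j : in_cube x -> grid_cell u y ->
  grid_index x j != u j :> nat -> (tnth x j <= tnth y j) = (grid_index x j < u j)%N.
Proof.
move=> xc /(_ j) /andP[y1 y2] ne.
have /andP[x0 x1] := xc j.
have h0 : 0 <= M%:R * tnth x j by rewrite mulr_ge0.
have /andP[h1 h2] := truncn_itv h0.
rewrite /grid_index in ne *; set f := Num.truncn _ in h1 h2 ne *.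
have uM := ltn_ord (u j).
have [lt|ge] := ltnP (minn f M.-1) (u j).
  apply: le_trans y1; rewrite ler_pdivlMr// mulrC; apply: le_trans (ltW h2) _.
  by rewrite ler_nat; lia.
apply/negbTE; rewrite -ltNge; apply: lt_le_trans y2 _.
rewrite ler_pdivrMr// mulrC; apply: le_trans h1; rewrite ler_nat; lia.
Qed.

End grid.

(** * Squared bias, averaged over patterns *)

Section bias.
Variables (R : realType) (n d M a k : nat) (L : R) (m : d.-tuple R -> R).
Variable x : d.-tuple R.
Hypotheses (M0 : (0 < M)%N) (d0 : (0 < d)%N).
Hypotheses (ha : (a <= n)%N) (hk : (4 * 2 ^ k <= a)%N).
Hypotheses (L0 : 0 <= L) (mL : lipschitz_on_cube L m) (xc : in_cube x).
Implicit Types (c : pattern n d M).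

Let q := @grid_index R d M x.
Let MR : 0 < M%:R :> R. Proof. by rewrite ltr0n. Qed.
Let lo0 : 'I_d -> nat := fun=> 0%N.
Let hiM : 'I_d -> nat := fun=> M.

Definition distinct_coords c : bool := [forall j, injectiveb (fun i => c i j)].

Definition generic_pattern c : bool :=
  distinct_coords c && [forall i, forall j, q j != c i j].

Lemma distinct_coordsP c S : distinct_coords c -> coord_inj c S.
Proof. by move=> /forallP h j i i' _ _; have /injectiveP := h j; exact. Qed.

Definition pattern_bias c : R :=
  \sum_i forest_weight R a k q c i * (m (grid_corner R (c i)) - m x).

Lemma leaf_bias_le c (theta : {set 'I_n} * split_coords d k) i : generic_pattern c ->
  theta \in forest_randomness d n a k -> i \in leaf_set c q theta.2 theta.1 ->
  (m (grid_corner R (c i)) - m x) ^+ 2 <=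
  (L / M%:R) ^+ 2 * \sum_l (leaf_side c q l theta.2 theta.1 lo0 hiM)%:R ^+ 2.
Proof.
move=> /andP[/distinct_coordsP cinj /forallP qc]; rewrite inE => /eqP cS il.
have f1 : in_box c theta.1 lo0 hiM by move=> i' j _ /=; exact: ltn_ord.
have f2 : (4 * 2 ^ k <= #|theta.1|.+2)%N by rewrite cS; lia.
have f3 j : (lo0 j <= q j < hiM j)%N by exact: grid_index_lt.
have f4 i' j : q j != c i' j :> nat by have /forallP := qc i'; exact.
have hd l := @leaf_side_bound n d M c q l k theta.2 theta.1 lo0 hiM i (cinj theta.1) f1 f2 f3 f4 il.
have dist : euclidean_dist (grid_corner R (c i)) x ^+ 2 <=
    (M%:R^-1) ^+ 2 * \sum_l (leaf_side c q l theta.2 theta.1 lo0 hiM)%:R ^+ 2.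
  rewrite /euclidean_dist sqr_sqrtr; last by apply: sumr_ge0 => l _; exact: sqr_ge0.
  rewrite mulr_sumr; apply: ler_sum => l _; rewrite -exprMn.
  have [h1 h2] := hd l.
  have /andP[g1 g2] := grid_index_bounds M0 l xc.
  set s := leaf_side _ _ _ _ _ _ _ in h1 h2 *.
  rewrite -[leLHS]real_normK ?num_real// lerXn2r ?nnegrE ?mulr_ge0 ?invr_ge0//.
  rewrite tnth_mktuple ler_norml.
  have -> : (c i l)%:R / M%:R - tnth x l = M%:R^-1 * ((c i l)%:R - M%:R * tnth x l).
    by field; rewrite gt_eqF.
  rewrite -mulrN !ler_pM2l ?invr_gt0//.
  have h1' : (c i l)%:R + 1 <= (grid_index M x l)%:R + s%:R :> R by rewrite natr1 -natrD ler_nat.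
  have h2' : (grid_index M x l)%:R + 1 <= (c i l)%:R + s%:R :> R by rewrite natr1 -natrD ler_nat.
  by rewrite -natr1 in g2; apply/andP; split; lra.
apply: (@le_trans _ _ (L ^+ 2 * euclidean_dist (grid_corner R (c i)) x ^+ 2)).
  rewrite -exprMn -[leLHS]real_normK ?num_real// lerXn2r ?nnegrE ?mulr_ge0 ?sqrtr_ge0//.
  by apply: mL => //; exact: grid_corner_in_cube.
by rewrite [(L / _) ^+ 2]exprMn -[leRHS]mulrA ler_wpM2l// sqr_ge0.
Qed.

(** Initial weight of the recursion. The condition that data points avoid the slots of x is not
    invariant under exchanges of slots, so it is dropped here; the terms are nonnegative, hence the
    sum only grows. *)
Let mu c : R := (distinct_coords c)%:R.

Let mu_swap : swap_invariant mu lo0 hiM.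
Proof.
move=> j u v _ _ c; congr (_%:R); congr nat_of_bool.
apply/forallP/forallP => h j'; have /injectiveP hj := h j'; apply/injectiveP => i i' e; apply: hj.
  by rewrite !ffunE; rewrite e.
by move: e; rewrite !ffunE; case: eqP => // _ /perm_inj.
Qed.

Lemma sum_pattern_bias_le :
  \sum_(c | generic_pattern c) pattern_bias c ^+ 2 <=
  #|{: pattern n d M}|%:R * (d%:R * L ^+ 2 * median_contraction R d k * (M.+1%:R / M%:R) ^+ 2).
Proof.
set FR := forest_randomness d n a k.
pose bd c (theta : {set 'I_n} * split_coords d k) : R :=
  (L / M%:R) ^+ 2 * \sum_l (leaf_side c q l theta.2 theta.1 lo0 hiM)%:R ^+ 2.
have N0 : 0 < #|FR|%:R :> R by exact: card_forest_randomness_gt0.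
apply: (@le_trans _ _ (\sum_c mu c * ((\sum_(theta in FR) bd c theta) / #|FR|%:R))).
  rewrite big_mkcond /=; apply: ler_sum => c _.
  have bd0 : 0 <= (\sum_(theta in FR) bd c theta) / #|FR|%:R.
    rewrite divr_ge0//; apply: sumr_ge0 => theta _; rewrite mulr_ge0 ?sqr_ge0//.
    by apply: sumr_ge0 => l _; rewrite sqr_ge0.
  case: ifPn => gc; last by rewrite mulr_ge0.
  rewrite /mu (andP gc).1 mul1r.
  apply: sqr_weighted_sum_le => // [|theta i]; first exact: distinct_coordsP (andP gc).1.
  exact: leaf_bias_le.
under eq_bigr do rewrite mulrA mulr_sumr.
rewrite -mulr_suml exchange_big /= ler_pdivrMr//.
have -> : \sum_(theta in FR) \sum_c mu c * bd c theta =
   (L / M%:R) ^+ 2 * \sum_l \sum_(S : {set 'I_n} | #|S| == a) \sum_(t : split_coords d k)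
     \sum_c mu c * (leaf_side c q l t S lo0 hiM)%:R ^+ 2.
  transitivity ((L / M%:R) ^+ 2 * \sum_(theta in FR) \sum_l \sum_c mu c *
      (leaf_side c q l theta.2 theta.1 lo0 hiM)%:R ^+ 2).
    rewrite mulr_sumr; apply: eq_bigr => theta _.
    rewrite exchange_big /= mulr_sumr; apply: eq_bigr => c _.
    by rewrite /bd mulrCA -mulr_sumr.
  rewrite exchange_big /=; congr (_ * _); apply: eq_bigr => l _.
  by rewrite sum_forest_randomness.
have step l (S : {set 'I_n}) : #|S| == a -> \sum_(t : split_coords d k)
     \sum_c mu c * (leaf_side c q l t S lo0 hiM)%:R ^+ 2 <=
     #|split_coords d k|%:R * median_contraction R d k * M.+1%:R ^+ 2 * #|{: pattern n d M}|%:R.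
  move=> /eqP cS.
  have f1 c : 0 <= mu c by [].
  have f2 c : mu c != 0 -> in_box c S lo0 hiM /\ coord_inj c S.
    rewrite /mu; case: (boolP (distinct_coords c)) => [dc _|_]; last by rewrite eqxx.
    by split; [move=> i j _ /=; exact: ltn_ord|exact: distinct_coordsP].
  have f3 j : (hiM j <= M)%N by [].
  have f4 : (4 * 2 ^ k <= #|S|.+2)%N by rewrite cS; lia.
  apply: le_trans (leaf_side_moment q l f1 mu_swap f2 f3 f4) _.
  (* The root box has [M] slots per axis and counts for [M.+1], whence the ratio [M.+1 / M] in the
     result. *)
  rewrite /hiM /lo0 subn0 ler_wpM2l ?mulr_ge0 ?median_contraction_ge0 ?exprn_ge0//.
  rewrite -sum1_card natr_sum; apply: ler_sum => c _.
  by rewrite /mu; case: (distinct_coords c).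
apply: (@le_trans _ _ ((L / M%:R) ^+ 2 * \sum_(l < d) \sum_(S : {set 'I_n} | #|S| == a)
   (#|split_coords d k|%:R * median_contraction R d k * M.+1%:R ^+ 2 * #|{: pattern n d M}|%:R))).
  rewrite ler_wpM2l ?sqr_ge0//; apply: ler_sum => l _; apply: ler_sum => S.
  exact: step.
rewrite !sumr_const card_ord card_forest_randomness.
have -> : #|[pred S : {set 'I_n} | #|S| == a]| = 'C(n, a).
  by rewrite -[X in 'C(X, _)]card_ord -card_draws; apply: eq_card => S; rewrite !inE.
rewrite le_eqVlt; apply/orP; left; apply/eqP.
rewrite -[_ *+ d]mulr_natl -[_ *+ 'C(n, a)]mulr_natl; field.
by rewrite gt_eqF.
Qed.

End bias.

(** * Proportion of nongeneric patterns *)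

Section nongeneric.
Variables (R : realType) (n d M : nat) (x : d.-tuple R).
Implicit Types (c : pattern n d M).

Let set_entry c (i : 'I_n) (j : 'I_d) (u : 'I_M) : pattern n d M :=
  [ffun i1 => [ffun j1 => if (i1 == i) && (j1 == j) then u else c i1 j1]].

(** Overwriting entry [(i, j)] with an arbitrary slot is injective on the patterns considered, since
    [f], which ignores that entry, gives back the old value. *)
Let card_entry_eq (i : 'I_n) (j : 'I_d) (f : pattern n d M -> nat) :
  (forall c u, f (set_entry c i j u) = f c) ->
  (#|[set c : pattern n d M | c i j == f c :> nat]%SET| * M <= #|{: pattern n d M}|)%N.
Proof.
move=> fE; rewrite [X in (_ * X <= _)%N](_ : M = #|[set: 'I_M]%SET|); last first.
  by rewrite cardsT card_ord.
rewrite -cardsX.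
rewrite -(card_in_imset (f := fun p => set_entry p.1 i j p.2)); first exact: max_card.
move=> [c u] [c' u']; rewrite !inE /= !andbT => /eqP ec /eqP ec' e.
have euu : u = u'.
  by have := congr1 (fun c : pattern n d M => c i j) e; rewrite !ffunE !eqxx.
have ecc : c i j = c' i j by apply: ord_inj; rewrite ec ec' -(fE c u) e fE.
congr pair => //; apply/ffunP => i1; apply/ffunP => j1.
have := congr1 (fun c : pattern n d M => c i1 j1) e; rewrite !ffunE.
by case: ifP => // /andP[/eqP -> /eqP ->].
Qed.

(** Union bound: on each axis there are [n * n] possible coincidences between points and [n] with x,
    each of proportion at most [1 / M]. *)
Lemma card_nongeneric :
  (#|[set c : pattern n d M | ~~ generic_pattern x c]%SET| * M <=
   d * (n * n + n) * #|{: pattern n d M}|)%N.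
Proof.
set q := grid_index M x.
pose same i j i' c : nat := (i' != i) && (c i j == c i' j :> nat).
pose hit i j c : nat := c i j == q j :> nat.
have sub c : (~~ generic_pattern x c <=
    \sum_(j < d) \sum_(i < n) (\sum_(i' < n) same i j i' c + hit i j c))%N.
  rewrite /generic_pattern negb_and; case: (boolP (_ || _)) => // /orP[].
    move=> /forallPn[j /injectivePn[i [i' ne e]]].
    rewrite (bigD1 j)//= (bigD1 i)//= (bigD1 i')//=.
    by rewrite {1}/same eq_sym ne e eqxx.
  move=> /forallPn[i /forallPn[j]]; rewrite negbK => e.
  by rewrite (bigD1 j)//= (bigD1 i)//= {1}/hit eq_sym e; lia.
have -> : #|[set c : pattern n d M | ~~ generic_pattern x c]%SET| =
    (\sum_(c : pattern n d M) (~~ generic_pattern x c))%N.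
  by rewrite -sum1dep_card big_mkcond; apply: eq_bigr => c _; case: (generic_pattern x c).
apply: (@leq_trans ((\sum_(c : pattern n d M) \sum_(j < d) \sum_(i < n)
    (\sum_(i' < n) same i j i' c + hit i j c)) * M)%N).
  by rewrite leq_mul2r leq_sum ?orbT.
rewrite exchange_big /= big_distrl /=.
have cardE (Q : pred (pattern n d M)) : (\sum_c Q c)%N = #|[set c | Q c]%SET|.
  by rewrite -sum1dep_card [RHS]big_mkcond; apply: eq_bigr => c _; case: (Q c).
have step j : ((\sum_(c : pattern n d M)
    \sum_(i < n) (\sum_(i' < n) same i j i' c + hit i j c)) * M <=
    (n * n + n) * #|{: pattern n d M}|)%N.
  rewrite exchange_big /= big_distrl /=.
  have -> : (n * n + n = \sum_(i < n) n.+1)%N.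
    by rewrite sum_nat_const card_ord mulnS addnC.
  rewrite big_distrl /=; apply: leq_sum => i _.
  rewrite big_split /= mulnDl mulSn addnC leq_add//.
    rewrite cardE; apply: card_entry_eq => c u; done.
  rewrite exchange_big /= big_distrl /= -[X in (_ <= X * _)%N](card_ord n) -sum_nat_const.
  rewrite [leqRHS]sum_nat_const.
  rewrite -[leqRHS]sum_nat_const; apply: leq_sum => i' _.
  have [->|ne] := eqVneq i' i.
    by rewrite big1 ?mul0n// => c _; rewrite /same eqxx.
  rewrite cardE; apply: leq_trans (card_entry_eq (i := i) (j := j) (f := fun c => c i' j) _).
    rewrite leq_mul2r; apply/orP; right; apply/subset_leq_card/fintype.subsetP => c.
    by rewrite !inE => /andP[].
  by move=> c u; rewrite !ffunE (negbTE ne).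
apply: leq_trans (leq_sum _ (fun j _ => step j)) _.
by rewrite sum_nat_const card_ord mulnA.
Qed.

End nongeneric.

Lemma measurable_grid_cell (R : realType) (d M : nat) (u : {ffun 'I_d -> 'I_M}) :
  measurable (@grid_cell R d M u).
Proof.
rewrite (_ : @grid_cell R d M u = \bigcap_(j in [set: 'I_d])
    ((fun x : d.-tuple R => tnth x j) @^-1` `[(u j)%:R / M%:R, (u j).+1%:R / M%:R[)).
  apply: fin_bigcap_measurable => [|j _]; first exact: finite_finset.
  by rewrite -[_ @^-1` _]setTI; apply: measurable_tnth => //; exact: measurable_itv.
apply/seteqP; split => x h j; first by move=> _ /=; rewrite in_itv /=; exact: h.
by have := h j I; rewrite /= in_itv.
Qed.

(** * Risk on the event that the data have a given pattern *)

Section pattern_risk.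
Context {R : realType} {d : nat} {disp : measure_display} {T : measurableType disp}.
Variables (P : probability T R) (X0 : {RV P >-> d.-tuple R}) (Y0 : {RV P >-> R}).
Variables (m : d.-tuple R -> R) (L sigma : R) (n M : nat).
Variables (X : 'I_n -> {RV P >-> d.-tuple R}) (Y : 'I_n -> {RV P >-> R}).
Hypothesis model : regression_model P X0 Y0 m L sigma.
Hypothesis iid : iid_copies P X0 Y0 X Y.
Hypotheses (L0 : 0 <= L) (M0 : (0 < M)%N).

Let Z i w := (X i w, Y i w).
Let Z0 w := (X0 w, Y0 w).
Let cell := @grid_cell R d M.
Let kap (u : {ffun 'I_d -> 'I_M}) := m (grid_corner R u).
Let eta : R := L * (Num.sqrt d%:R / M%:R).
Let p : R := (M%:R^-1) ^+ d.

Let MR : 0 < M%:R :> R. Proof. by rewrite ltr0n. Qed.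
Let eta0 : 0 <= eta. Proof. by rewrite mulr_ge0// divr_ge0// sqrtr_ge0. Qed.
Let p0 : 0 <= p. Proof. by rewrite exprn_ge0// invr_ge0. Qed.

Let mZ i : measurable_fun setT (Z i). Proof. exact: measurable_fun_pair. Qed.
Let mZ0 : measurable_fun setT Z0. Proof. exact: measurable_fun_pair. Qed.

Let law i B : measurable B -> P (Z i @^-1` B) = P (Z0 @^-1` B).
Proof. by move=> mB; exact: iid.1. Qed.

Let cellT u : set (d.-tuple R * R) := cell u `*` setT.

Let mcellT u : measurable (cellT u).
Proof. by apply: measurableX => //; exact: measurable_grid_cell. Qed.

Lemma grid_cell_prob u : P (X0 @^-1` cell u) = p%:E.
Proof.
have := rm_uniform model
  (A := fun j => `[(u j)%:R / M%:R, (u j).+1%:R / M%:R[%classic) (fun j => measurable_itv _).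
rewrite (_ : X0 @^-1` _ = X0 @^-1` cell u) => [->|]; last first.
  apply/seteqP; split => w h j; have := h j; by rewrite /= in_itv.
rewrite (eq_bigr (fun=> (M%:R^-1)%:E)) => [|j _].
  by rewrite prodEFin prodr_const card_ord.
rewrite setIidl; last first.
  move=> r /=; rewrite !in_itv /= => /andP[r1 r2]; apply/andP; split.
    by apply: le_trans r1; rewrite divr_ge0.
  by apply: le_trans (ltW r2) _; rewrite ler_pdivrMr// mul1r ler_nat.
rewrite lebesgue_measure_itv /= lte_fin ltr_pM2r ?invr_gt0// ltr_nat ltnSn.
by rewrite -EFinD -mulrBl -natr1 addrAC subrr add0r mul1r.
Qed.

Lemma copy_cell_prob i u : P (X i @^-1` cell u) = p%:E.
Proof.
rewrite -(grid_cell_prob u).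
have e (f : T -> d.-tuple R) (g : T -> R) : f @^-1` cell u = (fun w => (f w, g w)) @^-1` cellT u.
  by apply/seteqP; split => w //= [].
rewrite (e (X i) (Y i)) (e X0 Y0); exact: law.
Qed.

(** The exponents 0, 1 and 2 give the probability of the cell and the first two moments of the
    residual in it. *)
Let resid u (e : nat) (z : d.-tuple R * R) : R := \1_(cell u) z.1 * (z.2 - kap u) ^+ e.

Let mresid u e : measurable_fun setT (resid u e).
Proof.
apply: measurable_funM.
  apply: (measurableT_comp _ measurable_fst); apply: measurable_indic.
  exact: measurable_grid_cell.
by apply: measurable_funX; apply: measurable_funB.
Qed.

Let Qm u x : cell u x -> in_cube x -> `|m x - kap u| <= eta.
Proof.
move=> hx xc; have gc : in_cube (grid_corner R u) by exact: grid_corner_in_cube.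
apply: le_trans (rm_lipschitz model xc gc) _.
by rewrite ler_wpM2l//; exact: grid_cell_dist.
Qed.

Let mcell u : measurable (cell u). Proof. exact: measurable_grid_cell. Qed.

Let mD u : measurable (X0 @^-1` cell u).
Proof. by rewrite -[_ @^-1` _]setTI; exact: measurable_funPT. Qed.

Let resid0 u e w : resid u e (Z0 w) = \1_(X0 @^-1` cell u) w * (Y0 w - kap u) ^+ e.
Proof.
by rewrite /resid /= !indicE; congr (_%:R * _); congr nat_of_bool;
  apply/idP/idP; rewrite !inE.
Qed.

Let resid_moments i u e : P.-integrable setT (EFin \o (fun w => (Y0 w - kap u) ^+ e)) ->
  P.-integrable setT (EFin \o (resid u e \o Z i)) /\
  \int[P]_w resid u e (Z i w) = \int[P]_(w in X0 @^-1` cell u) (Y0 w - kap u) ^+ e.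
Proof.
move=> h; have h1 := integrable_indic_mul (mD u) h.
have h2 : P.-integrable setT (EFin \o (resid u e \o Z0)).
  by apply: eq_integrable h1 => // w _ /=; rewrite resid0.
have [h3 h4] := integral_same_law (mZ i) mZ0 (@law i) (mresid u e) h2.
split => //; rewrite h4 -[RHS]Rintegral_indic_mul; apply: eq_Rintegral => w _; exact: resid0.
Qed.

Let icst (r : R) : P.-integrable setT (EFin \o cst r).
Proof. exact: finite_measure_integrable_cst. Qed.

Let pE u : fine (P (X0 @^-1` cell u)) = p. Proof. by rewrite grid_cell_prob. Qed.

Let resid0_moment i u : P.-integrable setT (EFin \o (resid u 0 \o Z i)) /\
  \int[P]_w resid u 0 (Z i w) = p.
Proof.
have [|h1 h2] := @resid_moments i u 0; first exact: icst.
by split => //; rewrite h2 (Rintegral_cst _ (mD u)) mul1r pE.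
Qed.

Let resid1_moment i u : P.-integrable setT (EFin \o (resid u 1 \o Z i)) /\
  `|\int[P]_w resid u 1 (Z i w)| <= eta * p.
Proof.
have [|h1 h2] := @resid_moments i u 1.
  have [iY' _ _ _] := rm_regression model.
  exact: (integrableB measurableT iY' (icst (kap u))).
split => //; rewrite h2 -(pE u).
exact: (cell_mean_le model (mcell u) (@Qm u) eta0).
Qed.

Let resid2_moment i u (t : R) : 0 < t -> P.-integrable setT (EFin \o (resid u 2 \o Z i)) /\
  \int[P]_w resid u 2 (Z i w) <= ((1 + t) * sigma ^+ 2 + (1 + t^-1) * eta ^+ 2) * p.
Proof.
move=> t0; have [|h1 h2] := @resid_moments i u 2.
  exact: (integrable_sqr_residual model (kap u)).
split => //; rewrite h2 -(pE u).
exact: (cell_sqr_le model (mcell u) (@Qm u) t0).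
Qed.

Definition pattern_event (c : pattern n d M) : set T :=
  [set w | forall i, @grid_cell R d M (c i) (X i w)].

Lemma measurable_pattern_event c : measurable (pattern_event c).
Proof.
rewrite (_ : pattern_event c = \bigcap_(i in [set: 'I_n]) (X i @^-1` cell (c i))).
  apply: fin_bigcap_measurable => [|i _]; first exact: finite_finset.
  by rewrite -[_ @^-1` _]setTI; exact: measurable_funPT.
by apply/seteqP; split => w h i; [move=> _; exact: h|exact: (h i I)].
Qed.

Lemma pattern_event_prob c : P (pattern_event c) = (p ^+ n)%:E.
Proof.
have := iid.2 (fun i => cellT (c i)) (fun i => mcellT (c i)).
rewrite (_ : [set w | forall i, cellT (c i) (X i w, Y i w)] = pattern_event c); last first.
  by apply/seteqP; split => w h i; [have [] := h i|split => //; exact: h].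
move=> ->; rewrite (eq_bigr (fun=> p%:E)); first by rewrite prodEFin prodr_const card_ord.
move=> i _; rewrite -(copy_cell_prob i (c i)); congr (P _).
by apply/seteqP; split => w /=; [case|].
Qed.

(** The other points contribute [p] to the power [n - 2]; the factor [p ^+ 2] on the left avoids
    this subtraction. *)
Let pattern_pair_moment (c : pattern n d M) (i i' : 'I_n) (e e' : nat) : i != i' ->
  P.-integrable setT (EFin \o (resid (c i) e \o Z i)) ->
  P.-integrable setT (EFin \o (resid (c i') e' \o Z i')) ->
  P.-integrable setT (EFin \o (fun w => \1_(pattern_event c) w *
    ((Y i w - kap (c i)) ^+ e * (Y i' w - kap (c i')) ^+ e'))) /\
  p ^+ 2 * \int[P]_w (\1_(pattern_event c) w *
    ((Y i w - kap (c i)) ^+ e * (Y i' w - kap (c i')) ^+ e')) =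
  p ^+ n * (\int[P]_w resid (c i) e (Z i w) * \int[P]_w resid (c i') e' (Z i' w)).
Proof.
move=> ii' h h'.
have [h1 h2] := pair_expectation mZ iid.2 ii' (fun l => mcellT (c l))
  (mresid _ _) (mresid _ _) h h'.
set J := others_in _ _ _ _ in h1 h2.
have e1 w : resid (c i) e (Z i w) * (\1_J w * resid (c i') e' (Z i' w)) =
    \1_(pattern_event c) w * ((Y i w - kap (c i)) ^+ e * (Y i' w - kap (c i')) ^+ e').
  have -> : \1_(pattern_event c) w =
      \1_(cell (c i)) (X i w) * (\1_J w * \1_(cell (c i')) (X i' w)) :> R.
    rewrite !indicE -!natrM !mulnb; congr (_%:R); congr nat_of_bool.
    apply/idP/idP; rewrite !inE.
      move=> h0; apply/and3P; split; rewrite inE; [exact: h0| |exact: h0].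
      by move=> l _ _; split => //; exact: h0.
    move=> /and3P[]; rewrite !inE => c1 hJ c2 l.
    have [->//|li] := eqVneq l i; have [->//|li'] := eqVneq l i'.
    by have [] := hJ l li li'.
  by rewrite /resid /=; ring.
split.
  by apply: eq_integrable h1 => // w _ /=; rewrite e1.
have -> : \int[P]_w (\1_(pattern_event c) w *
    ((Y i w - kap (c i)) ^+ e * (Y i' w - kap (c i')) ^+ e')) =
    \int[P]_w (resid (c i) e (Z i w) * (\1_J w * resid (c i') e' (Z i' w))).
  by apply: eq_Rintegral => w _; rewrite e1.
rewrite h2 mulrCA mulrC; congr (_ * _).
rewrite (eq_bigr (fun=> p)) => [|l _]; last first.
  rewrite (_ : Z l @^-1` cellT (c l) = X l @^-1` cell (c l)) ?copy_cell_prob//.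
  by apply/seteqP; split => w /=; [case|].
have -> : p ^+ n = \prod_(l < n) p by rewrite prodr_const card_ord.
rewrite [RHS](bigD1 i)//= [X in _ = _ * X](bigD1 i')/=; last by rewrite eq_sym.
by rewrite expr2 mulrA.
Qed.

Hypothesis n2 : (1 < n)%N.

Let p_gt0 : 0 < p. Proof. by rewrite exprn_gt0// invr_gt0. Qed.

(** With a second index, one-point moments become pair moments of exponent 0 at the second point. *)
Let other (i : 'I_n) : exists i' : 'I_n, i != i'.
Proof.
have : (0 < #|[set~ i]%SET|)%N by rewrite cardsC1 card_ord; lia.
by move=> /card_gt0P[i']; rewrite !inE eq_sym => h; exists i'.
Qed.

Let cross_moment c i i' : i != i' ->
  P.-integrable setT (EFin \o (fun w => \1_(pattern_event c) w *
    ((Y i w - kap (c i)) * (Y i' w - kap (c i'))))) /\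
  \int[P]_w (\1_(pattern_event c) w *
    ((Y i w - kap (c i)) * (Y i' w - kap (c i')))) <= p ^+ n * eta ^+ 2.
Proof.
move=> ii'; have [h1 b1] := resid1_moment i (c i); have [h2 b2] := resid1_moment i' (c i').
have [h3 h4] := pattern_pair_moment ii' h1 h2.
split => //; rewrite -(ler_pM2l (exprn_gt0 2 p_gt0)) h4 [leRHS]mulrCA ler_wpM2l ?exprn_ge0//.
apply: le_trans (ler_norm _) _; rewrite normrM.
apply: le_trans (ler_pM (normr_ge0 _) (normr_ge0 _) b1 b2) _.
by rewrite le_eqVlt; apply/orP; left; apply/eqP; ring.
Qed.

Let square_moment c i (t : R) : 0 < t ->
  P.-integrable setT (EFin \o (fun w => \1_(pattern_event c) w *
    ((Y i w - kap (c i)) * (Y i w - kap (c i))))) /\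
  \int[P]_w (\1_(pattern_event c) w *
    ((Y i w - kap (c i)) * (Y i w - kap (c i)))) <=
  p ^+ n * ((1 + t) * sigma ^+ 2 + (1 + t^-1) * eta ^+ 2).
Proof.
move=> t0; have [i' ii'] := other i.
have [h1 b1] := resid2_moment i (c i) t0; have [h2 b2] := resid0_moment i' (c i').
have [h3 h4] := pattern_pair_moment ii' h1 h2.
have e w : (Y i w - kap (c i)) ^+ 2 * (Y i' w - kap (c i')) ^+ 0 =
  (Y i w - kap (c i)) * (Y i w - kap (c i)) by rewrite expr0 mulr1 expr2.
split; first by apply: eq_integrable h3 => // w _ /=; rewrite e.
under eq_Rintegral do rewrite -e.
rewrite -(ler_pM2l (exprn_gt0 2 p_gt0)) h4 [leRHS]mulrCA ler_wpM2l ?exprn_ge0//.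
rewrite b2; move: b1; set s2 := (_ + _ * eta ^+ 2) => b1.
by rewrite [leRHS](_ : _ = s2 * p * p); [rewrite ler_wpM2r|ring].
Qed.

Let single_moment c i :
  P.-integrable setT (EFin \o (fun w => \1_(pattern_event c) w * (Y i w - kap (c i)))) /\
  `|\int[P]_w (\1_(pattern_event c) w * (Y i w - kap (c i)))| <= p ^+ n * eta.
Proof.
have [i' ii'] := other i.
have [h1 b1] := resid1_moment i (c i); have [h2 b2] := resid0_moment i' (c i').
have [h3 h4] := pattern_pair_moment ii' h1 h2.
have e w : (Y i w - kap (c i)) ^+ 1 * (Y i' w - kap (c i')) ^+ 0 =
  (Y i w - kap (c i)) by rewrite expr0 mulr1.
split; first by apply: eq_integrable h3 => // w _ /=; rewrite e.
under eq_Rintegral do rewrite -e.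
rewrite -(ler_pM2l (exprn_gt0 2 p_gt0)) -{1}[p ^+ 2]ger0_norm ?exprn_ge0// -normrM h4.
rewrite normrM ger0_norm ?exprn_ge0// [leRHS]mulrCA ler_wpM2l ?exprn_ge0//.
rewrite b2 normrM (ger0_norm p0).
by rewrite [leRHS](_ : _ = eta * p * p); [rewrite ler_wpM2r|ring].
Qed.

(** The error is the weighted sum of the residuals plus the constant [b]. In the expanded square,
    the products of distinct residuals cost [eta ^+ 2] by independence, the diagonal costs [W] times
    a second moment since the sum of the [w i ^+ 2] is at most [W], and the term linear in the
    residuals costs [2 * |b| * eta]. *)
Lemma pattern_risk_le (c : pattern n d M) (w : 'I_n -> R) (W mu t : R) :
  (forall i, 0 <= w i) -> \sum_i w i = 1 -> (forall i, w i <= W) -> 0 < t ->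
  let b := \sum_i w i * (m (grid_corner R (c i)) - mu) in
  P.-integrable setT (EFin \o (fun o => \1_(pattern_event c) o *
    (\sum_i w i * Y i o - mu) ^+ 2)) /\
  \int[P]_o (\1_(pattern_event c) o * (\sum_i w i * Y i o - mu) ^+ 2) <=
  (M%:R^-1) ^+ d ^+ n * (eta ^+ 2 + W * ((1 + t) * sigma ^+ 2 + (1 + t^-1) * eta ^+ 2)
    + 2 * `|b| * eta + b ^+ 2).
Proof.
move=> w0 w1 wW t0 b; rewrite -/p.
set s2 := (1 + t) * sigma ^+ 2 + (1 + t^-1) * eta ^+ 2.
have s20 : 0 <= s2.
  by rewrite addr_ge0// mulr_ge0 ?sqr_ge0// addr_ge0// ?invr_ge0 ltW.
pose TT i i' o := w i * w i' * (\1_(pattern_event c) o *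
    ((Y i o - kap (c i)) * (Y i' o - kap (c i')))) : R.
pose U i o := 2 * b * w i * (\1_(pattern_event c) o * (Y i o - kap (c i))) : R.
have iprod i i' : P.-integrable setT (EFin \o (fun o => \1_(pattern_event c) o *
    ((Y i o - kap (c i)) * (Y i' o - kap (c i'))))).
  have [->|ii'] := eqVneq i i'; first by have [] := square_moment c i' t0.
  by have [] := cross_moment c ii'.
have iTT i i' : P.-integrable setT (EFin \o TT i i').
  exact: (integrableZl measurableT (w i * w i') (iprod i i')).
have iU i : P.-integrable setT (EFin \o U i).
  exact: (integrableZl measurableT (2 * b * w i) (single_moment c i).1).
have iI : P.-integrable setT (EFin \o (fun o => \1_(pattern_event c) o * b ^+ 2)).
  exact: (integrable_indic_mul (measurable_pattern_event c) (icst (b ^+ 2))).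
have iTs : P.-integrable setT (EFin \o (fun o => \sum_i \sum_i' TT i i' o)).
  by apply: integrable_sumR => i; exact: integrable_sumR.
have iUs : P.-integrable setT (EFin \o (fun o => \sum_i U i o)).
  exact: integrable_sumR.
have iTU := integrableD measurableT iTs iUs.
have eqn o : \1_(pattern_event c) o * (\sum_i w i * Y i o - mu) ^+ 2 =
    \sum_i \sum_i' TT i i' o + \sum_i U i o + \1_(pattern_event c) o * b ^+ 2.
  have -> : \sum_i w i * Y i o - mu = \sum_i w i * (Y i o - kap (c i)) + b.
    rewrite /b -big_split /= -{1}[mu]mul1r -w1 mulr_suml -sumrB.
    by apply: eq_bigr => i _; rewrite /kap; ring.
  have -> : \sum_i U i o = 2 * b * \1_(pattern_event c) o * \sum_i w i * (Y i o - kap (c i)).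
    by rewrite mulr_sumr; apply: eq_bigr => i _; rewrite /U; ring.
  have -> : \sum_i \sum_i' TT i i' o = \1_(pattern_event c) o *
      ((\sum_i w i * (Y i o - kap (c i))) * (\sum_i w i * (Y i o - kap (c i)))).
    rewrite mulr_suml mulr_sumr; apply: eq_bigr => i _; rewrite !mulr_sumr.
    by apply: eq_bigr => i' _; rewrite /TT; ring.
  by ring.
split.
  apply: eq_integrable (integrableD measurableT iTU iI) => // o _ /=.
  by rewrite eqn.
under eq_Rintegral do rewrite eqn.
rewrite (RintegralD measurableT iTU iI) (RintegralD measurableT iTs iUs).
have -> : \int[P]_o (\1_(pattern_event c) o * b ^+ 2) = b ^+ 2 * p ^+ n.
  rewrite Rintegral_indic_mul (Rintegral_cst _ (measurable_pattern_event c)).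
  by congr (_ * _); exact: (congr1 (@fine R) (pattern_event_prob c)).
rewrite Rintegral_sum => [|i]; last exact: integrable_sumR.
rewrite Rintegral_sum//.
(* The diagonal terms keep the off-diagonal bound as well, so that the first part sums to a product
   of two sums equal to 1. *)
have bT i i' : \int[P]_o TT i i' o <= w i * w i' * (p ^+ n * eta ^+ 2) +
    (i' == i)%:R * (w i * (W * (p ^+ n * s2))).
  rewrite RintegralZl//.
  have ww : 0 <= w i * w i' by rewrite mulr_ge0.
  have [->|ii'] := eqVneq i' i.
    have [_ h] := square_moment c i t0.
    apply: le_trans (ler_wpM2l (mulr_ge0 (w0 i) (w0 i)) h) _; rewrite mul1r.
    have h1 : w i * w i * (p ^+ n * s2) <= w i * (W * (p ^+ n * s2)).
      by rewrite -mulrA ler_wpM2l// ler_wpM2r// mulr_ge0// exprn_ge0.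
    apply: le_trans h1 _; rewrite lerDr mulr_ge0 ?mulr_ge0 ?sqr_ge0// exprn_ge0//.
  rewrite mul0r addr0 ler_wpM2l//; rewrite eq_sym in ii'.
  by have [] := cross_moment c ii'.
have bU i : \int[P]_o U i o <= w i * (2 * `|b| * (p ^+ n * eta)).
  rewrite RintegralZl//; last exact: (single_moment c i).1.
  have := (single_moment c i).2; set I := \int[P]_w _ => hI.
  have hb : b * I <= `|b| * (p ^+ n * eta).
    by apply: le_trans (ler_norm _) _; rewrite normrM ler_wpM2l.
  rewrite (_ : _ * I = w i * (2 * (b * I))); last by ring.
  by rewrite ler_wpM2l// -mulrA ler_wpM2l.
have hT : \sum_i \int[P]_o (\sum_i' TT i i' o) <= p ^+ n * eta ^+ 2 + W * (p ^+ n * s2).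
  under eq_bigr do rewrite Rintegral_sum//.
  apply: le_trans (ler_sum _ (fun i _ => ler_sum _ (fun i' _ => bT i i'))) _.
  under eq_bigr do rewrite big_split /= -mulr_suml -mulr_sumr w1 mulr1.
  rewrite big_split /= -mulr_suml w1 mul1r lerD2l.
  under eq_bigr => i _ do rewrite -mulr_suml (bigD1 i)//= eqxx
    big1 ?addr0 ?mul1r => [|i' /negbTE -> //].
  by rewrite -mulr_suml w1 mul1r.
have hU : \sum_i \int[P]_o U i o <= 2 * `|b| * (p ^+ n * eta).
  apply: le_trans (ler_sum _ (fun i _ => bU i)) _.
  by rewrite -mulr_suml w1 mul1r.
apply: le_trans (lerD (lerD hT hU) (lexx _)) _.
by rewrite le_eqVlt; apply/orP; left; apply/eqP; ring.
Qed.

End pattern_risk.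

(** * Summation over the patterns and the limit of fine grids *)

Section forest_risk_bound.
Context {R : realType} {d : nat} {disp : measure_display} {T : measurableType disp}.
Variables (P : probability T R) (X0 : {RV P >-> d.-tuple R}) (Y0 : {RV P >-> R}).
Variables (m : d.-tuple R -> R) (L sigma : R) (n : nat).
Variables (X : 'I_n -> {RV P >-> d.-tuple R}) (Y : 'I_n -> {RV P >-> R}).
Variables (a k : nat) (x : d.-tuple R).
Hypothesis model : regression_model P X0 Y0 m L sigma.
Hypothesis iid : iid_copies P X0 Y0 X Y.
Hypotheses (L0 : 0 <= L) (d0 : (0 < d)%N).
Hypotheses (ha : (a <= n)%N) (hk : (4 * 2 ^ k <= a)%N) (xc : in_cube x).

Let k0 : (0 < 2 ^ k)%N. Proof. by rewrite expn_gt0. Qed.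
Let n2 : (1 < n)%N. Proof. by have := k0; lia. Qed.

Section grid_size.
Variable M : nat.
Hypothesis M0 : (0 < M)%N.
Let MR : 0 < M%:R :> R. Proof. by rewrite ltr0n. Qed.
Let h : R := M%:R^-1.
Let h0 : 0 < h. Proof. by rewrite invr_gt0. Qed.
Let pn : R := h ^+ d ^+ n.
Let N : R := #|{: pattern n d M}|%:R.

Let pnN : pn * N = 1.
Proof.
rewrite /pn /N !card_ffun !card_ord natrX natrX -!exprMn /h.
by rewrite mulVf ?gt_eqF// !expr1n.
Qed.

Let pn0 : 0 <= pn. Proof. by rewrite exprn_ge0// exprn_ge0// ltW. Qed.

Let gen (c : pattern n d M) : bool := generic_pattern x c.
Let Ev (c : pattern n d M) : set T := pattern_event X c.
Let mEv c : measurable (Ev c). Proof. exact: measurable_pattern_event. Qed.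

Definition generic_event : set T := \bigcup_(c in [set c | gen c]) Ev c.

Lemma measurable_generic_event : measurable generic_event.
Proof. by apply: fin_bigcup_measurable => //; exact: finite_finset. Qed.

Lemma pattern_event_disjoint (c c' : pattern n d M) w : Ev c w -> Ev c' w -> c = c'.
Proof.
move=> hc hc'; apply/ffunP => i; apply/ffunP => j; apply: ord_inj.
have /andP[a1 a2] := hc i j; have /andP[b1 b2] := hc' i j.
have := le_lt_trans a1 b2; have := le_lt_trans b1 a2.
rewrite !ltr_pM2r ?invr_gt0// !ltr_nat !ltnS => h1 h2.
by apply/eqP; rewrite eqn_leq h1 h2.
Qed.

Lemma generic_event_prob :
  (P (~` generic_event) <= ((d * (n * n + n))%:R * h)%:E)%E.
Proof.
have mG := measurable_generic_event.
have iE c : P.-integrable setT (EFin \o (\1_(Ev c) : T -> R)) by exact: integrable_indic.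
have le1 w : \sum_(c <- enum gen) \1_(Ev c) w <= \1_generic_event w :> R.
  rewrite big_enum /=.
  have [[c gc Ec]|nG] := pselect (generic_event w).
    rewrite [leRHS]indicE mem_set; last by exists c.
    rewrite (bigD1 c)//= big1 ?addr0; first by rewrite indicE; case: (w \in _).
    move=> c' /andP[_ ne]; rewrite indicE memNset// => Ec'.
    by move: ne; rewrite (pattern_event_disjoint Ec Ec') eqxx.
  rewrite big1 ?indicE// => c gc; rewrite indicE memNset// => Ec.
  by apply: nG; exists c.
have PG : #|gen|%:R * pn <= fine (P generic_event).
  have e1 : \int[P]_w (\sum_(c <- enum gen) \1_(Ev c) w) = #|gen|%:R * pn.
    rewrite Rintegral_sum// big_enum /= (eq_bigr (fun=> pn)) ?sumr_const ?mulr_natl// => c _.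
    rewrite /Rintegral integral_indic// setIT.
    exact: (congr1 (@fine R) (pattern_event_prob model iid M0 c)).
  have e2 : \int[P]_w (\1_generic_event w) = fine (P generic_event).
    by rewrite /Rintegral integral_indic// setIT.
  rewrite -e1 -e2; apply: le_Rintegral => //.
    exact: integrable_sumR.
  exact: integrable_indic.
rewrite probability_setC// -(fineK (fin_num_measure P _ mG)) -EFinB lee_fin.
have cg := cardC gen.
have NN : N = #|gen|%:R + #|predC gen|%:R by rewrite -natrD cg.
have cn := card_nongeneric n M x.
have ec : #|[set c : pattern n d M | ~~ generic_pattern x c]%SET| = #|predC gen|.
  by apply: eq_card => c; rewrite !inE.
rewrite ec -(ler_nat R) !natrM -/N in cn.
have cn' : #|predC gen|%:R * pn <= (d * (n * n + n))%:R * h.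
  rewrite /h ler_pdivlMr// mulrAC.
  have -> : (d * (n * n + n))%:R = (d * (n * n + n))%:R * N * pn.
    by rewrite -mulrA [N * pn]mulrC pnN mulr1.
  by rewrite ler_wpM2r// natrM.
have : pn * N = #|gen|%:R * pn + #|predC gen|%:R * pn by rewrite NN; ring.
by rewrite pnN; lra.
Qed.

Let w (c : pattern n d M) (i : 'I_n) : R := forest_weight R a k (grid_index M x) c i.
Let W : R := 2 * 2 ^+ k / n%:R.

Let ginj c S : gen c -> coord_inj c S.
Proof. by move=> /andP[/distinct_coordsP h1 _]; exact: h1. Qed.

Let B : R := d%:R * L ^+ 2 * median_contraction R d k.

(** Coefficient of [h] in the risk bound. In order: the squared oscillation of [m] in a cell, the
    excess of the second moment, the cross term with the bias, and [(M.+1 / M) ^ 2 <= 1 + 3 * h]. *)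
Definition grid_error : R :=
  L ^+ 2 * d%:R + W * (sigma ^+ 2 + 2 * (L ^+ 2 * d%:R)) + 2 * (L ^+ 2 * d%:R) + 3 * B.

(** A measurable stand-in for the squared error: the pattern events are disjoint, so at most one
    term is nonzero. *)
Definition generic_risk (o : T) : R :=
  \sum_(c <- enum gen) \1_(Ev c) o * (\sum_i w c i * Y i o - m x) ^+ 2.

Lemma forest_error_generic o : generic_event o ->
  (forest_estimate a k (fun i => X i o) (fun i => Y i o) x - m x) ^+ 2 <= generic_risk o.
Proof.
move=> [c gc Ec]; rewrite /generic_risk big_enum (bigD1 c)//=.
have /andP[dc /forallP qc] := gc.
rewrite (@forest_estimate_weight R n d M a k (grid_index M x) hk c (@ginj c _ gc) _ _ x).
- rewrite indicE mem_set// mul1r lerDl sumr_ge0// => c' _.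
  by rewrite mulr_ge0// sqr_ge0.
- move=> i i' j; have [->|ne] := eqVneq i i'; first by rewrite ltxx ltnn.
  apply: (grid_cell_lt M0 (Ec i) (Ec i')).
  move: dc => /forallP /(_ j) /injectiveP hj.
  by apply: contra_neq ne; exact: hj.
- move=> i j; apply: (grid_cell_le_index M0 xc (Ec i)).
  by have /forallP := qc i; exact.
Qed.

(* Here the free parameter t of cell_sqr_le is 1/M. *)
Lemma generic_risk_integral :
  P.-integrable setT (EFin \o generic_risk) /\
  \int[P]_o generic_risk o <= sigma ^+ 2 * W + B + h * grid_error.
Proof.
have W0 : 0 <= W by rewrite divr_ge0// mulr_ge0// exprn_ge0.
have risk c (gc : gen c) := @pattern_risk_le R d disp T P X0 Y0 m L sigma n M X Y model iid L0 M0 n2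
  c (w c) W (m x) h (@forest_weight_ge0 R n d M a k _ c)
  (@sum_forest_weight R n d M a k (grid_index M x) ha hk c (@ginj c _ gc) d0)
  (@forest_weight_le R n d M a k (grid_index M x) ha hk c (@ginj c _ gc) d0) h0.
rewrite /= in risk.
have iR c : P.-integrable setT (EFin \o (fun o => (if gen c then 1 else 0) *
    (\1_(Ev c) o * (\sum_i w c i * Y i o - m x) ^+ 2))).
  case: ifPn => gc.
    by apply: eq_integrable (risk c gc).1 => // o _ /=; rewrite mul1r.
  by apply: eq_integrable (integrable0 P setT) => // o _ /=; rewrite mul0r.
have eR o : generic_risk o = \sum_c ((if gen c then 1 else 0) *
    (\1_(Ev c) o * (\sum_i w c i * Y i o - m x) ^+ 2)).
  rewrite /generic_risk big_enum big_mkcond /=; apply: eq_bigr => c _.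
  by rewrite unfold_in /gen; case: generic_pattern; rewrite ?mul1r ?mul0r.
split.
  by apply: eq_integrable (integrable_sumR (index_enum _) iR) => // o _ /=; rewrite eR.
under eq_Rintegral do rewrite eR.
rewrite (Rintegral_sum _ iR).
set s2 := (1 + h) * sigma ^+ 2 + (1 + h^-1) * (L * (Num.sqrt d%:R / M%:R)) ^+ 2.
set eta := L * (Num.sqrt d%:R / M%:R) in s2 *.
have hV : h^-1 = M%:R by rewrite /h invrK.
have s20 : 0 <= s2 by rewrite addr_ge0// mulr_ge0 ?sqr_ge0// addr_ge0// ?hV// ltW.
have eta0 : 0 <= eta by rewrite mulr_ge0// divr_ge0// sqrtr_ge0.
have sd0 : 0 <= Num.sqrt d%:R :> R by rewrite sqrtr_ge0.
have eta2 : eta ^+ 2 = L ^+ 2 * d%:R * h ^+ 2.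
  by rewrite /eta !exprMn sqr_sqrtr// mulrA.
have bias_le c : gen c -> `|pattern_bias a k m x c| <= L * Num.sqrt d%:R.
  move=> gc; have : L * Num.sqrt d%:R <= L * Num.sqrt d%:R by [].
  move: {2 3}(L * Num.sqrt d%:R) => r hr; rewrite /pattern_bias.
  apply: le_trans (ler_norm_sum _ _ _) _.
  rewrite -[leRHS]mul1r.
  rewrite -(@sum_forest_weight R n d M a k (grid_index M x) ha hk c (@ginj c _ gc) d0).
  rewrite mulr_suml.
  apply: ler_sum => i _; rewrite normrM ger0_norm ?forest_weight_ge0//.
  rewrite ler_wpM2l ?forest_weight_ge0//.
  have gcu := grid_corner_in_cube R M0 (c i).
  apply: le_trans (rm_lipschitz model gcu xc) _; apply: le_trans hr; rewrite ler_wpM2l//.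
  rewrite /euclidean_dist ler_wsqrtr//.
  have -> : d%:R = \sum_(j < d) 1 :> R by rewrite sumr_const card_ord.
  apply: ler_sum => j _; have /andP[g1 g2] := gcu j; have /andP[x1 x2] := xc j.
  by rewrite -[leLHS]real_normK ?num_real// exprn_ile1// ler_norml; apply/andP; split; lra.
(* Nongeneric patterns receive the same error term, so that it is averaged over all patterns and
   [pn * N = 1] applies. *)
have term c : \int[P]_o ((if gen c then 1 else 0) *
    (\1_(Ev c) o * (\sum_i w c i * Y i o - m x) ^+ 2)) <=
    pn * (eta ^+ 2 + W * s2 + 2 * (L * Num.sqrt d%:R) * eta) +
    pn * (if gen c then pattern_bias a k m x c ^+ 2 else 0).
  case: ifPn => gc; last first.
    under eq_Rintegral do rewrite mul0r.
    rewrite (Rintegral_cst _ measurableT) mul0r mulr0 addr0 mulr_ge0// !addr_ge0//.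
    - by rewrite exprn_ge0.
    - by rewrite mulr_ge0.
    - by rewrite !mulr_ge0.
  under eq_Rintegral do rewrite mul1r.
  apply: le_trans (risk c gc).2 _.
  rewrite -/pn -/eta -/s2 -/(pattern_bias a k m x c) -mulrDr ler_wpM2l//.
  rewrite lerD2r// lerD2l ler_wpM2r// ler_wpM2l//.
  exact: bias_le.
apply: le_trans (ler_sum _ (fun c _ => term c)) _.
rewrite big_split /= sumr_const -mulr_sumr -big_mkcond /=.
have sb := sum_pattern_bias_le M0 d0 ha hk L0 (rm_lipschitz model) xc.
rewrite -/B -/N in sb.
have {}sb : pn * \sum_(c | gen c) pattern_bias a k m x c ^+ 2 <= B * (1 + 3 * h).
  apply: le_trans (ler_wpM2l pn0 sb) _.
  rewrite [leLHS](_ : _ = pn * N * (B * (M.+1%:R / M%:R) ^+ 2)); last by ring.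
  rewrite pnN mul1r ler_wpM2l//.
    by rewrite mulr_ge0 ?median_contraction_ge0// mulr_ge0// sqr_ge0.
  have -> : M.+1%:R / M%:R = 1 + h by rewrite -natr1 mulrDl mulfV ?gt_eqF// mul1r.
  have : h ^+ 2 <= h by rewrite expr2 ger_pMl// invf_le1// ler1n.
  by lra.
have hh : h ^+ 2 <= h by rewrite expr2 ger_pMl// invf_le1// ler1n.
have Ld0 : 0 <= L ^+ 2 * d%:R by rewrite mulr_ge0// sqr_ge0.
have s2le : s2 <= sigma ^+ 2 + h * (sigma ^+ 2 + 2 * (L ^+ 2 * d%:R)).
  have e : h^-1 * h ^+ 2 = h by rewrite expr2 mulKf// gt_eqF.
  have : (1 + h^-1) * eta ^+ 2 <= 2 * h * (L ^+ 2 * d%:R).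
    rewrite eta2 [leLHS](_ : _ = (h ^+ 2 + h^-1 * h ^+ 2) * (L ^+ 2 * d%:R)); last by ring.
    by rewrite e ler_wpM2r//; lra.
  by rewrite /s2; lra.
have eta2le : eta ^+ 2 <= h * (L ^+ 2 * d%:R).
  by rewrite eta2 mulrC ler_wpM2r.
have Ldeta : L * Num.sqrt d%:R * eta = h * (L ^+ 2 * d%:R).
  transitivity (h * (L ^+ 2 * (Num.sqrt d%:R) ^+ 2)); last by rewrite sqr_sqrtr.
  by rewrite /eta /h; ring.
have sbg : (pn * (eta ^+ 2 + W * s2 + 2 * (L * Num.sqrt d%:R) * eta)) *+ #|{: pattern n d M}| =
    eta ^+ 2 + W * s2 + 2 * (L * Num.sqrt d%:R) * eta.
  by rewrite -mulr_natl -/N mulrA [N * pn]mulrC pnN mul1r.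
apply: (@le_trans _ _ (eta ^+ 2 + W * s2 + 2 * (L * Num.sqrt d%:R) * eta + B * (1 + 3 * h))).
  by apply: lerD; [rewrite sbg|exact: sb].
rewrite -[2 * _ * eta]mulrA Ldeta /grid_error.
have := ler_wpM2l W0 s2le; lra.
Qed.

End grid_size.

Lemma forest_risk_le_contraction :
  (forest_risk P m X Y a k x <=
    (2 * sigma ^+ 2 * (2 ^+ k / n%:R) + d%:R * L ^+ 2 * median_contraction R d k)%:E)%E.
Proof.
rewrite /forest_risk unlock; apply: integral_le_of_truncated => [w|e e0]; first exact: sqr_ge0.
set K := grid_error; set K1 : R := (d * (n * n + n))%:R.
have K0 : 0 <= K.
  have Ld0 : 0 <= L ^+ 2 * d%:R by rewrite mulr_ge0// sqr_ge0.
  have mc0 : 0 <= median_contraction R d k by exact: median_contraction_ge0.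
  have W0 : 0 <= 2 * 2 ^+ k / n%:R :> R by rewrite divr_ge0// mulr_ge0// exprn_ge0.
  have S0 : 0 <= sigma ^+ 2 + 2 * (L ^+ 2 * d%:R) by rewrite addr_ge0 ?sqr_ge0// mulr_ge0.
  have B0 : 0 <= d%:R * L ^+ 2 * median_contraction R d k.
    by rewrite mulr_ge0// mulr_ge0// sqr_ge0.
  apply: addr_ge0; last exact: mulr_ge0.
  apply: addr_ge0; last exact: mulr_ge0.
  by apply: addr_ge0 => //; exact: mulr_ge0.
(* Makes both the risk error [K / M] and the probability bound [K1 / M] at most [e]. *)
pose M := (Num.truncn ((K + K1) / e)).+1.
have M0 : (0 < M)%N by [].
have MR : 0 < M%:R :> R by rewrite ltr0n.
have hM : (K + K1) / M%:R <= e.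
  rewrite ler_pdivrMr// mulrC -ler_pdivrMr//.
  exact/ltW/truncnS_gt.
have [iG rG] := generic_risk_integral M0.
exists (generic_event M), (generic_risk M); split.
- exact: measurable_generic_event.
- apply: le_trans (generic_event_prob M0) _; rewrite lee_fin.
  apply: le_trans hM; rewrite ler_wpM2r ?invr_ge0//; rewrite -/K1; lra.
- by apply/measurable_EFinP; exact: measurable_int iG.
- split.
  + move=> o; rewrite sumr_ge0// => c _; rewrite mulr_ge0// ?sqr_ge0//.
  + exact: forest_error_generic.
  + rewrite -(fineK (integrable_fin_num measurableT iG)) lee_fin.
    apply: le_trans rG _.
    have : M%:R^-1 * K <= e.
      apply: le_trans hM; rewrite mulrC ler_wpM2r ?invr_ge0// lerDl.
      by rewrite /K1.
    rewrite -/K [sigma ^+ 2 * _](_ : _ = 2 * sigma ^+ 2 * (2 ^+ k / n%:R)); last by ring.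
    by lra.
Qed.

End forest_risk_bound.

(** * Optimal level *)

Lemma beta_rate_bounds (R : realType) (d : nat) : (0 < d)%N ->
  1 / 4 <= beta_rate R d < 1.
Proof.
move=> d0; have d1 : 1 <= d%:R :> R by rewrite ler1n.
have dV : 0 < d%:R^-1 :> R by rewrite invr_gt0; lra.
have dV1 : d%:R^-1 <= 1 :> R by rewrite invf_le1; lra.
have -> : beta_rate R d = 1 - 3 / 4 * d%:R^-1.
  by rewrite /beta_rate; field; rewrite gt_eqF//; lra.
by apply/andP; split; lra.
Qed.

(** Convexity: each exponential lies above its tangent at [x0], and the hypothesis says that the
    slopes cancel. *)
Lemma sum_expR_min (R : realType) (A B u v x0 x : R) : 0 <= A -> 0 <= B ->
  A * u * expR (x0 * u) + B * v * expR (x0 * v) = 0 ->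
  A * expR (x0 * u) + B * expR (x0 * v) <= A * expR (x * u) + B * expR (x * v).
Proof.
move=> A0 B0 e.
have tangent w : expR (x0 * w) * (1 + (x - x0) * w) <= expR (x * w).
  have -> : x * w = x0 * w + (x - x0) * w by ring.
  by rewrite expRD ler_wpM2l ?expR_ge0// expR_ge1Dx.
have := ler_wpM2l A0 (tangent u); have := ler_wpM2l B0 (tangent v).
have : (x - x0) * (A * u * expR (x0 * u) + B * v * expR (x0 * v)) = 0 by rewrite e mulr0.
by lra.
Qed.

Section optimal_level.
Variables (R : realType) (d : nat) (C1 L sigma : R).
Hypotheses (d0 : (0 < d)%N) (C10 : 0 < C1) (L0 : 0 < L) (sigma0 : 0 < sigma).

Let b : R := beta_rate R d.
Let D : R := ln 2 - ln b.
Let A : R := 2 * sigma ^+ 2.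
Let B : R := d%:R * L ^+ 2 * C1.
(** The derivative in [k] of [A * 2 ^ k / n + B * b ^ k] vanishes when [(2 / b) ^ k] equals
    [n * (B * - ln b / (A * ln 2))]. *)
Let C3 : R := ln (B * - ln b / (A * ln 2)).

Let b0 : 0 < b. Proof. by have := beta_rate_bounds R d0; rewrite -/b; lra. Qed.
Let lnb : ln b < 0.
Proof. by rewrite ln_lt0//; have := beta_rate_bounds R d0; rewrite -/b; lra. Qed.
Let ln2 : 0 < ln 2 :> R. Proof. by rewrite ln_gt0//; lra. Qed.
Let D0 : 0 < D. Proof. by rewrite /D; have := lnb; have := ln2; lra. Qed.
Let A0 : 0 < A. Proof. by rewrite mulr_gt0// exprn_gt0. Qed.
Let B0 : 0 < B. Proof. by rewrite !mulr_gt0// ?exprn_gt0// ltr0n. Qed.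

Let powRE (a x : R) : 0 < a -> a `^ x = expR (x * ln a).
Proof. by move=> a0; rewrite /powR gt_eqF. Qed.

Let kn n : R := optimal_level d C3 n.

Let knE n : kn n * D = ln n%:R + C3.
Proof. by rewrite /kn /optimal_level -/b -/D divfK// gt_eqF. Qed.

Lemma optimal_level_min n k : (0 < n)%N ->
  risk_bound d C1 L sigma n (kn n) <= risk_bound d C1 L sigma n k.
Proof.
move=> n0; have nR : 0 < n%:R :> R by rewrite ltr0n.
rewrite /risk_bound -/b -/A -/B !(powRE _ b0) !(powRE _ (ltr0n R 2)).
rewrite ![_ / n%:R]mulrC !mulrA.
apply: sum_expR_min; [by rewrite divr_ge0// ltW|exact: ltW|].
have e : expR (kn n * ln 2) = expR (kn n * ln b) * (n%:R * (B * - ln b / (A * ln 2))).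
  have -> : kn n * ln 2 = kn n * ln b + (ln n%:R + C3) by rewrite -knE /D; ring.
  rewrite !expRD !lnK ?posrE//; apply: divr_gt0; apply: mulr_gt0 => //.
  by rewrite oppr_gt0.
rewrite e; field.
by rewrite !gt_eqF.
Qed.

Let pow2_kn n : (0 < n)%N -> 2 `^ kn n = n%:R `^ (ln 2 / D) * 2 `^ (C3 / D).
Proof.
move=> n0; rewrite !powRE ?ltr0n// -expRD; congr expR.
have -> : kn n = (ln n%:R + C3) / D by rewrite -knE mulfK// gt_eqF.
by field; rewrite gt_eqF.
Qed.

Let powb_kn n : (0 < n)%N -> b `^ kn n = n%:R `^ (ln b / D) * b `^ (C3 / D).
Proof.
move=> n0; rewrite !powRE ?ltr0n// -expRD; congr expR.
have -> : kn n = (ln n%:R + C3) / D by rewrite -knE mulfK// gt_eqF.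
by field; rewrite gt_eqF.
Qed.

Let C4 : R := 4 * 2 `^ (C3 / D).

Lemma optimal_level_allowed (n a : nat) : (0 < n)%N ->
  C4 * n%:R `^ (ln 2 / D) <= a%:R -> 4 <= a%:R * 2 `^ (- kn n).
Proof.
move=> n0 h; rewrite powRN -ler_pdivrMr ?invr_gt0 ?powR_gt0// invrK pow2_kn//.
by apply: le_trans h; rewrite /C4 le_eqVlt; apply/orP; left; apply/eqP; ring.
Qed.

(** Rounding the level down decreases the variance term and multiplies the bias term by at most
    [b^-1]. *)
Let C : R := A * 2 `^ (C3 / D) + B * (b^-1 * b `^ (C3 / D)).

Lemma risk_bound_floor (n k : nat) : (0 < n)%N -> Num.floor (kn n) = k%:Z ->
  risk_bound d C1 L sigma n k%:R <= C * n%:R `^ (ln b / D).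
Proof.
move=> n0 hk; have nR : 0 < n%:R :> R by rewrite ltr0n.
have hk1 : k%:R <= kn n by have := ge_floor (kn n); rewrite hk.
have hk2 : kn n < k%:R + 1 by have := floorD1_gt (kn n); rewrite hk intrD.
rewrite /risk_bound -/b -/A -/B /C mulrDl.
(* Both terms have the same order in [n], because [ln 2 / D - 1 = ln b / D]. *)
have e : 2 `^ kn n / n%:R = n%:R `^ (ln b / D) * 2 `^ (C3 / D).
  rewrite pow2_kn// !(powRE _ nR) (_ : ln 2 / D * ln n%:R = ln b / D * ln n%:R + ln n%:R).
    by rewrite expRD lnK ?posrE//; field; rewrite gt_eqF.
  by rewrite /D; field; rewrite gt_eqF.
apply: lerD.
  rewrite -mulrA ler_wpM2l ?(ltW A0)// [_ * n%:R `^ _]mulrC -e ler_wpM2r ?invr_ge0//.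
  by rewrite ler_powR// ler1n.
rewrite -mulrA ler_wpM2l ?(ltW B0)//.
rewrite -mulrA [b `^ _ * _]mulrC -powb_kn// ler_pdivlMl//.
rewrite -{1}[b]powRr1 ?(ltW b0)// -powRD; last by rewrite (gt_eqF b0) implybT.
rewrite !powRE// ler_expR ler_wnM2r ?(ltW lnb)//.
by rewrite addrC ltW.
Qed.

Lemma exists_optimal_constants : exists C3 C4 C : R, [/\ 0 < C4, 0 < C,
  forall n : nat, (0 < n)%N -> forall k : R,
    risk_bound d C1 L sigma n (optimal_level d C3 n)
      <= risk_bound d C1 L sigma n k,
  forall n a : nat, (0 < n)%N ->
    C4 * n%:R `^ (ln 2 / (ln 2 - ln (beta_rate R d))) <= a%:R ->
    4 <= a%:R * 2 `^ (- optimal_level d C3 n) &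
  forall n k : nat, (0 < n)%N -> Num.floor (optimal_level d C3 n) = k%:Z ->
    risk_bound d C1 L sigma n k%:R <=
      C * n%:R `^ (ln (beta_rate R d) / (ln 2 - ln (beta_rate R d)))].
Proof.
exists C3, C4, C; split.
- by rewrite mulr_gt0// powR_gt0.
- have p2 : 0 < 2 `^ (C3 / D) by rewrite powR_gt0.
  have pb : 0 < b^-1 * b `^ (C3 / D) by apply: mulr_gt0; rewrite ?invr_gt0 ?powR_gt0.
  exact: addr_gt0 (mulr_gt0 A0 p2) (mulr_gt0 B0 pb).
- by move=> n n0 k; exact: optimal_level_min.
- exact: optimal_level_allowed.
- exact: risk_bound_floor.
Qed.

End optimal_level.

Lemma forest_risk_le_risk_bound (R : realType) (d : nat) (disp : measure_display)
    (T : measurableType disp) (P : probability T R)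
    (X0 : {RV P >-> d.-tuple R}) (Y0 : {RV P >-> R}) (m : d.-tuple R -> R)
    (L sigma : R) (n : nat) (X : 'I_n -> {RV P >-> d.-tuple R})
    (Y : 'I_n -> {RV P >-> R}) (a k : nat) (x : d.-tuple R) :
  (0 < d)%N -> 0 <= L ->
  regression_model P X0 Y0 m L sigma -> iid_copies P X0 Y0 X Y ->
  admissible R n a k -> in_cube x ->
  (forest_risk P m X Y a k x <= (risk_bound d (expR 6) L sigma n k%:R)%:E)%E.
Proof.
move=> d0 L0 model iid [han hak] xc.
have hk : (4 * 2 ^ k <= a)%N.
  by rewrite -(ler_nat R) natrM natrX; rewrite ler_pdivlMr ?exprn_gt0// in hak.
apply: le_trans (forest_risk_le_contraction model iid L0 d0 han hk xc) _.
have b0 : 0 <= beta_rate R d by have := beta_rate_bounds R d0; lra.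
rewrite lee_fin /risk_bound !powR_mulrn// lerD2l -[leRHS]mulrA.
by rewrite ler_wpM2l ?median_contraction_le// mulr_ge0// sqr_ge0.
Qed.

Theorem theorem3p1 (R : realType) (d : nat) (hd : (1 <= d)%N) :
  exists2 C1 : R, 0 < C1 &
  forall L sigma : R, 0 < L -> 0 < sigma ->
  (forall (disp : measure_display) (T : measurableType disp)
     (P : probability T R) (X0 : {RV P >-> d.-tuple R}) (Y0 : {RV P >-> R})
     (m : d.-tuple R -> R) (n : nat)
     (X : 'I_n -> {RV P >-> d.-tuple R}) (Y : 'I_n -> {RV P >-> R})
     (a k : nat) (x : d.-tuple R),
     regression_model P X0 Y0 m L sigma -> iid_copies P X0 Y0 X Y ->
     admissible R n a k -> in_cube x ->
     (forest_risk P m X Y a k x <= (risk_bound d C1 L sigma n k%:R)%:E)%E) /\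
  (exists C3 C4 C : R, [/\ 0 < C4, 0 < C,
     forall n : nat, (0 < n)%N -> forall k : R,
       risk_bound d C1 L sigma n (optimal_level d C3 n)
         <= risk_bound d C1 L sigma n k,
     forall n a : nat, (0 < n)%N ->
       C4 * n%:R `^ (ln 2 / (ln 2 - ln (beta_rate R d))) <= a%:R ->
       4 <= a%:R * 2 `^ (- optimal_level d C3 n)
   & forall (disp : measure_display) (T : measurableType disp)
       (P : probability T R) (X0 : {RV P >-> d.-tuple R}) (Y0 : {RV P >-> R})
       (m : d.-tuple R -> R) (n : nat)
       (X : 'I_n -> {RV P >-> d.-tuple R}) (Y : 'I_n -> {RV P >-> R})
       (a k : nat) (x : d.-tuple R),
       regression_model P X0 Y0 m L sigma -> iid_copies P X0 Y0 X Y ->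
       C4 * n%:R `^ (ln 2 / (ln 2 - ln (beta_rate R d))) <= a%:R ->
       Num.floor (optimal_level d C3 n) = k%:Z ->
       admissible R n a k -> in_cube x ->
       (forest_risk P m X Y a k x <=
         (C * n%:R `^ (ln (beta_rate R d)
                       / (ln 2 - ln (beta_rate R d))))%:E)%E]).

Proof.
have d0 : (0 < d)%N := hd.
(* The constant of [median_contraction_le], the same for every [d]. *)
exists (expR 6); first exact: expR_gt0.
move=> L sigma L0 sigma0.
have risk := fun disp T P X0 Y0 m n X Y a k x => @forest_risk_le_risk_bound R d disp T P
  X0 Y0 m L sigma n X Y a k x d0 (ltW L0).
split; first exact: risk.
have [C3 [C4 [C [C40 C0 hmin hallow hfloor]]]] :=
  exists_optimal_constants d0 (expR_gt0 6) L0 sigma0.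
exists C3, C4, C; split => // disp T P X0 Y0 m n X Y a k x model iid _ hk adm xc.
apply: le_trans (risk _ _ _ _ _ _ _ _ _ _ _ _ model iid adm xc) _.
rewrite lee_fin; apply: hfloor hk.
case: adm => han hak; apply: leq_trans han; rewrite lt0n; apply/negP => /eqP a0.
by move: hak; rewrite a0 mul0r; lra.
Qed.
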